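(* Let $d\in\mathbb N$, $p\in[2,\infty)$ and put $\eta:=1/q-1/2$. Apply the Weak Chebyshev Greedy Algorithm with weakness parameter $t\in(0,1]$ to $f\in L_p$ with respect to the real $d$-variate trigonometric system $\mathcal{RT}^d_p$ normalized in $L_p$, and let $f_m$ be the residual after $m$ iterations. If $f\in\mathbf W^r_q$, then $$ \|f_m\|_{p} \ll \begin{cases} m^{-r+\eta}(\log m)^{(d-1)(r-2\eta)+r-\eta}, & 1<q\le 2,\quad r>1/q,\\ m^{-r}(\log m)^{rd}, & 2\le q<\infty, \quad r>1/2.\end{cases} $$
   Context: Functions are real-valued and $2\pi$-periodic in each of $d$ variables; $\mathbb T^d=[0,2\pi)^d$ carries the normalized Lebesgue measure $(2\pi)^{-d}d\mathbf x$, $L_p=L_p(\mathbb T^d)$ is the real Banach space with norm $\|\cdot\|_p$, and $(f\ast g)(\mathbf x)=(2\pi)^{-d}\int_{\mathbb T^d}f(\mathbf y)g(\mathbf x-\mathbf y)\,d\mathbf y$. Dictionary: $\mathcal{RT}^d_p$ is the set of all products $\prod_{j=1}^d u_j(x_j)$, where each $u_j$ is one of the functions $1,\sin x,\cos x,\sin 2x,\cos 2x,\dots$, normalized to have norm $1$ in $L_p$. For a nonzero $g$ in a real Banach space $X$, $F_g$ denotes a norming functional: $\|F_g\|_{X^*}=1$, $F_g(g)=\|g\|_X$. Weak Chebyshev Greedy Algorithm (WCGA) with parameter $t\in(0,1]$ with respect to a dictionary $\mathcal D\subset X$: set $f_0:=f$. For each $m\ge1$: (1) $\varphi_m\in\mathcal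 D$ is any element satisfying $|F_{f_{m-1}}(\varphi_m)|\ge t\sup_{g\in\mathcal D}|F_{f_{m-1}}(g)|$; (2) $\Phi_m:=\operatorname{span}\{\varphi_j\}_{j=1}^m$ and $G_m$ is the best approximant to $f$ from $\Phi_m$ in $X$; (3) $f_m:=f-G_m$. (If $f_{m-1}=0$ the algorithm stops and subsequent residuals are $0$.) Here $X=L_p$, $\mathcal D=\mathcal{RT}^d_p$. For $r>0$ let $F_r(x):=1+2\sum_{k=1}^\infty k^{-r}\cos(kx-r\pi/2)$ (univariate), $F_r(\mathbf x):=\prod_{j=1}^d F_r(x_j)$, and $\mathbf W^r_q:=\{f: f=\varphi\ast F_r,\ \|\varphi\|_q\le 1\}$. The sign $\ll$ means that the left side is at most $C$ times the right side for all integers $m\ge2$ and all $f\in\mathbf W^r_q$, with $C>0$ independent of $m$ and $f$ (it may depend on $r,p,q,d,t$). *)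

(* Defs.v *)
From HB Require Import structures.
From mathcomp Require Import all_boot all_order all_algebra.
From mathcomp Require Import all_classical all_reals all_analysis.

Set Implicit Arguments.
Unset Strict Implicit.
Unset Printing Implicit Defensive.

Import Order.TTheory GRing.Theory Num.Theory.
Import numFieldNormedType.Exports.

Local Open Scope classical_set_scope.
Local Open Scope ring_scope.

(* [nrm] need not separate points: the intended [X] consists of functions
   rather than of classes modulo almost everywhere equality, so "g = 0" in the
   Banach space reads [nrm g = 0]. *)
Section greedy.
Variables (R : realType) (X : lmodType R) (nrm : X -> R).

(* Extended-real supremum: [+oo] for an unbounded functional. *)
Definition dual_norm (F : {scalar X}) : \bar R :=
  ereal_sup [set `|F h|%:E | h in [set h | nrm h <= 1]].

Definition norming_functional (F : {scalar X}) (g : X) : Prop :=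
  dual_norm F = 1%E /\ F g = nrm g.

Definition span_upto (phi : nat -> X) (m : nat) : set X :=
  [set h | exists c : nat -> R, h = \sum_(1 <= j < m.+1) c j *: phi j].

Definition best_approximant (f : X) (V : set X) (G : X) : Prop :=
  V G /\ forall h, V h -> nrm (f - G) <= nrm (f - h).

(* Iteration [k.+1], from the residual [res k] to the residual [res k.+1]. *)
Definition wcga_step (D : set X) (t : R) (f : X)
    (phi G res : nat -> X) (k : nat) : Prop :=
  exists F : {scalar X},
    [/\ norming_functional F (res k),
        D (phi k.+1) /\
        (t%:E * ereal_sup [set `|F g|%:E | g in D] <= `|F (phi k.+1)|%:E)%E,
        best_approximant f (span_upto phi k.+1) (G k.+1) &
        res k.+1 = f - G k.+1].

(* [fm] is a residual after [m] iterations, for some admissible choice of the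
   norming functionals, of the dictionary elements and of the approximants. *)
Definition wcga_residual (D : set X) (t : R) (f : X) (m : nat) (fm : X) :
    Prop :=
  exists phi G res : nat -> X,
    [/\ res 0%N = f, res m = fm &
        forall k, (k < m)%N ->
          (nrm (res k) = 0 -> nrm (res k.+1) = 0) /\
          (nrm (res k) <> 0 -> wcga_step D t f phi G res k)].

End greedy.

(* The torus is R^d with a probability measure concentrated on [0, 2pi]^d:
   functions on it matter only almost everywhere for this measure, so that
   their values outside a period cell play no role. *)
Section torus.
Variable R : realType.

Lemma twopi_gt0 : (0 : R) < 2 * pi.
Proof. by rewrite mulr_gt0// pi_gt0. Qed.

Definition circle : probability (measurableTypeR R) R :=
  uniform_prob twopi_gt0.

Definition Rd (d : nat) := (d.-tuple (measurableTypeR R))%type.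

Definition tcons n (z : measurableTypeR R * Rd n) : Rd n.+1 :=
  [the n.+1.-tuple (measurableTypeR R) of z.1 :: z.2].

Lemma measurable_tcons n : measurable_fun [set: _] (@tcons n).
Proof. exact: measurable_cons. Qed.

HB.instance Definition _ n :=
  isMeasurableFun.Build _ _ _ _ (@tcons n) (@measurable_tcons n).

(* The d-fold product of [circle], i.e., (2pi)^-d dx on [0, 2pi]^d. *)
Fixpoint torus (d : nat) : probability (Rd d) R :=
  match d with
  | 0%N => \d_([tuple] : Rd 0)
  | n.+1 => distribution (circle \x torus n)%E (@tcons n)
  end.

Definition subRd d (x y : Rd d) : Rd d :=
  [tuple (tnth x i : R) - tnth y i | i < d].

Definition convolution d (f g : Rd d -> R) (x : Rd d) : R :=
  \int[torus d]_y (f y * g (subRd x y)).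

(* 1, sin x, cos x, sin 2x, cos 2x, ... for k = 0, 1, 2, 3, 4, ... *)
Definition trig (k : nat) (x : R) : R :=
  if odd k then sin ((uphalf k)%:R * x) else cos (k./2%:R * x).

Definition ntrig (p : R) (k : nat) (x : R) : R :=
  trig k x / fine ('N[circle]_(p%:E)[EFin \o trig k])%E.

(* The series converges for r > 0 and x outside 2 pi Z; on 2 pi Z it may
   diverge, and [limn] then returns an unspecified value, on a null set. *)
Definition F1 (r : R) (x : R) : R :=
  1 + 2 * limn (fun n => \sum_(1 <= k < n)
                  (k%:R `^ (- r)) * cos (k%:R * x - r * pi / 2)).

Definition Fd d (r : R) (x : Rd d) : R := \prod_(i < d) F1 r (tnth x i).

Definition W d (r q : R) : set (Rd d -> R) :=
  [set f | exists phi : Rd d -> R,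
    [/\ phi \in Lfun (torus d) q%:E,
        ('N[torus d]_(q%:E)[EFin \o phi] <= 1)%E &
        f = convolution phi (@Fd d r) %[ae torus d]]].

End torus.

Section Lp.
Variables (R : realType) (d : nat).

Lemma ge2_ge1 (p : R) : 2 <= p -> (1 <= p%:E)%E.
Proof. by move=> p2; rewrite lee_fin (le_trans _ p2)// ler1n. Qed.

Variables (p : R) (p1 : (1 <= p%:E)%E).

Definition Lp := LfunType (torus R d) p1.

Definition Lp_norm (f : Lp) : R := fine ('N[torus R d]_(p%:E)[EFin \o f])%E.

Definition RT : set Lp :=
  [set g | exists k : 'I_d -> nat,
    forall x : Rd R d, g x = \prod_(i < d) ntrig p (k i) (tnth x i)].

End Lp.

(* Main.v *)
(** The proof bounds the residuals directly, without any sparse approximation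
of [f].  On a probability space the [L_2] norm is at most the [L_q] norm for
[q >= 2], so that it suffices to treat [1 < q <= 2].

Let [h = f - g] be a residual, [F] its norming functional, and [M] the supremum
of [|F|] over the dictionary.  [F] kills the elements chosen so far, because [g]
is a best approximant.  Expand [f] in the trigonometric system.  For a
frequency not chosen so far the coefficient of [f] is proportional to that of
[h]; Bessel's inequality over the hyperbolic cross of size [L], which has at
most [L (1 + ln L)^(d-1)] elements, and the decay of the coefficients of [f]
outside of it give
  [F h <= M (kap |h| + tau)],
with [kap^2] of order [L (1 + ln L)^(d-1)] and [tau] the l^1 tail of the
coefficients.  The tail is controlled through the multivariate Hardy-Littlewood
inequality [sum_a W(a)^(q-2) |c_a|^q <= C |phi|_q^q], [W(a) = prod (a_i + 1)],
and Hoelder's inequality.  So, as long as [|h| > tau / kap], some dictionary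
element satisfies [|F| >= 1 / (2 kap)], and the smoothness of [L_p], [p >= 2],
makes the norm decrease by a factor [1 - c / kap^2] at each step.  Choosing [L]
of order [m / (ln m)^d] balances [tau / kap] against [exp (- c m / kap^2)]. *)
Require Import Defs.
From HB Require Import structures.
From mathcomp Require Import all_boot all_order all_algebra.
From mathcomp Require Import all_classical all_reals all_analysis.
From mathcomp Require Import measurable_realfun zify lra ring.

Set Implicit Arguments.
Unset Strict Implicit.
Unset Printing Implicit Defensive.

Import Order.TTheory GRing.Theory Num.Theory.
Import numFieldNormedType.Exports.

Local Open Scope classical_set_scope.
Local Open Scope ring_scope.

(** The Hardy-Littlewood inequality is used rather than Hausdorff-Young because it yields the
    smaller power of the logarithm. It gives [tau] of order L^(1/q-r) (1 + ln L)^((d-1)(1/2-eta)),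
    so that [tau / kap] is of order L^(-(r-eta)) (1 + ln L)^(-(d-1)eta); with Hausdorff-Young the
    last exponent would be +(d-1)eta. For L of order m / (ln m)^d this is m^(-(r-eta)) (ln
    m)^(d(r-eta)-(d-1)eta), the claimed rate, and m / kap^2 is a large multiple of ln m. The main
    obstacle is the expansion of [f]: the kernel is a series that need not converge absolutely, [f]
    is a convolution only almost everywhere, and [phi] is merely in L_q. All sums are therefore
    finite sums over cubes of indices, bounded uniformly in the size of the cube. Convergence in L^1
    identifies the limit as [f], and summability of the coefficients makes the convergence uniform.
    The phase r pi / 2 of the kernel is moved onto [phi], whose coefficients are taken in a
    phase-shifted system, so that [f] itself expands in the dictionary. *)

(** * The greedy algorithm in a smooth seminormed space *)

Section greedy_rate.
Variables (R : realType) (X : lmodType R) (nrm : X -> R).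
Hypothesis nrm_ge0 : forall x, 0 <= nrm x.
Hypothesis nrmZ : forall (a : R) x, nrm (a *: x) = `|a| * nrm x.
Variable gam : R.
Hypothesis gam_gt0 : 0 < gam.
(** Uniform smoothness of power type 2 in homogeneous form: relative to [nrm x], the second
    difference at [x] is quadratic in [nrm y / nrm x]. *)
Hypothesis nrm_smooth : forall x y, 0 < nrm x ->
  nrm (x + y) + nrm (x - y) <= 2 * nrm x + gam * (nrm y ^+ 2 / nrm x).

(** Besides rescaling to the unit ball, the point is that [nrm] may vanish at a nonzero vector: all
    its multiples then lie in the unit ball, and a nonzero value of [F] could be scaled up to 2. *)
Lemma dual_norm_le (F : {scalar X}) : dual_norm nrm F = 1%E ->
  forall x, `|F x| <= nrm x.
Proof.
move=> F1 x.
have le1 y : nrm y <= 1 -> `|F y| <= 1.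
  move=> y1; rewrite -lee_fin -F1; apply: ereal_sup_ubound.
  by exists y.
have [x0|x0] := eqVneq (nrm x) 0; last first.
  have xp : 0 < nrm x by rewrite lt_def x0 nrm_ge0.
  have := le1 ((nrm x)^-1 *: x).
  have i0 : 0 <= (nrm x)^-1 by rewrite invr_ge0.
  rewrite nrmZ linearZ normrM (ger0_norm i0) mulVf// => /(_ (lexx _)).
  by rewrite ler_pdivrMl// mulr1.
rewrite x0 leNgt; apply/negP => Fx0.
have := le1 ((2 / `|F x|) *: x).
rewrite nrmZ x0 mulr0 linearZ /= normrM => /(_ ler01).
by rewrite ger0_norm ?divr_ge0// -mulrA mulVf ?gt_eqF// mulr1; lra.
Qed.

(** Adding [nrm x + a * F y <= nrm (x + a *: y)] to the minimality at [x - a *: y] and using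
    smoothness gives [a * F y = O(a ^ 2)] for both signs of [a]. *)
Lemma norming_orthogonal (F : {scalar X}) (x y : X) :
  norming_functional nrm F x -> 0 < nrm x ->
  (forall a, nrm x <= nrm (x - a *: y)) -> F y = 0.
Proof.
move=> [F1 Fx] x0 xmin.
have key a : a * F y <= gam * (a ^+ 2 * (nrm y ^+ 2 / nrm x)).
  have := nrm_smooth (a *: y) x0.
  have := xmin a.
  have := dual_norm_le F1 (x + a *: y).
  rewrite linearD linearZ /= Fx nrmZ exprMn real_normK ?num_real// mulrA.
  have := ler_norm (nrm x + a * F y); lra.
apply/eqP; case: (eqVneq (F y) 0) => // Fy.
set c := gam * (nrm y ^+ 2 / nrm x).
have c0 : 0 <= c by rewrite mulr_ge0 ?divr_ge0 ?sqr_ge0 ?(ltW x0) ?(ltW gam_gt0).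
(* For [u = F y / (c + 1)] the bound reads [u ^ 2 * (c + 1) <= u ^ 2 * c], which forces [u = 0]. *)
have := key (F y / (c + 1)).
rewrite [leRHS](_ : _ = (F y / (c + 1)) ^+ 2 * c); last by rewrite /c; ring.
have cp : 0 < c + 1 by lra.
have Fyu : F y = F y / (c + 1) * (c + 1) by rewrite mulfVK ?gt_eqF.
set u := F y / (c + 1) in Fyu *.
have u0 : u != 0 by apply: contraNneq Fy => u0; rewrite Fyu u0 mul0r.
have : 0 < u ^+ 2 by rewrite exprn_even_gt0.
by rewrite Fyu; lra.
Qed.

Variables (D : set X) (t B : R) (f : X) (kap tau : R).
Hypotheses (t_gt0 : 0 < t) (B_gt0 : 0 < B) (kap_gt0 : 0 < kap) (tau_ge0 : 0 <= tau).
Hypothesis D_bounded : forall g, D g -> nrm g <= B.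
(* Applied to the norming functional of [f - g], whose norm is then bounded by
   the right-hand side: either [nrm (f - g) <= tau / kap], or [1 <= 2 * M * kap]. *)
Hypothesis f_concentrated : forall (F : {scalar X}) (phi : nat -> X) (k : nat)
    (g : X) (M : R),
  (forall x, `|F x| <= nrm x) ->
  (forall j, (1 <= j <= k)%N -> D (phi j) /\ F (phi j) = 0) ->
  span_upto phi k g -> (forall h, D h -> `|F h| <= M) ->
  F (f - g) <= M * (kap * nrm (f - g) + tau).

(** Smoothness bounds [nrm (x - b *: y)] by [nrm x - b * F y + gam * b ^ 2 * B ^ 2 / nrm x], and the
    witness [b] minimizes this quadratic. *)
Lemma greedy_decrease (F : {scalar X}) (x y : X) :
  norming_functional nrm F x -> 0 < nrm x -> nrm y <= B ->
  exists a : R, nrm (x - a *: y) <= nrm x * (1 - `|F y| ^+ 2 / (4 * gam * B ^+ 2)).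
Proof.
move=> [F1 Fx] x0 yB.
pose b := 2^-1 / (gam * B ^+ 2) * nrm x * F y.
exists b.
have := nrm_smooth (b *: y) x0.
have := dual_norm_le F1 (x + b *: y).
rewrite linearD linearZ /= Fx nrmZ exprMn (real_normK (num_real b)).
have := ler_norm (nrm x + b * F y).
have yB2 : nrm y ^+ 2 <= B ^+ 2 by rewrite lerXn2r// nnegrE ?(ltW B_gt0).
have : gam * (b ^+ 2 * nrm y ^+ 2 / nrm x) <= gam * (b ^+ 2 * B ^+ 2 / nrm x).
  by rewrite ler_pM2l// ler_pM2r ?invr_gt0// ler_wpM2l// sqr_ge0.
have -> : gam * (b ^+ 2 * B ^+ 2 / nrm x) = 2^-1 * (b * F y).
  by rewrite /b; field; rewrite ?gt_eqF.
have -> : nrm x * (1 - `|F y| ^+ 2 / (4 * gam * B ^+ 2)) = nrm x - 2^-1 * (b * F y).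
  by rewrite (real_normK (num_real _)) /b; field; rewrite ?gt_eqF.
lra.
Qed.

Lemma span_upto0 (phi : nat -> X) m : span_upto phi m 0.
Proof. by exists (fun=> 0); rewrite big1// => j _; rewrite scale0r. Qed.

Lemma span_upto_addZ (phi : nat -> X) m g (a : R) j : (1 <= j <= m)%N ->
  span_upto phi m g -> span_upto phi m (g + a *: phi j).
Proof.
move=> jm [c ->]; exists (fun i => c i + (if i == j then a else 0)).
under [RHS]eq_bigr do rewrite scalerDl.
rewrite big_split/=; congr (_ + _).
rewrite (big_rem j)/=; last by rewrite mem_index_iota ltnS.
rewrite eqxx big_seq big1 ?addr0// => i.
rewrite mem_rem_uniq ?iota_uniq// inE => /andP[/negbTE -> _].
by rewrite scale0r.
Qed.

Lemma span_uptoS (phi : nat -> X) m : span_upto phi m `<=` span_upto phi m.+1.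
Proof.
move=> g [c ->]; exists (fun i => if (i <= m)%N then c i else 0).
rewrite [RHS]big_nat_recr//= ltnn scale0r addr0.
by apply: eq_big_nat => i; rewrite ltnS => /andP[_ ->].
Qed.

Lemma greedy_rate m fm : wcga_residual nrm D t f m fm ->
  nrm fm <= Num.max (tau / kap)
    (nrm f * expR (- (t ^+ 2 / (16 * gam * B ^+ 2)) * (m%:R / kap ^+ 2))).
Proof.
move=> [phi [G [res [res0 <- step]]]].
(* After a vanishing residual nothing is known about [phi] and [G], so the state is described only
   while the residual is nonzero. *)
have inv k : (k <= m)%N -> nrm (res k) <> 0 ->
    [/\ forall j, (1 <= j <= k)%N -> D (phi j) &
      exists g, [/\ span_upto phi k g, res k = f - g &
        forall h, span_upto phi k h -> nrm (f - g) <= nrm (f - h)]].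
  elim: k => [_ _|k IH km rk].
    split; first by move=> [].
    exists 0; split; [exact: span_upto0|by rewrite subr0|].
    by move=> h [c ->]; rewrite big_geq.
  have [stop run] := step _ km.
  have rk0 : nrm (res k) <> 0 by move/stop.
  have [F [_ [Dphi _] [spG minG] ->]] := run rk0.
  have [Dk _] := IH (ltnW km) rk0.
  split; last by exists (G k.+1).
  by move=> j /andP[j1]; rewrite leq_eqVlt => /predU1P[->//|jk]; apply: Dk; rewrite j1.
(* [c / kap ^ 2] is the gain of [greedy_decrease] when [|F y| = t / (2 * kap)], hence
   [16 = 4 * 2 ^ 2]. *)
set c := t ^+ 2 / (16 * gam * B ^+ 2).
have c0 : 0 < c by rewrite divr_gt0 ?exprn_gt0 ?mulr_gt0 ?exprn_gt0.
suff H k : (k <= m)%N ->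
    nrm (res k) <= Num.max (tau / kap) (nrm f * expR (- c * (k%:R / kap ^+ 2))).
  exact: H.
elim: k => [|k IH] km; first by rewrite res0 mul0r mulr0 expR0 mulr1 le_max lexx orbT.
have [stop run] := step _ km.
have [/stop ->|/eqP rk0] := pselect (nrm (res k) = 0).
  by rewrite le_max divr_ge0// ltW.
have rkp : 0 < nrm (res k) by rewrite lt_def rk0 nrm_ge0.
have [Dk [g [spg rkE ming]]] := inv k (ltnW km) (elimN eqP rk0).
have [F [nF [Dphi supF] [spG minG] rSE]] := run (elimN eqP rk0).
have Fphi0 j : (1 <= j <= k)%N -> F (phi j) = 0.
  move=> jk; apply: (norming_orthogonal nF rkp) => a.
  rewrite rkE -addrA -opprD; apply: ming; exact: span_upto_addZ.
have MF h : D h -> `|F h| <= `|F (phi k.+1)| / t.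
  move=> Dh; rewrite ler_pdivlMr// mulrC -lee_fin EFinM.
  apply: le_trans supF; rewrite lee_pmul2l ?lte_fin//.
  by apply: ereal_sup_ubound; exists h.
have := f_concentrated (dual_norm_le nF.1)
  (fun j jk => conj (Dk j jk) (Fphi0 j jk)) spg MF.
rewrite -rkE nF.2 => lowF.
have next (y : X) : span_upto phi k.+1 (f - y) -> nrm (res k.+1) <= nrm y.
  by move=> spy; rewrite rSE (le_trans (minG _ spy))// opprB addrC subrK.
have mono : nrm (res k.+1) <= nrm (res k).
  by apply: next; rewrite rkE opprB addrC subrK; exact: span_uptoS.
(* Once the threshold is reached, monotonicity of the norms of the residuals suffices. *)
have [small|big] := leP (nrm (res k)) (tau / kap).
  by rewrite le_max (le_trans mono small).
(* Above the threshold [tau < kap * nrm (res k)], so [lowF] bounds [nrm (res k)] by [|F (phi k.+1)|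
   / t * (2 * kap * nrm (res k))], and the norm cancels. *)
have Flow : t / (2 * kap) <= `|F (phi k.+1)|.
  rewrite ler_pdivrMr ?mulr_gt0//.
  move: big; rewrite ltr_pdivrMr// => big.
  set u := `|F _| in lowF *.
  have u0 : 0 <= u by exact: normr_ge0.
  have : nrm (res k) <= u / t * (2 * kap * nrm (res k)).
    by apply: (le_trans lowF); rewrite ler_wpM2l ?divr_ge0 ?(ltW t_gt0)//; lra.
  have -> : u / t * (2 * kap * nrm (res k)) = (u * (2 * kap) / t) * nrm (res k) by ring.
  by rewrite -{1}(mul1r (nrm _)) ler_pM2r// ler_pdivlMr// mul1r.
(* The new best approximant is compared with the old [g] corrected by a multiple of the new
   element. *)
have [a dec] := greedy_decrease nF rkp (D_bounded Dphi).
have {dec} := le_trans (next _ _) dec.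
have -> : f - (res k - a *: phi k.+1) = g + a *: phi k.+1.
  by rewrite rkE -addrA -opprD opprB addrC subrK.
have spk : span_upto phi k.+1 (g + a *: phi k.+1).
  by apply: span_upto_addZ; rewrite ?leqnn//; exact: span_uptoS.
move=> /(_ spk) dec.
rewrite le_max; apply/orP; right.
have rk_le : nrm (res k) <= nrm f * expR (- c * (k%:R / kap ^+ 2)).
  by move: (IH (ltnW km)); rewrite le_max leNgt big.
have -> : - c * (k.+1%:R / kap ^+ 2) = - c * (k%:R / kap ^+ 2) + - (c / kap ^+ 2).
  by rewrite -natr1; field; rewrite gt_eqF.
rewrite expRD mulrA; apply: le_trans (ler_wpM2r (expR_ge0 _) rk_le).
apply: (le_trans dec).
rewrite ler_pM2l//; apply: le_trans (expR_ge1Dx _); rewrite lerD2l lerN2.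
have : (t / (2 * kap)) ^+ 2 <= `|F (phi k.+1)| ^+ 2.
  by rewrite lerXn2r// nnegrE// divr_ge0 ?mulr_ge0// ltW.
move=> h; rewrite (le_trans _ (ler_wpM2r _ h)) ?invr_ge0 ?mulr_ge0 ?exprn_ge0 ?(ltW gam_gt0) ?(ltW B_gt0)//.
rewrite le_eqVlt; apply/orP; left; apply/eqP.
by rewrite /c; field; rewrite ?gt_eqF.
Qed.
End greedy_rate.

(** * Smoothness of L_p for p >= 2 *)

Section Lp_smoothness.
Variable R : realType.
Implicit Types a b p : R.

(** The excess over 2 is the square of [expR (y / 2) - expR (- (y / 2))], which for [y >= 0] is at
    most [y * expR (y / 2)]. *)
Lemma expR_even_le (y : R) : expR y + expR (- y) <= 2 + y ^+ 2 * expR `|y|.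
Proof.
wlog y0 : y / 0 <= y.
  move=> H; have [/H//|/ltW y0] := leP 0 y.
  by have := H (- y); rewrite opprK sqrrN normrN oppr_ge0 y0 addrC; exact.
rewrite ger0_norm//.
have h1 : 0 <= expR (y / 2) - expR (- (y / 2)).
  by rewrite subr_ge0 ler_expR; lra.
have h2 : expR (y / 2) - expR (- (y / 2)) <= y * expR (y / 2).
  rewrite [leLHS](_ : _ = (1 - expR (- y)) * expR (y / 2)); last first.
    by rewrite mulrBl mul1r -expRD; congr (_ - expR _); lra.
  by rewrite ler_wpM2r ?expR_ge0//; have := expR_ge1Dx (- y); lra.
have := ler_pM h1 h1 h2 h2.
have e1 : expR (y / 2) * expR (y / 2) = expR y by rewrite -expRD; congr expR; lra.
have e2 : expR (- (y / 2)) * expR (- (y / 2)) = expR (- y) by rewrite -expRD; congr expR; lra.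
have e3 : expR (y / 2) * expR (- (y / 2)) = 1 by rewrite -expRD subrr expR0.
rewrite -[in _ ^+ 2 * _]e1 -[in X in _ -> X <= _]e1 -e2; nra.
Qed.

Lemma powR1D_le p (x : R) : 0 <= p -> -1 < x -> (1 + x) `^ p <= expR (p * x).
Proof.
move=> p0 x1; rewrite /powR gt_eqF; last lra.
by rewrite ler_expR ler_wpM2l// le_ln1Dx.
Qed.

Definition smooth_cst p : R := p ^+ 2 * expR p + 2 * 3 `^ p.

Lemma smooth_cst_ge0 p : 0 <= smooth_cst p.
Proof.
apply: addr_ge0; apply: mulr_ge0 => //; rewrite ?expR_ge0 ?powR_ge0//.
exact: sqr_ge0.
Qed.

(** If [|b| >= |a| / 2], both terms on the left are at most [(3 * |b|) ^ p]. Otherwise division by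
    [|a|] reduces to [1 + x] and [1 - x] with [|x| < 1/2], where [(1 + x) ^ p <= expR (p * x)] and
    [expR_even_le] apply. The two cases give the two summands of [smooth_cst]. *)
Lemma powR_smooth p a b : 2 <= p ->
  `|a + b| `^ p + `|a - b| `^ p <=
  2 * `|a| `^ p + smooth_cst p * (`|a| `^ (p - 2) * `|b| `^ 2 + `|b| `^ p).
Proof.
move=> p2; have p0 : 0 <= p by lra.
have c1 : 0 <= p ^+ 2 * expR p by rewrite mulr_ge0 ?sqr_ge0 ?expR_ge0.
have c2 : 0 <= 2 * 3 `^ p :> R by rewrite mulr_ge0 ?powR_ge0.
have [ba|ab] := ltP `|b| (`|a| / 2); last first.
  have h (u : R) : `|u| <= 3 * `|b| -> `|u| `^ p <= 3 `^ p * `|b| `^ p.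
    by move=> ub; rewrite -powRM// ge0_ler_powR ?nnegrE.
  have h1 := h (a + b); have h2 := h (a - b).
  have {h1} := h1 ltac:(by have := ler_normD a b; have := normr_ge0 b; lra).
  have {h2} := h2 ltac:(by have := ler_normB a b; have := normr_ge0 b; lra).
  have : 0 <= `|a| `^ p by exact: powR_ge0.
  have : 0 <= `|a| `^ (p - 2) * `|b| `^ 2 by rewrite mulr_ge0 ?powR_ge0.
  have : 0 <= `|b| `^ p by exact: powR_ge0.
  rewrite /smooth_cst; nra.
have a0 : a != 0.
  by apply/eqP => a0; move: ba; rewrite a0 normr0 mul0r ltNge normr_ge0.
have na0 : 0 < `|a| by rewrite normr_gt0.
have [x bE x1] : exists2 x, b = a * x & `|x| < 2^-1.
  exists (b / a); first by rewrite mulrC divfK.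
  by rewrite normf_div ltr_pdivrMr// mulrC.
have /andP[xl xu] : - 2^-1 < x < 2^-1 by rewrite -ltr_norml.
rewrite bE -[X in `|X + _|]mulr1 -[X in `|X - _|]mulr1 -mulrDr -mulrBr !normrM.
rewrite !powRM//.
have -> : `|a| `^ (p - 2) * (`|a| `^ 2 * `|x| `^ 2) = `|a| `^ p * `|x| ^+ 2.
  rewrite (powR_mulrn 2 (normr_ge0 x)) mulrA -powRD ?subrK//.
  by apply/implyP => _; rewrite gt_eqF.
suff H : `|1 + x| `^ p + `|1 - x| `^ p <= 2 + smooth_cst p * (`|x| ^+ 2 + `|x| `^ p).
  have := ler_wpM2l (powR_ge0 `|a| p) H; lra.
rewrite (@ger0_norm _ (1 + x)); last by lra.
rewrite (@ger0_norm _ (1 - x)); last by lra.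
apply: (@le_trans _ _ (expR (p * x) + expR (- (p * x)))).
  by rewrite lerD//; [|rewrite -mulrN]; apply: powR1D_le => //; lra.
apply: (le_trans (expR_even_le _)); rewrite lerD2l exprMn.
apply: (@le_trans _ _ (p ^+ 2 * expR p * x ^+ 2)).
  rewrite mulrAC ler_wpM2r ?sqr_ge0// ler_wpM2l ?sqr_ge0// ler_expR normrM (ger0_norm p0).
  by rewrite ler_piMr//; lra.
have : 0 <= `|x| `^ p by exact: powR_ge0.
rewrite (real_normK (num_real x)) /smooth_cst; have := sqr_ge0 x; nra.
Qed.

(** The mixed product is split into pure p-th powers, so that integration needs no Hoelder
    inequality. With [s] the ratio of the norms of [b] and [a], the term with [s ^ (- p)] integrates
    to the p-th power of the norm of [a], leaving a relative error [O(s ^ 2)]. *)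
Lemma powR_smooth_scaled p a b (s : R) : 2 <= p -> 0 < s <= 1 ->
  `|a + b| `^ p + `|a - b| `^ p <=
  2 * `|a| `^ p + 2 * smooth_cst p * s ^+ 2 * (`|a| `^ p + s `^ (- p) * `|b| `^ p).
Proof.
move=> p2 /andP[s0 s1]; apply: (le_trans (powR_smooth a b p2)).
have C0 := smooth_cst_ge0 p.
suff H : `|a| `^ (p - 2) * `|b| `^ 2 + `|b| `^ p <=
    2 * s ^+ 2 * (`|a| `^ p + s `^ (- p) * `|b| `^ p).
  have := ler_wpM2l C0 H; lra.
pose v := `|b| / s.
have v0 : 0 <= v by rewrite divr_ge0// ltW.
have bE : `|b| = s * v by rewrite /v mulrC divfK ?gt_eqF.
have -> : s `^ (- p) * `|b| `^ p = v `^ p.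
  rewrite bE powRM ?(ltW s0)// mulrA -powRD ?addNr ?powRr0 ?mul1r//.
  by rewrite (gt_eqF s0) implybT.
rewrite bE; move: v0 {bE}; move: v => v v0; rewrite !powRM ?(ltW s0)//.
have h1 : `|a| `^ (p - 2) * v `^ 2 <= `|a| `^ p + v `^ p.
  have powE (u : R) : 0 <= u -> u `^ p = u `^ (p - 2) * u `^ 2.
    move=> u0; have [->|un0] := eqVneq u 0.
      by rewrite (@powR0 _ p) ?gt_eqF ?(@powR0 _ 2) ?mulr0//; lra.
    by rewrite -powRD ?subrK// un0 implybT.
  have [av|va] := leP `|a| v.
    rewrite [v `^ p]powE// (@le_trans _ _ (v `^ (p - 2) * v `^ 2)) ?lerDr ?powR_ge0//.
    by rewrite ler_wpM2r ?powR_ge0// ge0_ler_powR ?nnegrE//; lra.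
  rewrite [`|a| `^ p]powE// (@le_trans _ _ (`|a| `^ (p - 2) * `|a| `^ 2)) ?lerDl ?powR_ge0//.
  by rewrite ler_wpM2l ?powR_ge0// ge0_ler_powR ?nnegrE// ltW.
have h2 : s `^ p <= s ^+ 2.
  by rewrite -(powR_mulrn 2 (ltW s0)) ger_powR// s0.
have sE : s `^ 2 = s ^+ 2 by rewrite powR_mulrn// ltW.
rewrite mulrCA sE.
have := ler_wpM2l (sqr_ge0 s) h1.
have := ler_wpM2r (powR_ge0 v p) h2.
have := powR_ge0 `|a| p; have := sqr_ge0 s; nra.
Qed.

(** Young's inequality with second factor 1, that is, the tangent to [x ^ p] at 1. *)
Lemma le_powR_conjugate p (x : R) : 1 < p -> 0 <= x -> x <= x `^ p / p + (1 - p^-1).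
Proof.
move=> p1 x0.
have p0 : 0 < p by lra.
have q0 : 0 < 1 - p^-1 by rewrite subr_gt0 invf_lt1.
have := @conjugate_powR R x 1 p (1 - p^-1)^-1 x0 ler01 p0.
by rewrite invr_gt0 q0 invrK addrC subrK powR1 mulr1 mul1r addrC => ->.
Qed.

Section Lfun_smooth.
Context d (T : measurableType d) (mu : {measure set T -> \bar R}).
Variables (p : R) (p1 : (1 <= p%:E)%E).
Hypothesis p2 : 2 <= p.
Let nm (f : LfunType mu p1) : R := fine ('N[mu]_(p%:E)[EFin \o f])%E.

Let p0 : 0 < p. Proof. exact: lt_le_trans p2. Qed.

Lemma Lnorm_powR (f : LfunType mu p1) : nm f `^ p = \int[mu]_x (`|f x| `^ p).
Proof.
apply: EFin_inj; rewrite -poweR_EFin finite_norm_fine powR_Lnorm ?gt_eqF//.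
rewrite /Rintegral fineK; first by [].
apply: integrable_fin_num => //; apply: Lfun_integrable; first by rewrite -lee_fin.
exact: LfunP.
Qed.

Lemma Lnorm_smooth (f g : LfunType mu p1) : 0 < nm f ->
  nm (f + g) + nm (f - g) <= 2 * nm f + (4 * smooth_cst p + 2) * (nm g ^+ 2 / nm f).
Proof.
move=> f0.
have nm0 h : 0 <= nm h by rewrite fine_ge0// Lnorm_ge0.
have C0 := smooth_cst_ge0 p.
pose s := nm g / nm f.
have s0 : 0 <= s by rewrite divr_ge0.
have gE : nm g = s * nm f by rewrite /s divfK ?gt_eqF.
have -> : nm g ^+ 2 / nm f = s ^+ 2 * nm f by rewrite gE; field; rewrite gt_eqF.
have tri : nm (f + g) + nm (f - g) <= 2 * nm f + 2 * nm g.
  have := ler_LnormD f g; have := ler_LnormD f (- g).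
  have := LnormrN g; rewrite -/(nm _) -/(nm _) => ->.
  rewrite -/(nm _) -/(nm _) -/(nm _) -/(nm _); lra.
(* For [s > 1] the triangle inequality is enough, since [2 * s <= 2 * s ^ 2]; this accounts for the
   summand 2 in the constant. *)
have [s1|s1] := ltP 1 s.
  apply: (le_trans tri); rewrite lerD2l gE mulrA mulrA; apply: ler_wpM2r; first exact: ltW.
  have := C0; nra.
have [sz|sn0] := eqVneq s 0.
  by apply: (le_trans tri); rewrite gE sz mul0r mulr0 addr0 expr0n/= mul0r mulr0 addr0.
have sp : 0 < s by rewrite lt_def sn0.
have If (h : LfunType mu p1) : mu.-integrable setT (EFin \o (fun x => `|h x| `^ p)).
  by apply: Lfun_integrable; [rewrite -lee_fin|exact: LfunP].
pose c := 2 * smooth_cst p * s ^+ 2.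
have key : nm (f + g) `^ p + nm (f - g) `^ p <= nm f `^ p * (2 + 2 * c).
  have sg : s `^ (- p) * nm g `^ p = nm f `^ p.
    rewrite gE powRM ?(ltW sp)// ?ltW// mulrA -powRD ?addNr ?powRr0 ?mul1r//.
    by rewrite (gt_eqF sp) implybT.
  have -> : nm f `^ p * (2 + 2 * c) =
      (2 + c) * nm f `^ p + c * s `^ (- p) * nm g `^ p.
    by rewrite -[in RHS]mulrA sg; ring.
  rewrite !Lnorm_powR -RintegralD// -!RintegralZl// -RintegralD//; last 2 first.
    - exact: (integrableZl measurableT (2 + c) (If f)).
    - exact: (integrableZl measurableT (c * s `^ (- p)) (If g)).
  apply: le_Rintegral => //.
  - exact: (integrableD measurableT (If (f + g)) (If (f - g))).
  - exact: (integrableD measurableT (integrableZl measurableT (2 + c) (If f))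
      (integrableZl measurableT (c * s `^ (- p)) (If g))).
  - move=> x _ /=.
    have := @powR_smooth_scaled p (f x) (g x) s p2; rewrite sp s1 => /(_ isT).
    rewrite -/c; lra.
have pA : 0 < nm f `^ p by rewrite powR_gt0.
(* The tangent at [nm f] turns the bound [key] on the sum of p-th powers into one on the sum of
   norms. *)
have h u : 0 <= u -> u <= nm f * (u `^ p / nm f `^ p / p + (1 - p^-1)).
  move=> u0; rewrite mulrC -ler_pdivrMr//.
  have p1' : 1 < p by apply: lt_le_trans p2; rewrite ltr1n.
  have := le_powR_conjugate p1' (divr_ge0 u0 (ltW f0)).
  have -> : (u / nm f) `^ p = u `^ p / nm f `^ p; last by [].
  rewrite powRM ?invr_ge0 ?(ltW f0)//; congr (_ * _).
  by rewrite -[in LHS]powR_inv1 ?(ltW f0)// powRAC powR_inv1 ?powR_ge0.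
have := h _ (nm0 (f + g)); have := h _ (nm0 (f - g)) => h1 h2.
apply: (le_trans (lerD h2 h1)).
have k1 : (nm (f + g) `^ p + nm (f - g) `^ p) / nm f `^ p / p <= (2 + 2 * c) / p.
  by rewrite ler_pM2r ?invr_gt0// ler_pdivrMr// mulrC.
have c0 : 0 <= c by rewrite /c; apply: mulr_ge0; [exact: mulr_ge0|exact: sqr_ge0].
have k2 : 2 * c / p <= 2 * c.
  rewrite ler_pdivrMr//; apply: ler_peMr; first exact: mulr_ge0.
  by apply: le_trans p2; rewrite ler1n.
rewrite -mulrDr [leRHS](_ : _ = nm f * (2 + 2 * c + 2 * s ^+ 2)); last by rewrite /c; ring.
rewrite ler_pM2l//.
move: k1 k2 (sqr_ge0 s); rewrite !mulrDl => k1 k2 k3; lra.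
Qed.

End Lfun_smooth.
End Lp_smoothness.

(** * Counting and summing over hyperbolic crosses *)

Section hyperbolic_sums.
Variable R : realType.

Lemma big_tuple_cons N n (G : n.+1.-tuple 'I_N -> R) :
  \sum_a G a = \sum_(k < N) \sum_(b : n.-tuple 'I_N) G [tuple of k :: b].
Proof.
rewrite pair_bigA/=.
rewrite (reindex (fun u : 'I_N * n.-tuple 'I_N => [tuple of u.1 :: u.2]))//=.
exists (fun a => (thead a, [tuple of behead a])) => [[k b] _|a _] /=.
  by congr pair; apply: val_inj.
by rewrite -tuple_eta.
Qed.

(** An index enumerates 1, sin x, cos x, sin 2x, ..., so [a_i + 1] is only comparable with the
    frequency, and it stays positive for the constant. *)
Definition tweight N d (a : d.-tuple 'I_N) : R := \prod_(i < d) (tnth a i).+1%:R.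

Lemma tweight_cons N n (k : 'I_N) (b : n.-tuple 'I_N) :
  tweight [tuple of k :: b] = k.+1%:R * tweight b.
Proof.
rewrite /tweight big_ord_recl tnth0; congr (_ * _).
by apply: eq_bigr => i _; rewrite tnthS.
Qed.

Lemma tweight_ge1 N d (a : d.-tuple 'I_N) : 1 <= tweight a.
Proof.
by rewrite /tweight; elim/big_ind: _ => // [x y|i _]; [exact: mulr_ege1|rewrite ler1n].
Qed.

Lemma tweight_gt0 N d (a : d.-tuple 'I_N) : 0 < tweight a.
Proof. exact: lt_le_trans (tweight_ge1 a). Qed.

Lemma inv_le_lnB k : k.+2%:R^-1 <= ln k.+2%:R - ln k.+1%:R :> R.
Proof.
rewrite -lerN2 opprB -ln_div ?posrE//.
have -> : k.+1%:R / k.+2%:R = 1 + - k.+2%:R^-1 :> R.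
  by rewrite -[k.+2%:R]natr1; field; rewrite gt_eqF// natr1.
by rewrite le_ln1Dx// ltrN2 invf_lt1// ltr1n.
Qed.

Lemma harmonic_le N (L : R) : 1 <= L ->
  \sum_(k < N | k.+1%:R <= L) k.+1%:R^-1 <= 1 + ln L.
Proof.
move=> L1; have L0 : 0 < L by rewrite (lt_le_trans _ L1).
(* The minimum lets the induction gain a difference of logarithms at each admissible index and
   nothing beyond [L]. *)
have H : \sum_(k < N.+1 | k.+1%:R <= L) k.+1%:R^-1 <= 1 + ln (Num.min N.+1%:R L).
  elim: N => [|N IH].
    rewrite big_mkcond big_ord_recr big_ord0/= L1 add0r invr1 lerDl ln_ge0//.
    by rewrite le_min lexx.
  rewrite big_mkcond big_ord_recr/= -big_mkcond/=.
  have [NL|LN] := leP N.+2%:R L.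
    have NL' : N.+1%:R <= L by apply: le_trans NL; rewrite ler_nat.
    rewrite (min_idPl NL') in IH.
    by apply: (le_trans (lerD IH (inv_le_lnB N))); lra.
  rewrite addr0 (le_trans IH)// lerD2l ler_ln ?posrE ?lt_min ?L0 ?ltr0n//.
  by rewrite ge_min lexx orbT.
apply: le_trans (le_trans H _).
  rewrite big_mkcond [leRHS]big_mkcond/= big_ord_recr/= lerDl.
  by case: ifP.
rewrite lerD2l ler_ln ?posrE ?lt_min ?L0 ?ltr0n//.
by rewrite ge_min lexx orbT.
Qed.

(** A discrete substitute for comparison with an integral. The natural bound has [k.+2 ^ (- b)] on
    the left; passing to [k.+1] costs [2 ^ b]. *)
Lemma powR_telescope (b : R) k : 1 < b ->
  k.+1%:R `^ (- b) <=
  2 `^ b / (b - 1) * (k.+1%:R `^ (1 - b) - k.+2%:R `^ (1 - b)) :> R.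
Proof.
move=> b1; have b0 : 0 < b - 1 by lra.
have h : (b - 1) * k.+2%:R `^ (- b) <= k.+1%:R `^ (1 - b) - k.+2%:R `^ (1 - b) :> R.
  have -> : k.+1%:R `^ (1 - b) = k.+2%:R `^ (1 - b) *
      expR ((b - 1) * (ln k.+2%:R - ln k.+1%:R)) :> R.
    rewrite /powR !gt_eqF ?ltr0n// -expRD; congr expR; ring.
  have -> : k.+2%:R `^ (- b) = k.+2%:R `^ (1 - b) * k.+2%:R^-1 :> R.
    by rewrite -powR_inv1// -powRD; [congr powR; ring|rewrite pnatr_eq0 implybT].
  rewrite -[X in _ <= _ - X]mulr1 -mulrBr mulrCA ler_wpM2l ?powR_ge0//.
  rewrite lerBrDl (le_trans _ (expR_ge1Dx _))// lerD2l.
  by rewrite ler_wpM2l ?(ltW b0)// inv_le_lnB.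
rewrite -mulrA -ler_pdivrMl ?powR_gt0// -ler_pdivrMl ?invr_gt0// invrK.
apply: le_trans h; rewrite ler_wpM2l ?(ltW b0)//.
rewrite mulrC -powRN -powRM// !powRN lef_pV2 ?posrE ?powR_gt0//.
rewrite ge0_ler_powR ?nnegrE//; first by lra.
by rewrite -natrM ler_nat muln2 -addnn addSnnS leq_addl.
Qed.

Lemma powR_tail N (b L : R) : 1 < b -> 0 < L ->
  \sum_(k < N | L < k.+1%:R) k.+1%:R `^ (- b) <= 2 `^ b / (b - 1) * L `^ (1 - b).
Proof.
move=> b1 L0; have c0 : 0 <= 2 `^ b / (b - 1).
  by rewrite divr_ge0 ?powR_ge0//; lra.
have anti (x y : R) : 0 < x -> x <= y -> y `^ (1 - b) <= x `^ (1 - b).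
  move=> x0 xy; have y0 := lt_le_trans x0 xy.
  rewrite -opprB !powRN lef_pV2 ?posrE ?powR_gt0//.
  by rewrite ge0_ler_powR ?nnegrE ?(ltW x0) ?(ltW y0)//; lra.
(* Telescoped form for the induction: the maximum stays at [L] until the first admissible index. *)
suff H : \sum_(k < N | L < k.+1%:R) k.+1%:R `^ (- b) <=
    2 `^ b / (b - 1) * (L `^ (1 - b) - (Num.max N.+1%:R L) `^ (1 - b)).
  by apply: (le_trans H); rewrite ler_wpM2l// gerBl powR_ge0.
elim: N => [|N IH].
  by rewrite big_ord0 mulr_ge0// subr_ge0 anti// le_max lexx orbT.
rewrite big_mkcond big_ord_recr/= -big_mkcond/=.
have [LN|NL] := ltP L N.+1%:R.
  rewrite (max_idPl (ltW LN)) in IH.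
  have LN2 : L <= N.+2%:R by rewrite (le_trans (ltW LN))// ler_nat.
  rewrite (max_idPl LN2).
  have := powR_telescope N b1; lra.
rewrite addr0; apply: (le_trans IH); rewrite ler_wpM2l// lerD2l lerN2.
by apply: anti; rewrite ?lt_max ?L0 ?orbT// ge_max !le_max ler_nat leqnSn lexx orbT.
Qed.

Lemma powR_sum_le N (b : R) : 1 < b ->
  \sum_(k < N) k.+1%:R `^ (- b) <= 2 `^ b / (b - 1) * 2^-1 `^ (1 - b).
Proof.
move=> b1; apply: le_trans (powR_tail N b1 _) => //.
rewrite le_eqVlt; apply/orP; left; apply/eqP; apply: eq_bigl => k.
by rewrite (lt_le_trans (y := 1)) ?ler1n// invf_lt1// ltr1n.
Qed.

(** Fixing the first index [k] leaves a cross of size [L / k.+1] in one dimension less; the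
    resulting harmonic sum contributes one logarithm. The first coordinate costs none, hence [d]
    logarithms for [d.+1] coordinates. *)
Lemma hyperbolic_count d N (L : R) : 1 <= L ->
  \sum_(a : d.+1.-tuple 'I_N | tweight a <= L) 1 <= L * (1 + ln L) ^+ d.
Proof.
elim: d L => [|d IH] L L1; have L0 : 0 < L by rewrite (lt_le_trans _ L1).
  rewrite expr0 mulr1 big_mkcond/= big_tuple_cons.
  have -> : \sum_(k < N) \sum_(b : 0.-tuple 'I_N)
      (if tweight [tuple of k :: b] <= L then 1 else 0) =
      \sum_(k < N | k.+1%:R <= L) (1 : R).
    rewrite [RHS]big_mkcond; apply: eq_bigr => k _.
    rewrite (eq_bigr (fun=> if k.+1%:R <= L then 1 else 0)); last first.
      by move=> b _; rewrite tweight_cons /tweight big_ord0 mulr1.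
    by rewrite sumr_const card_tuple expn0 mulr1n.
  have H : \sum_(k < N | k.+1%:R <= L) (1 : R) <= Num.min N%:R L.
    elim: N => [|N IH]; first by rewrite big_ord0 le_min lexx ltW.
    rewrite big_mkcond big_ord_recr/= -big_mkcond/=.
    have [NL|LN] := leP N.+1%:R L.
      have NL' : N%:R <= L by apply: le_trans NL; rewrite ler_nat.
      by rewrite (min_idPl NL') in IH; rewrite -natr1 lerD2r.
    by rewrite addr0 (le_trans IH)// ge_min lexx orbT.
  by apply: (le_trans H); rewrite ge_min lexx orbT.
rewrite big_mkcond/= big_tuple_cons.
apply: (@le_trans _ _ (\sum_(k < N | k.+1%:R <= L) L * (1 + ln L) ^+ d * k.+1%:R^-1)).
  rewrite [leRHS]big_mkcond/=; apply: ler_sum => k _.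
  have k0 : 0 < k.+1%:R :> R by [].
  have cE (b : d.+1.-tuple 'I_N) :
      (tweight [tuple of k :: b] <= L) = (tweight b <= L / k.+1%:R).
    by rewrite tweight_cons ler_pdivlMr// mulrC.
  under eq_bigr do rewrite cE.
  rewrite -big_mkcond/=; case: ifP => kL.
    have L1' : 1 <= L / k.+1%:R by rewrite ler_pdivlMr// mul1r.
    apply: (le_trans (IH _ L1')); rewrite mulrAC ler_pM2r ?invr_gt0// ler_pM2l//.
    apply: lerXn2r; rewrite ?nnegrE ?addr_ge0 ?ln_ge0//.
    rewrite lerD2l ler_ln ?posrE ?divr_gt0// ler_pdivrMr//.
    by rewrite ler_peMr ?(ltW L0)// ler1n.
  rewrite big_pred0// => b; apply/negbTE; rewrite -ltNge.
  apply: lt_le_trans (tweight_ge1 b).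
  by rewrite ltr_pdivrMr// mul1r ltNge kL.
rewrite -mulr_sumr exprSr mulrA ler_wpM2l ?harmonic_le//.
by rewrite mulr_ge0 ?(ltW L0)// exprn_ge0// addr_ge0 ?ln_ge0.
Qed.

Lemma tweight_sum_le (b : R) : 1 < b -> exists2 Z, 0 <= Z &
  forall d N, \sum_(a : d.-tuple 'I_N) tweight a `^ (- b) <= Z ^+ d.
Proof.
move=> b1; exists (2 `^ b / (b - 1) * 2^-1 `^ (1 - b)) => [|d N].
  by rewrite mulr_ge0 ?divr_ge0 ?powR_ge0//; lra.
elim: d => [|d IH].
  rewrite (eq_bigr (fun=> 1)); last first.
    by move=> a _; rewrite /tweight big_ord0 powR1.
  by rewrite sumr_const card_tuple expn0 mulr1n.
rewrite big_tuple_cons exprS.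
under eq_bigr => k _.
  under eq_bigr do rewrite tweight_cons powRM// ?ltW ?tweight_gt0//.
  rewrite -mulr_sumr; over.
rewrite -mulr_suml; apply: ler_pM => //; last exact: powR_sum_le.
  by apply: sumr_ge0 => k _; rewrite powR_ge0.
by apply: sumr_ge0 => k _; rewrite powR_ge0.
Qed.

(** Induction on the first index [k]. For [k.+1 <= L] the tail beyond [L / k.+1] scales so that only
    [1 / k.+1] remains, whose sum gives a logarithm. For [k.+1 > L] the other indices are
    unrestricted and their whole sum is bounded. *)
Lemma hyperbolic_tail (b : R) d : 1 < b -> exists2 C, 0 < C &
  forall N L, 1 <= L ->
  \sum_(a : d.+1.-tuple 'I_N | L < tweight a) tweight a `^ (- b) <=
  C * (L `^ (1 - b) * (1 + ln L) ^+ d).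
Proof.
move=> b1.
pose c := 2 `^ b / (b - 1).
have c0 : 0 < c by rewrite divr_gt0 ?powR_gt0//; lra.
elim: d => [|d [C C0 IH]].
  exists c => // N L L1; have L0 : 0 < L by rewrite (lt_le_trans _ L1).
  rewrite expr0 mulr1 big_mkcond big_tuple_cons/=.
  apply: le_trans (powR_tail N b1 L0).
  rewrite [leRHS]big_mkcond; apply: ler_sum => k _.
  rewrite (eq_bigr (fun=> if L < k.+1%:R then k.+1%:R `^ (- b) else 0)); last first.
    by move=> a _; rewrite tweight_cons /tweight big_ord0 mulr1.
  by rewrite sumr_const card_tuple expn0 mulr1n.
have [Z Z0 HZ] := tweight_sum_le b1.
exists (C + c * Z ^+ d.+1) => [|N L L1].
  by rewrite ltr_wpDr// mulr_ge0 ?(ltW c0)// exprn_ge0.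
have L0 : 0 < L by rewrite (lt_le_trans _ L1).
have ln1 : 1 <= 1 + ln L by rewrite lerDl ln_ge0.
rewrite big_mkcond big_tuple_cons/=.
apply: (@le_trans _ _ (\sum_(k < N | k.+1%:R <= L)
     C * (L `^ (1 - b) * (1 + ln L) ^+ d) * k.+1%:R^-1 +
   \sum_(k < N | L < k.+1%:R) Z ^+ d.+1 * k.+1%:R `^ (- b))).
  rewrite (big_mkcond (fun k : 'I_N => _ <= L)) (big_mkcond (fun k : 'I_N => L < _)).
  rewrite -big_split/=; apply: ler_sum => k _.
  have k0 : 0 < k.+1%:R :> R by [].
  have cE (a : d.+1.-tuple 'I_N) :
      (if L < tweight [tuple of k :: a] then tweight [tuple of k :: a] `^ (- b) else 0) =
      k.+1%:R `^ (- b) * (if L / k.+1%:R < tweight a then tweight a `^ (- b) else 0).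
    rewrite tweight_cons powRM ?(ltW (tweight_gt0 a))// ltr_pdivrMr// (mulrC (tweight a)).
    by case: ifP; rewrite ?mulr0.
  under eq_bigr do rewrite cE.
  rewrite -mulr_sumr -big_mkcond/=.
  have [kL|Lk] := leP k.+1%:R L; rewrite ?addr0 ?add0r.
    have L1' : 1 <= L / k.+1%:R by rewrite ler_pdivlMr// mul1r.
    have := ler_wpM2l (powR_ge0 k.+1%:R (- b)) (IH N _ L1').
    move/le_trans; apply.
    rewrite mulrCA -!mulrA ler_pM2l// mulrCA mulrA.
    have -> : (L / k.+1%:R) `^ (1 - b) * k.+1%:R `^ (- b) =
        L `^ (1 - b) * k.+1%:R^-1.
      rewrite powRM ?(ltW L0) ?invr_ge0// -mulrA; congr (_ * _).
      rewrite -(powR_inv1 (ltW k0)) -powRrM -powRD; last by rewrite (gt_eqF k0) implybT.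
      by congr powR; ring.
    rewrite -!mulrA ler_wpM2l ?powR_ge0// mulrC ler_wpM2r ?invr_ge0//.
    apply: lerXn2r; rewrite ?nnegrE ?addr_ge0 ?ln_ge0//.
    rewrite lerD2l ler_ln ?posrE ?divr_gt0// ler_pdivrMr//.
    by rewrite ler_peMr ?(ltW L0)// ler1n.
  rewrite mulrC ler_wpM2r ?powR_ge0//; apply: le_trans (HZ d.+1 N).
  rewrite big_mkcond; apply: ler_sum => a _.
  by case: ifP => // _; exact: powR_ge0.
rewrite -!mulr_sumr.
have h1 : C * (L `^ (1 - b) * (1 + ln L) ^+ d) * (\sum_(k < N | k.+1%:R <= L) k.+1%:R^-1) <=
    C * (L `^ (1 - b) * (1 + ln L) ^+ d.+1).
  rewrite -!mulrA ler_pM2l// ler_wpM2l ?powR_ge0// exprSr.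
  by rewrite ler_wpM2l ?harmonic_le// exprn_ge0// (le_trans ler01).
apply: (le_trans (lerD h1 (ler_wpM2l (exprn_ge0 d.+1 Z0) (powR_tail N b1 L0)))).
rewrite mulrDl lerD2l -/c mulrA (mulrC (Z ^+ _)) ler_wpM2l ?(mulr_ge0 (ltW c0) (exprn_ge0 _ Z0))//.
by rewrite ler_peMr ?powR_ge0// exprn_ege1.
Qed.

(** Hoelder's inequality with [X + 1] in place of the root of [X]: only the dependence on [Y]
    affects the rates. Young's inequality is applied to [s * x i] and [y i / s], with [s] such that
    [s ^ p] and [s ^ (- q) * Y] both equal [Y ^ (1 / q)]. *)
Lemma sum_hoelder (I : finType) (P : pred I) (x y : I -> R) (p q X Y : R) :
  0 < p -> 0 < q -> p^-1 + q^-1 = 1 -> 0 < Y ->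
  (forall i, 0 <= x i) -> (forall i, 0 <= y i) ->
  \sum_(i | P i) x i `^ p <= X -> \sum_(i | P i) y i `^ q <= Y ->
  \sum_(i | P i) x i * y i <= (X + 1) * Y `^ q^-1.
Proof.
move=> p0 q0 pq Y0 x0 y0 hX hY.
pose s := Y `^ (q^-1 / p).
have s0 : 0 < s by exact: powR_gt0.
have X0 : 0 <= X by apply: le_trans hX; apply: sumr_ge0 => i _; exact: powR_ge0.
apply: (@le_trans _ _ (\sum_(i | P i) (s `^ p * x i `^ p + s `^ (- q) * y i `^ q))).
  apply: ler_sum => i _.
  have -> : x i * y i = (s * x i) * (s^-1 * y i) by field; rewrite gt_eqF.
  apply: (@le_trans _ _ ((s * x i) `^ p / p + (s^-1 * y i) `^ q / q)).
    by apply: conjugate_powR; rewrite ?mulr_ge0 ?invr_ge0// ltW.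
  rewrite !powRM ?invr_ge0 ?(ltW s0)//.
  have -> : s^-1 `^ q = s `^ (- q).
    by rewrite -(powR_inv1 (ltW s0)) -powRrM mulN1r.
  have p1 : p^-1 <= 1 by rewrite -pq lerDl invr_ge0 ltW.
  have q1 : q^-1 <= 1 by rewrite -pq lerDr invr_ge0 ltW.
  by rewrite lerD// ler_piMr// mulr_ge0 ?powR_ge0.
rewrite big_split/= -!mulr_sumr mulrDl mul1r lerD//.
  rewrite mulrC; have -> : Y `^ q^-1 = s `^ p.
    by rewrite /s -powRrM divfK ?gt_eqF.
  by rewrite ler_wpM2r ?powR_ge0.
apply: (le_trans (ler_wpM2l (powR_ge0 _ _) hY)).
rewrite /s -powRrM -{2}(powRr1 (ltW Y0)) -powRD; last by rewrite (gt_eqF Y0) implybT.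
rewrite le_eqVlt; apply/orP; left; apply/eqP; congr powR.
have -> : p^-1 = 1 - q^-1 by rewrite -pq addrK.
by field; rewrite gt_eqF.
Qed.
End hyperbolic_sums.

(** * Bounded measurable functions on a probability space *)

Section bounded_measurable.
Context d (T : measurableType d) (R : realType).
Implicit Types f g : T -> R.

(** This class is closed under products and truncation and is integrable for every probability,
    which disposes of integrability conditions until the final passage to L_q. *)
Definition bmfun f := measurable_fun [set: T] f /\ exists B, forall x, `|f x| <= B.

Lemma bm_measurable f : bmfun f -> measurable_fun [set: T] f.
Proof. by case. Qed.

Lemma bm_cst (c : R) : bmfun (fun=> c).
Proof. by split; [exact: measurable_cst|exists `|c|]. Qed.

Lemma bmD f g : bmfun f -> bmfun g -> bmfun (fun x => f x + g x).
Proof.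
move=> [mf [B fB]] [mg [C gC]]; split; first exact: measurable_funD.
by exists (B + C) => x; rewrite (le_trans (ler_normD _ _))// lerD.
Qed.

Lemma bmM f g : bmfun f -> bmfun g -> bmfun (fun x => f x * g x).
Proof.
move=> [mf [B fB]] [mg [C gC]]; split; first exact: measurable_funM.
by exists (B * C) => x; rewrite normrM ler_pM.
Qed.

Lemma bmN f : bmfun f -> bmfun (fun x => - f x).
Proof.
move=> [mf [B fB]]; split; first exact: measurableT_comp.
by exists B => x; rewrite normrN.
Qed.

Lemma bmB f g : bmfun f -> bmfun g -> bmfun (fun x => f x - g x).
Proof. by move=> bf bg; apply: bmD => //; exact: bmN. Qed.

Lemma bmZ (c : R) f : bmfun f -> bmfun (fun x => c * f x).
Proof. by move=> bf; apply: bmM => //; exact: bm_cst. Qed.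

Lemma bm_abs f : bmfun f -> bmfun (fun x => `|f x|).
Proof.
move=> [mf [B fB]]; split; first exact: measurableT_comp.
by exists B => x; rewrite normr_id.
Qed.

Lemma bmX f n : bmfun f -> bmfun (fun x => f x ^+ n).
Proof.
move=> bf; elim: n => [|n IH]; first by under eq_fun do rewrite expr0; exact: bm_cst.
by under eq_fun do rewrite exprS; exact: bmM.
Qed.

Lemma bm_powR f (p : R) : 0 <= p -> bmfun f -> bmfun (fun x => `|f x| `^ p).
Proof.
move=> p0 [mf [B fB]]; split.
  by apply: (measurableT_comp (measurable_powR _)) => //; exact: measurableT_comp.
exists (B `^ p) => x; rewrite ger0_norm ?powR_ge0// ge0_ler_powR ?nnegrE//.
exact: le_trans (fB x).
Qed.

Lemma bm_sum (I : finType) (P : pred I) (F : I -> T -> R) :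
  (forall i, P i -> bmfun (F i)) -> bmfun (fun x => \sum_(i | P i) F i x).
Proof.
move=> bF; rewrite (_ : (fun x => _) = \sum_(i | P i) F i)%R; last first.
  by apply/funext => x; rewrite fct_sumE.
elim/big_ind: _ => //; [exact: bm_cst|exact: bmD].
Qed.

Lemma bm_prod (I : finType) (P : pred I) (F : I -> T -> R) :
  (forall i, P i -> bmfun (F i)) -> bmfun (fun x => \prod_(i | P i) F i x).
Proof.
move=> bF; rewrite (_ : (fun x => _) = \prod_(i | P i) F i)%R; last first.
  by apply/funext => x; rewrite fct_prodE.
elim/big_ind: _ => //; [exact: bm_cst|exact: bmM].
Qed.

Variable P : probability T R.

Lemma bm_integrable f : bmfun f -> P.-integrable [set: T] (EFin \o f).
Proof.
move=> [mf [B fB]].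
apply: (@le_integrable _ _ _ P _ measurableT _ (cst B%:E)).
- exact/measurable_EFinP.
- by move=> x _ /=; rewrite lee_fin (le_trans (fB x))// ler_norm.
- exact: finite_measure_integrable_cst.
Qed.

Lemma bm_int_le f g : bmfun f -> bmfun g -> (forall x, f x <= g x) ->
  \int[P]_x f x <= \int[P]_x g x.
Proof. by move=> bf bg fg; apply: le_Rintegral => //; exact: bm_integrable. Qed.

Lemma bm_intD f g : bmfun f -> bmfun g ->
  \int[P]_x (f x + g x) = \int[P]_x f x + \int[P]_x g x.
Proof. by move=> bf bg; apply: RintegralD => //; exact: bm_integrable. Qed.

Lemma bm_intB f g : bmfun f -> bmfun g ->
  \int[P]_x (f x - g x) = \int[P]_x f x - \int[P]_x g x.
Proof. by move=> bf bg; apply: RintegralB => //; exact: bm_integrable. Qed.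

Lemma bm_intZ (c : R) f : bmfun f -> \int[P]_x (c * f x) = c * \int[P]_x f x.
Proof. by move=> bf; apply: RintegralZl => //; exact: bm_integrable. Qed.

Lemma prob_int_cst (c : R) : \int[P]_x c = c.
Proof.
rewrite Rintegral_cst//.
by transitivity (c * fine 1%E); [congr (_ * fine _); exact: probability_setT|rewrite mulr1].
Qed.

Lemma bm_int_norm f : bmfun f -> `|\int[P]_x f x| <= \int[P]_x `|f x|.
Proof. by move=> bf; apply: le_normr_Rintegral => //; exact: bm_integrable. Qed.

Lemma bm_int_sum (I : finType) (Q : pred I) (F : I -> T -> R) :
  (forall i, Q i -> bmfun (F i)) ->
  \int[P]_x (\sum_(i | Q i) F i x) = \sum_(i | Q i) \int[P]_x F i x.
Proof.
move=> bF; rewrite -big_filter.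
under eq_Rintegral do rewrite -big_filter.
have : forall i, i \in [seq i <- index_enum I | Q i] -> bmfun (F i).
  by move=> i; rewrite mem_filter => /andP[/bF].
elim: [seq _ <- _ | _] => [_|i s IH bs].
  by rewrite big_nil; under eq_Rintegral do rewrite big_nil; rewrite prob_int_cst.
rewrite big_cons; under eq_Rintegral do rewrite big_cons.
rewrite bm_intD ?IH//.
- by move=> j js; apply: bs; rewrite inE js orbT.
- by apply: bs; rewrite inE eqxx.
- rewrite (_ : (fun x => _) = \sum_(i <- s) F i)%R; last first.
    by apply/funext => x; rewrite fct_sumE.
  rewrite big_seq; elim/big_ind: _ => //; [exact: bm_cst|exact: bmD|].
  by move=> j js; apply: bs; rewrite inE js orbT.
Qed.

Lemma bm_int_ge0 f : (forall x, 0 <= f x) -> 0 <= \int[P]_x f x.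
Proof. by move=> f0; apply: Rintegral_ge0. Qed.

Lemma bm_cut f (c : R) : bmfun f -> bmfun (fun x => if `|f x| <= c then f x else 0).
Proof.
move=> [mf [B fB]]; split.
  apply: measurable_fun_if => //=; last exact: measurable_funTS.
  by apply: measurable_fun_ler => //; exact: measurableT_comp.
exists B => x; case: ifP => // _; rewrite normr0; exact: le_trans (fB x).
Qed.
End bounded_measurable.

(** * Sums over dyadic levels *)

Section geometric_levels.
Variable R : realType.
Implicit Types c v s : R.

Lemma two_powR_gt1 s : 0 < s -> 1 < 2 `^ s.
Proof.
move=> s0; have : 1 `^ s < 2 `^ s by rewrite gt0_ltr_powR ?nnegrE// ltr1n.
by rewrite powR1.
Qed.

(** An increasing geometric sum is controlled by its last level, which is below [v]; the induction
    carries the next level, capped at [2 * v]. *)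
Lemma levels_below c v s M : 0 < c -> 0 < v -> 0 < s ->
  \sum_(j < M | c * 2 ^+ j < v) (c * 2 ^+ j) `^ s <= (2 `^ s - 1)^-1 * (2 * v) `^ s.
Proof.
move=> c0 v0 s0.
have d0 : 0 < 2 `^ s - 1 :> R by rewrite subr_gt0 two_powR_gt1.
have lev0 j : 0 < c * 2 ^+ j by rewrite mulr_gt0// exprn_gt0.
suff H : \sum_(j < M | c * 2 ^+ j < v) (c * 2 ^+ j) `^ s <=
    (2 `^ s - 1)^-1 * (Num.min (c * 2 ^+ M) (2 * v)) `^ s.
  apply: (le_trans H); rewrite ler_pM2l ?invr_gt0// ge0_ler_powR ?nnegrE ?(ltW s0)//.
  - by rewrite le_min !ltW// mulr_gt0.
  - by rewrite mulr_ge0// ltW.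
  - by rewrite ge_min lexx orbT.
elim: M => [|M IH]; first by rewrite big_ord0 mulr_ge0 ?powR_ge0// invr_ge0 ltW.
rewrite big_mkcond big_ord_recr/= -big_mkcond/=.
have [Mv|vM] := ltP (c * 2 ^+ M) v.
  have M2 : c * 2 ^+ M <= 2 * v by lra.
  rewrite (min_idPl M2) in IH.
  rewrite exprS mulrCA (min_idPl _) ?ler_pM2l ?(ltW Mv)//.
  rewrite (powRM s _ (ltW (lev0 M)))//; apply: (le_trans (lerD IH (lexx _))).
  rewrite le_eqVlt; apply/orP; left; apply/eqP.
  by field; rewrite gt_eqF.
rewrite addr0; apply: (le_trans IH); rewrite ler_pM2l ?invr_gt0//.
rewrite ge0_ler_powR ?nnegrE ?(ltW s0)//.
- by rewrite le_min !ltW// mulr_gt0.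
- by rewrite le_min !ltW// mulr_gt0.
rewrite le_min !ge_min lexx orbT andbT; apply/orP; left.
by rewrite exprS mulrCA ler_peMl ?(ltW (lev0 M))// ler1n.
Qed.

(** A decreasing geometric sum is controlled by its first level, which is at least [v]; a subtracted
    term makes the induction telescope. *)
Lemma levels_above c v s M : 0 < c -> 0 < v -> 0 < s ->
  \sum_(j < M | v <= c * 2 ^+ j) (c * 2 ^+ j) `^ (- s) <= (1 - 2 `^ (- s))^-1 * v `^ (- s).
Proof.
move=> c0 v0 s0.
have d0 : 0 < 1 - 2 `^ (- s) :> R.
  by rewrite subr_gt0 powRN invf_lt1 ?powR_gt0// two_powR_gt1.
have lev0 j : 0 < c * 2 ^+ j by rewrite mulr_gt0// exprn_gt0.
have anti (x y : R) : 0 < x -> x <= y -> y `^ (- s) <= x `^ (- s).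
  move=> x0 xy; have y0 := lt_le_trans x0 xy.
  rewrite !powRN lef_pV2 ?posrE ?powR_gt0//.
  by rewrite ge0_ler_powR ?nnegrE ?(ltW x0) ?(ltW y0)// ltW.
suff H : \sum_(j < M | v <= c * 2 ^+ j) (c * 2 ^+ j) `^ (- s) <=
    (1 - 2 `^ (- s))^-1 * (v `^ (- s) - (Num.max (c * 2 ^+ M) v) `^ (- s)).
  by apply: (le_trans H); rewrite ler_pM2l ?invr_gt0// gerBl powR_ge0.
elim: M => [|M IH].
  by rewrite big_ord0 mulr_ge0 ?invr_ge0 ?(ltW d0)// subr_ge0 anti// le_max lexx orbT.
rewrite big_mkcond big_ord_recr/= -big_mkcond/=.
have [vM|Mv] := leP v (c * 2 ^+ M).
  rewrite (max_idPl vM) in IH.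
  rewrite exprS mulrCA (max_idPl _); last by have := lev0 M; lra.
  rewrite (powRM (- s) _ (ltW (lev0 M)))//; apply: (le_trans (lerD IH (lexx _))).
  rewrite le_eqVlt; apply/orP; left; apply/eqP.
  by field; rewrite gt_eqF.
rewrite addr0; apply: (le_trans IH); rewrite ler_pM2l ?invr_gt0// lerD2l lerN2.
apply: anti; first by rewrite lt_max v0 orbT.
rewrite ge_max !le_max lexx orbT andbT; apply/orP; left.
by rewrite exprS mulrCA ler_peMl ?(ltW (lev0 M))// ler1n.
Qed.

Lemma level_find c v M : 0 < c -> c < v -> v <= c * 2 ^+ M ->
  exists2 j : 'I_M, c * 2 ^+ j < v & v <= 2 * (c * 2 ^+ j).
Proof.
move=> c0 cv; elim: M => [|M IH]; first by rewrite expr0 mulr1 leNgt cv.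
rewrite exprS mulrCA => vM.
have [/IH[j j1 j2]|] := leP v (c * 2 ^+ M).
  by exists (widen_ord (leqnSn M) j).
by exists ord_max.
Qed.
End geometric_levels.

(** * The Hardy-Littlewood inequality for bounded systems satisfying Bessel's inequality *)

Section hardy_littlewood.
Context d (T : measurableType d) (R : realType) (P : probability T R).
Variable u : nat -> T -> R.
Hypothesis bu : forall n, bmfun (u n).
Hypothesis u_le1 : forall n x, `|u n x| <= 1.
Hypothesis bessel : forall N phi, bmfun phi ->
  \sum_(n < N) (\int[P]_x (phi x * u n x)) ^+ 2 <= \int[P]_x (phi x ^+ 2).

(* The part of [phi] above the level [c] contributes through its L^1 norm, the
   part below through Bessel's inequality. *)
Let weak_type_bound N phi (c : R) : bmfun phi -> 0 < c ->
  \sum_(n < N | 2 * c < n.+1%:R * `|\int[P]_x (phi x * u n x)|) n.+1%:R `^ (-2) <=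
  4 * c^-1 * \int[P]_x `|phi x - (if `|phi x| <= c then phi x else 0)| +
  c `^ (-2) * \int[P]_x ((if `|phi x| <= c then phi x else 0) ^+ 2).
Proof.
move=> bphi c0.
set h := fun x => if `|phi x| <= c then phi x else 0.
have bh : bmfun h by exact: bm_cut.
pose g x := phi x - h x.
have bg : bmfun g by exact: bmB.
set ng := \int[P]_x `|g x|; set nh := \int[P]_x (h x ^+ 2).
have ng0 : 0 <= ng by apply: bm_int_ge0.
have split_int n : `|\int[P]_x (phi x * u n x)| <= ng + `|\int[P]_x (h x * u n x)|.
  have -> : \int[P]_x (phi x * u n x) = \int[P]_x (g x * u n x) + \int[P]_x (h x * u n x).
    rewrite -bm_intD; [|exact: bmM..].
    by apply: eq_Rintegral => x _; rewrite -mulrDl /g subrK.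
  apply: (le_trans (ler_normD _ _)); rewrite lerD2r.
  have bgu : bmfun (fun x => g x * u n x) by exact: bmM.
  apply: (le_trans (bm_int_norm P bgu)); apply: bm_int_le; [exact: bm_abs..|].
  by move=> x; rewrite normrM ler_piMr.
(* If a coefficient of [phi] exceeds [2 * c / n.+1], then [ng] exceeds [c / n.+1] or the coefficient
   of [h] is at least that large; the second case is treated by Chebyshev's inequality. *)
apply: (@le_trans _ _ (\sum_(n < N | c < n.+1%:R * ng) n.+1%:R `^ (-2) +
    \sum_(n < N) c `^ (-2) * (\int[P]_x (h x * u n x)) ^+ 2)).
  rewrite !(big_mkcond (fun n : 'I_N => _ < _)) -big_split/=; apply: ler_sum => n _.
  have n0 : 0 < n.+1%:R :> R by [].
  have t0 : 0 <= c `^ (-2) * (\int[P]_x (h x * u n x)) ^+ 2.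
    by rewrite mulr_ge0 ?powR_ge0 ?sqr_ge0.
  have s0 : 0 <= (if c < n.+1%:R * ng then n.+1%:R `^ (-2) else 0) :> R.
    by case: ifP => // _; exact: powR_ge0.
  case: ifP => [big|_]; last by rewrite addr_ge0.
  case: ifP s0 => [_ _|/negbT]; first by rewrite lerDl.
  rewrite -leNgt => small _; rewrite add0r.
  have hbig : c <= n.+1%:R * `|\int[P]_x (h x * u n x)|.
    have := ler_wpM2l (ltW n0) (split_int n); rewrite mulrDr; lra.
  have -> : n.+1%:R `^ (-2) = n.+1%:R ^- 2 :> R by rewrite powRN powR_mulrn.
  have -> : c `^ (-2) = c ^- 2 by rewrite powRN powR_mulrn// ltW.
  rewrite ler_pdivlMl ?exprn_gt0// ler_pdivrMr ?exprn_gt0//.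
  rewrite -(real_normK (num_real (\int[P]_x _))) mulrC -exprMn.
  by apply: lerXn2r; rewrite ?nnegrE ?(ltW c0)// mulr_ge0.
apply: lerD; last first.
  by rewrite -mulr_sumr ler_wpM2l ?powR_ge0//; exact: bessel.
have [ng00|ng1] := eqVneq ng 0.
  rewrite big_pred0 ?ng00 ?mulr0// => n.
  by rewrite mulr0; apply/negbTE; rewrite -leNgt ltW.
have ngp : 0 < ng by rewrite lt_def ng1.
(* The sum of [n.+1 ^ (-2)] over [n.+1 > c / ng] is at most [4 * ng / c]. *)
under eq_bigl do rewrite -ltr_pdivrMr//.
apply: (le_trans (powR_tail N _ (divr_gt0 c0 ngp))); first by rewrite ltr1n.
rewrite (_ : 2 - 1 = 1 :> R); last by ring.
rewrite (_ : 1 - 2 = - 1 :> R); last by ring.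
rewrite powR_mulrn// powR_inv1 ?divr_ge0 ?(ltW c0)// divr1 invf_div.
by rewrite le_eqVlt; apply/orP; left; apply/eqP; ring.
Qed.

(* Marcinkiewicz interpolation: [weak_type_bound] is summed over the levels
   [c * 2 ^+ j]. *)
Lemma hardy_littlewood1 (q : R) : 1 < q -> q <= 2 -> exists2 C, 0 < C &
  forall N phi, bmfun phi ->
  \sum_(n < N) n.+1%:R `^ (q - 2) * `|\int[P]_x (phi x * u n x)| `^ q <=
  C * \int[P]_x (`|phi x| `^ q).
Proof.
(* For [q = 2] the claim is Bessel's inequality; the constant [K2] below requires [q < 2]. *)
move=> q1; rewrite le_eqVlt => /predU1P[->|q2].
  exists 1 => // N phi bphi; rewrite subrr mul1r.
  under eq_bigr do rewrite powRr0 mul1r powR_mulrn// real_normK ?num_real//.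
  under eq_Rintegral do rewrite powR_mulrn// real_normK ?num_real//.
  exact: bessel.
have q0 : 0 < q by lra.
pose K1 : R := (2 `^ (q - 1) - 1)^-1 * 2 `^ (q - 1).
pose K2 : R := (1 - 2 `^ (- (2 - q)))^-1.
have K10 : 0 < K1.
  by rewrite mulr_gt0 ?powR_gt0// invr_gt0 subr_gt0 two_powR_gt1//; lra.
have K20 : 0 < K2.
  by rewrite invr_gt0 subr_gt0 powRN invf_lt1 ?powR_gt0// two_powR_gt1//; lra.
exists (4 `^ q * (4 * K1 + K2)) => [|N phi bphi].
  by rewrite mulr_gt0 ?powR_gt0// addr_gt0// mulr_gt0.
(* With mass [n.+1 ^ (-2)] at [n], the left-hand side is the q-th moment of [x], which
   [weak_type_bound] controls through the distribution of [x]. *)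
pose x n := n.+1%:R * `|\int[P]_x (phi x * u n x)| : R.
have x0 n : 0 <= x n by rewrite mulr_ge0.
have termE n : n.+1%:R `^ (q - 2) * `|\int[P]_x (phi x * u n x)| `^ q =
    n.+1%:R `^ (-2) * x n `^ q.
  rewrite /x powRM// mulrA -powRD; last by rewrite pnatr_eq0 implybT.
  by rewrite addrC.
under eq_bigr do rewrite termE.
(* [2 * c] lies below every positive [x n], so that the levels reach all of them; the default 1
   serves when there is none. *)
pose c := \big[Num.min/1]_(n < N | 0 < x n) (x n / 4).
have c0 : 0 < c.
  by apply: lt_bigmin => // n xn; rewrite divr_gt0.
have cx (n : 'I_N) : 0 < x n -> 2 * c < x n.
  move=> xn; have : c <= x n / 4 by apply: bigmin_le_cond.
  lra.
have [M HM] : exists M, forall n : 'I_N, x n <= 2 * c * 2 ^+ M.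
  pose X := \sum_(n < N) x n.
  exists (Num.bound (X / (2 * c))) => n.
  rewrite mulrC -ler_pdivrMr ?mulr_gt0//.
  apply: (@le_trans _ _ (X / (2 * c))).
    rewrite ler_pM2r ?invr_gt0 ?mulr_gt0// /X (bigD1 n)//= lerDl.
    exact: sumr_ge0.
  have XM : X / (2 * c) < (Num.bound (X / (2 * c)))%:R.
    by apply: archi_boundP; rewrite divr_ge0 ?sumr_ge0// mulr_ge0// ltW.
  by apply: (le_trans (ltW XM)); rewrite -natrX ler_nat ltnW// ltn_expl.
pose lev j : R := c * 2 ^+ j.
have lev0 j : 0 < lev j by rewrite mulr_gt0// exprn_gt0.
(* Every positive [x n] satisfies [2 * lev j < x n <= 4 * lev j] for some [j], whence [4 ^ q]. *)
apply: (@le_trans _ _ (\sum_(j < M) 4 `^ q * lev j `^ q *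
    (\sum_(n < N | 2 * lev j < x n) n.+1%:R `^ (-2)))).
  under [leRHS]eq_bigr do rewrite mulr_sumr big_mkcond/=.
  rewrite exchange_big/=; apply: ler_sum => n _.
  have sum0 (j : 'I_M) : 0 <=
      (if 2 * lev j < x n then 4 `^ q * lev j `^ q * n.+1%:R `^ (-2) else 0) :> R.
    by case: ifP => // _; rewrite !mulr_ge0 ?powR_ge0.
  have [xn0|xn0] := eqVneq (x n) 0.
    by rewrite [X in X `^ q]xn0 powR0 ?(gt_eqF q0)// mulr0; exact: sumr_ge0.
  have xnp : 0 < x n by rewrite lt_def xn0 x0.
  have c20 : 0 < 2 * c by rewrite mulr_gt0.
  have [j j1 j2] := level_find c20 (cx n xnp) (HM n).
  rewrite (bigD1 j)//= ler_wpDr ?sumr_ge0//.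
  rewrite -mulrA in j1; rewrite -mulrA in j2; rewrite /lev j1.
  rewrite [leRHS]mulrC ler_wpM2l ?powR_ge0// -powRM ?(ltW (lev0 j))//.
  rewrite ge0_ler_powR ?nnegrE ?x0//; [lra|by rewrite mulr_ge0 ?(ltW (lev0 j))|].
  by rewrite /lev; lra.
pose h j y := if `|phi y| <= lev j then phi y else 0.
have bh j : bmfun (h j) by exact: bm_cut.
have bg j : bmfun (fun y => `|phi y - h j y|) by apply: bm_abs; exact: bmB.
have bh2 j : bmfun (fun y => h j y ^+ 2) by exact: bmX.
have b1 j : bmfun (fun y => 4 * lev j `^ (q - 1) * `|phi y - h j y|) by exact: bmZ.
have b2 j : bmfun (fun y => lev j `^ (q - 2) * h j y ^+ 2) by exact: bmZ.
apply: (@le_trans _ _ (4 `^ q * \int[P]_y (\sum_(j < M)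
   (4 * lev j `^ (q - 1) * `|phi y - h j y| + lev j `^ (q - 2) * h j y ^+ 2)))).
  rewrite bm_int_sum; last by move=> j _; exact: bmD.
  rewrite mulr_sumr; apply: ler_sum => j _; rewrite -mulrA ler_pM2l ?powR_gt0//.
  apply: (le_trans (ler_wpM2l (powR_ge0 _ _) (weak_type_bound N bphi (lev0 j)))).
  rewrite bm_intD// !bm_intZ// mulrDr.
  rewrite le_eqVlt; apply/orP; left; apply/eqP; congr (_ + _).
    rewrite powRB; last by rewrite (gt_eqF (lev0 j)) implybT.
    by rewrite powRr1 ?(ltW (lev0 j))//; ring.
  rewrite mulrA -powRD//; by rewrite (gt_eqF (lev0 j)) implybT.
rewrite -mulrA ler_pM2l ?powR_gt0// -bm_intZ; last by apply: bm_powR => //; lra.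
apply: bm_int_le => [||y].
- by apply: bm_sum => j _; exact: bmD.
- by apply: bmZ; apply: bm_powR => //; lra.
(* Pointwise in [y], the levels below [|phi y|] contribute to the first sum only and those above to
   the second only; either geometric sum gives a multiple of [|phi y| ^ q]. *)
rewrite big_split/= mulrDl lerD//.
  have [p0|p0] := eqVneq (phi y) 0.
    rewrite big1 => [|j _].
      by apply: mulr_ge0; [apply: mulr_ge0 => //; exact: ltW|exact: powR_ge0].
    by rewrite /h p0 if_same subrr normr0 mulr0.
  have pp : 0 < `|phi y| by rewrite normr_gt0.
  apply: (@le_trans _ _ (4 * `|phi y| *
      \sum_(j < M | lev j < `|phi y|) lev j `^ (q - 1))).
    rewrite [X in _ * X]big_mkcond mulr_sumr; apply: ler_sum => j _.
    rewrite /h; case: leP => [_|_]; first by rewrite subrr normr0 !mulr0.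
    by rewrite subr0; lra.
  rewrite -mulrA -[leRHS]mulrA ler_pM2l//.
  have q10 : 0 < q - 1 by lra.
  apply: (le_trans (ler_wpM2l (ltW pp) (levels_below M c0 pp q10))).
  rewrite (powRM (q - 1) (ler0n R 2) (ltW pp)) [leLHS](_ : _ = K1 * (`|phi y| * `|phi y| `^ (q - 1))); last first.
    by rewrite /K1; ring.
  by rewrite mulr_powRB1//; lra.
have [p0|p0] := eqVneq (phi y) 0.
  rewrite big1 => [|j _].
    by apply: mulr_ge0; [exact: ltW|exact: powR_ge0].
  by rewrite /h p0 if_same expr0n mulr0.
have pp : 0 < `|phi y| by rewrite normr_gt0.
apply: (@le_trans _ _ (`|phi y| ^+ 2 *
    \sum_(j < M | `|phi y| <= lev j) lev j `^ (- (2 - q)))).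
  rewrite [X in _ * X]big_mkcond mulr_sumr; apply: ler_sum => j _.
  rewrite /h opprB; case: ifP => _; last by rewrite mulr0 expr2 mul0r mulr0.
  by rewrite (real_normK (num_real (phi y))) mulrC.
have q20 : 0 < 2 - q by lra.
apply: (le_trans (ler_wpM2l (sqr_ge0 _) (levels_above M c0 pp q20))).
rewrite mulrCA ler_wpM2l ?(ltW K20)// -powR_mulrn// -powRD; last by rewrite (gt_eqF pp) implybT.
by rewrite (_ : 2 + - (2 - q) = q); last by ring.
Qed.
End hardy_littlewood.

(** * Iterated integrals on the torus and the multivariate Hardy-Littlewood inequality *)

Section torus_integral.
Variable R : realType.
Local Notation circ := (circle R).
Local Notation tor := (torus R).

Lemma bm_comp d d' (T : measurableType d) (T' : measurableType d') (g : T -> T') (f : T' -> R) :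
  measurable_fun [set: T] g -> bmfun f -> bmfun (fun x => f (g x)).
Proof.
move=> mg [mf [B fB]]; split; last by exists B.
exact: measurableT_comp.
Qed.

Lemma measurable_tcons1 n (y : Rd R n) :
  measurable_fun setT (fun x : measurableTypeR R => tcons (x, y)).
Proof.
apply: (@measurableT_comp _ _ _ _ _ _ (@tcons R n) _ (fun x => (x, y))).
  exact: measurable_tcons.
by apply: measurable_fun_pair.
Qed.

Lemma torus_int0 (f : Rd R 0 -> R) : bmfun f -> \int[tor 0%N]_x f x = f [tuple].
Proof.
move=> [mf _]; rewrite /Rintegral /= integral_dirac//; first by rewrite diracT mul1e.
exact/measurable_EFinP.
Qed.

Lemma torus_ge0_intS n (f : Rd R n.+1 -> \bar R) : measurable_fun setT f ->
  (forall x, 0 <= f x)%E ->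
  (\int[tor n.+1]_z f z = \int[tor n]_y \int[circ]_x f (tcons (x, y)))%E.
Proof.
move=> mf f0; rewrite /= ge0_integral_distribution// fubini_tonelli2//.
  exact: (measurableT_comp mf (@measurable_tcons R n)).
by move=> x; exact: f0.
Qed.

(** Fubini's theorem; the first conclusion keeps the inner integral in the class, so that the
    argument can be iterated over the coordinates. *)
Lemma torus_intS n (f : Rd R n.+1 -> R) : bmfun f ->
  bmfun (fun y => \int[circ]_x f (tcons (x, y))) /\
  \int[tor n.+1]_z f z = \int[tor n]_y \int[circ]_x f (tcons (x, y)).
Proof.
move=> bf.
have bf1 (y : Rd R n) : bmfun (fun x => f (tcons (x, y))).
  exact: (bm_comp (@measurable_tcons1 n y) bf).
have ift : (circ \x tor n)%E.-integrable setT (EFin \o (fun z => f (tcons z))).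
  apply: bm_integrable; exact: (bm_comp (@measurable_tcons R n) bf).
have GE y : (\int[circ]_x f (tcons (x, y)))%:E = fubini_G circ (EFin \o (fun z => f (tcons z))) y.
  by rewrite /fubini_G /Rintegral fineK//; apply: integrable_fin_num => //; exact: bm_integrable.
split; last first.
  rewrite /Rintegral/= integral_distribution//; last exact/measurable_EFinP/bm_measurable.
  rewrite -integral21_prod_meas1//; congr fine; apply: eq_integral => y _.
  by rewrite -GE.
split.
  apply/measurable_EFinP; rewrite (_ : EFin \o _ = fubini_G circ (EFin \o (fun z => f (tcons z)))).
    exact: (measurable_fubini_G ift).
  by apply/funext => y /=; rewrite GE.
have [mf [B fB]] := bf; exists B => y.
apply: (le_trans (bm_int_norm circ (bf1 y))).
rewrite -[leRHS](prob_int_cst circ B); apply: bm_int_le => //; [exact: bm_abs|exact: bm_cst].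
Qed.

Definition tens d (u : nat -> R -> R) (k : 'I_d -> nat) (x : Rd R d) : R :=
  \prod_(i < d) u (k i) (tnth x i).

Lemma tens_tcons n u (k : 'I_n.+1 -> nat) z (y : Rd R n) :
  tens u k (tcons (z, y)) = u (k ord0) z * tens u (fun i => k (lift ord0 i)) y.
Proof.
rewrite /tens big_ord_recl /tcons/= tnth0; congr (_ * _).
by apply: eq_bigr => i _; rewrite tnthS.
Qed.

Lemma bm_tnth d (h : measurableTypeR R -> R) (i : 'I_d) :
  bmfun h -> bmfun (fun x : Rd R d => h (tnth x i)).
Proof. by move=> bh; exact: (bm_comp (measurable_tnth i) bh). Qed.

Lemma bm_tens d (u : nat -> measurableTypeR R -> R) (k : 'I_d -> nat) :
  (forall n, bmfun (u n)) -> bmfun (tens u k).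
Proof. by move=> bu; apply: bm_prod => i _; exact: bm_tnth. Qed.

Lemma torus_int_prod d (h : 'I_d -> measurableTypeR R -> R) : (forall i, bmfun (h i)) ->
  \int[tor d]_x (\prod_(i < d) h i (tnth x i)) = \prod_(i < d) \int[circ]_x h i x.
Proof.
elim: d h => [|d IH] h bh.
  by rewrite torus_int0 ?big_ord0//; apply: bm_prod => i _; exact: bm_tnth.
have bp : bmfun (fun x : Rd R d.+1 => \prod_(i < d.+1) h i (tnth x i)).
  by apply: bm_prod => i _; exact: bm_tnth.
rewrite (torus_intS bp).2.
rewrite big_ord_recl -IH// -bm_intZ; last by apply: bm_prod => i _; exact: bm_tnth.
apply: eq_Rintegral => y _; rewrite mulrC -bm_intZ//.
apply: eq_Rintegral => x _; rewrite big_ord_recl /tcons/= tnth0 mulrC; congr (_ * _).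
by apply: eq_bigr => i _; rewrite tnthS.
Qed.

(** Induction on the dimension. [Phi k] is the k-th coefficient in the first variable: the induction
    hypothesis is applied to each [Phi k], and then the univariate inequality to each slice of
    [phi], under the integral over the other variables. *)
Lemma hardy_littlewood_torus (u : nat -> measurableTypeR R -> R) (q C : R) :
  1 < q -> 0 <= C -> (forall n, bmfun (u n)) ->
  (forall N phi, bmfun phi ->
    \sum_(n < N) n.+1%:R `^ (q - 2) * `|\int[circ]_x (phi x * u n x)| `^ q <=
    C * \int[circ]_x (`|phi x| `^ q)) ->
  forall d N phi, bmfun phi ->
    \sum_(a : d.-tuple 'I_N) tweight R a `^ (q - 2) *
       `|\int[tor d]_x (phi x * tens u (fun i => tnth a i) x)| `^ q <=
    C ^+ d * \int[tor d]_x (`|phi x| `^ q).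
Proof.
move=> q1 C0 bu HL; have q0 : 0 <= q by lra.
elim=> [|d IH] N phi bphi.
  have bq : bmfun (fun x => `|phi x| `^ q) by exact: bm_powR.
  rewrite (eq_bigr (fun=> `|phi [tuple]| `^ q)); last first.
    move=> a _; rewrite /tweight big_ord0 powR1 mul1r.
    rewrite torus_int0; last by apply: bmM => //; exact: bm_tens.
    by rewrite /tens big_ord0 mulr1.
  by rewrite sumr_const card_tuple expn0 mulr1n torus_int0// mul1r.
rewrite big_tuple_cons.
pose Phi (k : nat) (y : Rd R d) := \int[circ]_x (phi (tcons (x, y)) * u k x).
have btc (y : Rd R d) : bmfun (fun x => phi (tcons (x, y))).
  exact: (bm_comp (@measurable_tcons1 d y) bphi).
have bPhi k : bmfun (Phi k).
  have bk : bmfun (fun z : Rd R d.+1 => phi z * u k (tnth z ord0)).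
    by apply: bmM => //; exact: bm_tnth.
  have [] := torus_intS bk; rewrite /Phi.
  by under [X in bmfun X -> _]eq_fun do under eq_Rintegral do rewrite /tcons/= tnth0.
have coefE (k : 'I_N) (b : d.-tuple 'I_N) :
    \int[tor d.+1]_x (phi x * tens u (fun i => tnth [tuple of k :: b] i) x) =
    \int[tor d]_y (Phi k y * tens u (fun i => tnth b i) y).
  have [_ ->] := torus_intS (bmM bphi (bm_tens (fun i => tnth [tuple of k :: b] i) bu)).
  apply: eq_Rintegral => y _; rewrite /Phi mulrC -bm_intZ; last exact: bmM.
  apply: eq_Rintegral => x _; rewrite tens_tcons tnth0 mulrA mulrC; congr (_ * _).
  by apply: eq_bigr => i _; rewrite tnthS.
apply: (@le_trans _ _ (\sum_(k < N) k.+1%:R `^ (q - 2) *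
    (C ^+ d * \int[tor d]_y (`|Phi k y| `^ q)))).
  apply: ler_sum => k _; apply: le_trans (ler_wpM2l (powR_ge0 _ _) (IH N _ (bPhi k))).
  rewrite mulr_sumr; apply: ler_sum => b _.
  by rewrite tweight_cons powRM ?(ltW (tweight_gt0 _ _))// coefE mulrA.
under eq_bigr do rewrite mulrCA.
rewrite -mulr_sumr exprSr -mulrA ler_wpM2l ?exprn_ge0//.
have bq : bmfun (fun z => `|phi z| `^ q) by exact: bm_powR.
have [bqS ->] := torus_intS bq.
rewrite -bm_intZ//.
have bPq (k : 'I_N) : bmfun (fun y => `|Phi k y| `^ q) by exact: bm_powR.
rewrite (eq_bigr (fun k : 'I_N => \int[tor d]_y (k.+1%:R `^ (q - 2) * `|Phi k y| `^ q))); last first.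
  by move=> k _; rewrite bm_intZ.
rewrite -bm_int_sum; last by move=> k _; apply: bmZ; exact: bm_powR.
apply: bm_int_le; [|exact: bmZ|].
  by apply: bm_sum => k _; apply: bmZ; exact: bm_powR.
by move=> y; exact: HL.
Qed.

(** Truncation and dominated convergence. The pointwise bound by [|phi|] transfers estimates in L_q,
    although the approximation is only in L^1. *)
Lemma bounded_approx d (T : measurableType d) (P : probability T R) (phi : T -> R) (e : R) :
  P.-integrable setT (EFin \o phi) -> 0 < e ->
  exists h, [/\ bmfun h, forall x, `|h x| <= `|phi x| & \int[P]_x `|phi x - h x| <= e].
Proof.
move=> iphi e0.
have mphi : measurable_fun setT phi by apply/measurable_EFinP; exact: measurable_int iphi.
pose f_ (n : nat) x := if `|phi x| <= n%:R then phi x else 0.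
have mf_ n : measurable_fun setT (f_ n).
  apply: measurable_fun_if => //=; last exact: measurable_funTS.
  by apply: measurable_fun_ler => //; exact: measurableT_comp.
have le_f n x : `|f_ n x| <= `|phi x| by rewrite /f_; case: ifP => // _; rewrite normr0.
have c1 : {ae P, forall x, setT x -> (fun n => (EFin \o f_ n) x) @ \oo --> (EFin \o phi) x}.
  apply: aeW => x _; apply: cvg_near_cst.
  near=> n; rewrite /= /f_ ifT//; near: n; exact: nbhs_infty_ger.
have c2 : {ae P, forall x (n : nat), setT x -> (`|(EFin \o f_ n) x| <= (`|phi x|%R)%:E)%E}.
  by apply: aeW => x n _ /=; rewrite lee_fin.
have c3 : P.-integrable setT (EFin \o (fun y => `|phi y|)).
  exact: integrable_norm.
have [_ + _] := dominated_convergence measurableT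
  (fun n => (measurable_EFinP _ _).2 (mf_ n)) ((measurable_EFinP _ _).2 mphi) c1 c3 c2.
move=> /fine_cvgP[_ /cvgrPdist_le /(_ _ e0)] [n _ /(_ n (leqnn n))/=].
rewrite sub0r normrN => He.
exists (f_ n); split => //.
  split=> //; exists n%:R => x; rewrite /f_; case: ifP => // _.
  by rewrite normr0.
apply: le_trans He; apply: le_trans (ler_norm _).
rewrite /Rintegral le_eqVlt; apply/orP; left; apply/eqP; congr fine.
by apply: eq_integral => x _; rewrite distrC.
Unshelve. all: by end_near.
Qed.

Lemma le1_tens d (u : nat -> R -> R) (k : 'I_d -> nat) (x : Rd R d) :
  (forall n y, `|u n y| <= 1) -> `|tens u k x| <= 1.
Proof.
move=> u1; rewrite /tens normr_prod; apply: (@le_trans _ _ (\prod_(i < d) 1)).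
  by apply: ler_prod => i _; rewrite normr_ge0 u1.
by rewrite big1.
Qed.

Lemma integrable_mulbm d (T : measurableType d) (P : probability T R) (f g : T -> R) :
  P.-integrable setT (EFin \o f) -> bmfun g ->
  P.-integrable setT (EFin \o (fun x => f x * g x)).
Proof.
move=> intf [mg [B gB]].
have mf : measurable_fun setT f by apply/measurable_EFinP; exact: measurable_int intf.
apply: (@le_integrable _ _ _ P _ measurableT _ (EFin \o (fun x => B * f x))).
- by apply/measurable_EFinP; exact: measurable_funM.
- move=> x _ /=; rewrite lee_fin !normrM mulrC ler_wpM2r//.
  exact: le_trans (ler_norm _).
- exact: (integrableZl measurableT B intf).
Qed.

Lemma dist_int_mul d (T : measurableType d) (P : probability T R) (f h g : T -> R) :
  P.-integrable setT (EFin \o f) -> P.-integrable setT (EFin \o h) ->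
  bmfun g -> (forall x, `|g x| <= 1) ->
  `|\int[P]_x (f x * g x) - \int[P]_x (h x * g x)| <= \int[P]_x `|f x - h x|.
Proof.
move=> intf inth bg g1.
have intD : P.-integrable setT (EFin \o (fun x => f x - h x)).
  exact: (integrableB measurableT intf inth).
rewrite -RintegralB//; [|exact: integrable_mulbm..].
under eq_Rintegral do rewrite -mulrBl.
have intDg := integrable_mulbm intD bg.
apply: (le_trans (le_normr_Rintegral measurableT intDg)).
apply: le_Rintegral => //.
- exact: integrable_norm intDg.
- exact: integrable_norm intD.
- by move=> x _; rewrite normrM ler_piMr.
Qed.

(* [phi] is approximated by a bounded function so closely that no coefficient
   decreases to less than half of its size, hence the factor [2 `^ q]. *)
Lemma hardy_littlewood_Lq (u : nat -> measurableTypeR R -> R) (q C : R) :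
  1 < q -> 0 <= C -> (forall n, bmfun (u n)) -> (forall n y, `|u n y| <= 1) ->
  (forall N phi, bmfun phi ->
    \sum_(n < N) n.+1%:R `^ (q - 2) * `|\int[circ]_x (phi x * u n x)| `^ q <=
    C * \int[circ]_x (`|phi x| `^ q)) ->
  forall d N (phi : Rd R d -> R), phi \in Lfun (tor d) q%:E ->
    \sum_(a : d.-tuple 'I_N) tweight R a `^ (q - 2) *
       `|\int[tor d]_x (phi x * tens u (fun i => tnth a i) x)| `^ q <=
    2 `^ q * (C ^+ d * \int[tor d]_x (`|phi x| `^ q)).
Proof.
move=> q1 C0 bu u1 HL d N phi Lphi; have q0 : 0 <= q by lra.
have q1' : (1 <= q%:E)%E by rewrite lee_fin ltW.
have iphi : (tor d).-integrable setT (EFin \o phi).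
  apply/Lfun1_integrable; apply: (Lfun_subset (q := q%:E)) Lphi => //.
  exact: fin_num_measure.
have iphiq := Lfun_integrable (ltW q1) Lphi.
pose co (f : Rd R d -> R) (a : d.-tuple 'I_N) :=
  \int[tor d]_x (f x * tens u (fun i => tnth a i) x).
pose e := \big[Num.min/1]_(a : d.-tuple 'I_N | co phi a != 0) (`|co phi a| / 2).
have e0 : 0 < e.
  by apply: lt_bigmin => // a a0; rewrite divr_gt0// normr_gt0.
have [h [bh hphi he]] := bounded_approx iphi e0.
have half a : `|co phi a| <= 2 * `|co h a|.
  have [->|a0] := eqVneq (co phi a) 0; first by rewrite normr0 mulr_ge0.
  have ea : e <= `|co phi a| / 2 by apply: bigmin_le_cond.
  have bt : bmfun (tens u (fun i => tnth a i)) by exact: bm_tens.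
  have ih := bm_integrable (tor d) bh.
  have : `|co phi a - co h a| <= e.
    by apply: le_trans he; apply: dist_int_mul => // x; exact: le1_tens.
  have := ler_distD (co h a) (co phi a) 0; rewrite !subr0; lra.
apply: (@le_trans _ _ (2 `^ q * \sum_(a : d.-tuple 'I_N) tweight R a `^ (q - 2) * `|co h a| `^ q)).
  rewrite mulr_sumr; apply: ler_sum => a _; rewrite mulrCA ler_wpM2l ?powR_ge0//.
  by rewrite -powRM// ge0_ler_powR ?nnegrE ?mulr_ge0// half.
rewrite ler_pM2l ?powR_gt0//; apply: (le_trans (hardy_littlewood_torus q1 C0 bu HL N bh)).
rewrite ler_wpM2l ?exprn_ge0//; apply: le_Rintegral => //.
- exact: (bm_integrable _ (bm_powR q0 bh)).
- by move=> x _; rewrite ge0_ler_powR ?nnegrE.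
Qed.

End torus_integral.

(** * Translation invariance on the circle *)

Section circle_translation.
Variable R : realType.
Local Notation circ := (circle R).
Local Notation mu := (@lebesgue_measure R).
Local Notation T := (measurableTypeR R).

Lemma measurable_shift (c : R) : measurable_fun [set: T] (fun x : T => x + c : T).
Proof. by apply: (@continuous_measurable_fun R) => x; apply: cvgD => //; exact: cvg_cst. Qed.

(** The image of Lebesgue measure under a translation agrees with it on half-open intervals, hence
    everywhere. *)
Lemma ge0_integral_shift (h : T -> \bar R) (a b c : R) : measurable_fun setT h ->
  (forall x, 0 <= h x)%E ->
  (\int[mu]_(x in `[a, b[) h (x + c)%R = \int[mu]_(x in `[(a + c)%R, (b + c)%R[) h x)%E.
Proof.
move=> mh h0.
have -> : `[a, b[%classic = (fun x : T => x + c : T) @^-1` `[a + c, b + c[%classic :> set T.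
  by apply/seteqP; split => x /=; rewrite !in_itv/= lerD2r ltrD2r.
have H := @ge0_integral_pushforward _ _ T T R _ (measurable_shift c) mu.
rewrite -H//; last exact: measurable_funTS.
apply/esym; apply: eq_measure_integral => [|mS A mA _]; first exact: measurable_shift.
apply: lebesgue_measure_unique => //= X [[u v] _ <-].
rewrite /pushforward/=.
have -> : (fun x : T => x + c : T) @^-1` `]u, v]%classic = `]u - c, v - c]%classic :> set T.
  by apply/seteqP; split => x /=; rewrite !in_itv/= ltrBlDr lerBrDr.
rewrite !lebesgue_measure_itv/= !lte_fin ltrD2r; case: ifP => // _.
by rewrite -!EFinB; congr EFin; ring.
Qed.

Definition periodic2pi (h : R -> \bar R) := forall x, h (x + 2 * pi) = h x.

Lemma periodic2pi_int (h : R -> \bar R) (z : int) x : periodic2pi h -> h (x + z%:~R * (2 * pi)) = h x.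
Proof.
move=> ph; have nat_case n y : h (y + n%:R * (2 * pi)) = h y.
  elim: n y => [|n IH] y; first by rewrite mul0r addr0.
  by rewrite -natr1 mulrDl mul1r addrA ph IH.
case: z => n; first exact: nat_case.
by rewrite NegzE mulrNz mulNr -[in RHS](subrK (n.+1%:R * (2 * pi)) x) nat_case.
Qed.

Lemma circle_ge0_integral (h : T -> \bar R) : measurable_fun setT h ->
  (forall x, 0 <= h x)%E ->
  (\int[circ]_x h x = ((2 * pi)^-1)%:E * \int[mu]_(x in `[0%R, (2 * pi)%R[) h x)%E.
Proof.
move=> mh h0; rewrite integral_uniform// subr0; congr (_ * _)%E.
by rewrite integral_itv_bndo_bndc//; exact: measurable_funTS.
Qed.

(** By periodicity [c] may be taken in one period; the part of the shifted cell beyond [2 * pi] is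
    then moved back to its beginning. *)
Lemma circle_shift (h : T -> \bar R) (c : R) : measurable_fun setT h ->
  (forall x, 0 <= h x)%E -> periodic2pi h ->
  (\int[circ]_x h (x + c)%R = \int[circ]_x h x)%E.
Proof.
move=> mh h0 ph.
have pi2 : 0 < 2 * pi :> R by exact: twopi_gt0.
wlog /andP[c0 c1] : c / 0 <= c < 2 * pi.
  move=> H; pose z := Num.floor (c / (2 * pi)).
  have /andP[z1 z2] := floor_itv (c / (2 * pi)).
  rewrite -(H (c - z%:~R * (2 * pi))).
    apply: eq_integral => x _; rewrite -[in RHS](periodic2pi_int z _ ph).
    by rewrite -addrA subrK.
  rewrite subr_ge0 -ler_pdivlMr// z1/= ltrBlDr.
  by move: z2; rewrite intrD ltr_pdivrMr// mulrDl mul1r addrC.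
rewrite !circle_ge0_integral//; last exact: (measurableT_comp mh (measurable_shift c)).
congr (_ * _)%E; rewrite ge0_integral_shift// add0r.
have mA a b : measurable (`[a, b[%classic : set T) by exact: measurable_itv.
have -> : `[c, 2 * pi + c[%classic = `[c, 2 * pi[%classic `|` `[2 * pi, 2 * pi + c[%classic :> set T.
  apply/seteqP; split => x /=; rewrite !in_itv/=.
    by move=> /andP[-> ->] /=; rewrite andbT; case: ltP; [left|right].
  by move=> [|] /andP[? ?]; apply/andP; split; lra.
rewrite ge0_integral_setU//; last 2 first.
  - exact: measurable_funTS.
  - apply/disj_setPS => x /=; rewrite !in_itv/= => -[/andP[_ ?] /andP[? _]]; lra.
have -> : (\int[mu]_(x in `[(2 * pi)%R, (2 * pi + c)%R[) h x = \int[mu]_(x in `[0%R, c[) h x)%E.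
  rewrite -[X in `[X, _[%classic](add0r) (addrC (2 * pi) c) -ge0_integral_shift//.
  by apply: eq_integral => x _; rewrite ph.
rewrite addeC -ge0_integral_setU//; last 2 first.
  - exact: measurable_funTS.
  - apply/disj_setPS => x /=; rewrite !in_itv/= => -[/andP[_ ?] /andP[? _]]; lra.
congr integral; apply/seteqP; split => x /=; rewrite !in_itv/=.
  by move=> [|] /andP[? ?]; apply/andP; split; lra.
by move=> /andP[-> ->] /=; rewrite andbT; case: ltP; [left|right].
Qed.
End circle_translation.

(** * Orthogonality of the trigonometric system *)

Section trigonometric_system.
Variable R : realType.
Local Notation circ := (circle R).
Local Notation T := (measurableTypeR R).

(** One family with a free phase covers sines, cosines and the shifted terms of the kernel. *)
Definition wave (k : nat) (th : R) (x : T) : R := cos (k%:R * x + th).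

Lemma bm_wave k th : bmfun (wave k th).
Proof.
split; last by exists 1 => x; rewrite ler_norml cos_geN1 cos_le1.
apply: (@continuous_measurable_fun R) => x.
apply: continuous_comp; last exact: continuous_cos.
by apply: cvgD; [apply: cvgM => //; exact: cvg_cst|exact: cvg_cst].
Qed.

Lemma wave_le1 k th x : `|wave k th x| <= 1.
Proof. by rewrite ler_norml cos_geN1 cos_le1. Qed.

Lemma wave_periodic k th x : wave k th (x + 2 * pi) = wave k th x.
Proof.
rewrite /wave -(periodicn (@cosD2pi R) k (k%:R * x + th)); congr cos.
have -> : pi *+ 2 *+ k = k%:R * (2 * pi) :> R by rewrite !mulr_natl.
by rewrite mulrDr addrAC.
Qed.

(** Translation by [pi / k] changes the sign of the wave and preserves the integral. The constant 1
    is added because [circle_shift] is about nonnegative functions. *)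
Lemma int_wave k th : (0 < k)%N -> \int[circ]_x wave k th x = 0.
Proof.
move=> k0; have kn0 : k%:R != 0 :> R by rewrite pnatr_eq0 -lt0n.
have bw := bm_wave k th.
have b1 : bmfun (fun x => 1 + wave k th x) by apply: bmD => //; exact: bm_cst.
have shiftE x : wave k th (x + pi / k%:R) = - wave k th x.
  rewrite /wave -cosDpi; congr cos; field; exact: kn0.
have : \int[circ]_x (1 + wave k th (x + pi / k%:R)) = \int[circ]_x (1 + wave k th x).
  rewrite /Rintegral; congr fine.
  apply: (@circle_shift R (fun x => (1 + wave k th x)%:E)) => //.
  - by apply/measurable_EFinP; exact: bm_measurable.
  - by move=> x; rewrite lee_fin -lerBlDl sub0r cos_geN1.
  - by move=> x; rewrite wave_periodic.
under eq_Rintegral do rewrite shiftE.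
rewrite bm_intB//; last exact: bm_cst.
rewrite bm_intD//; last exact: bm_cst.
rewrite prob_int_cst; lra.
Qed.

Lemma waveM k l th et x : wave k th x * wave l et x =
  2^-1 * (cos ((k%:R - l%:R) * x + (th - et)) + wave (k + l) (th + et) x).
Proof.
rewrite /wave natrD.
have -> : (k%:R - l%:R) * x + (th - et) = (k%:R * x + th) - (l%:R * x + et) by ring.
have -> : (k%:R + l%:R) * x + (th + et) = (k%:R * x + th) + (l%:R * x + et) by ring.
by move: (k%:R * x + th) (l%:R * x + et) => a b; rewrite cosB cosD; lra.
Qed.

Lemma int_wave_neq k l th et : k != l -> \int[circ]_x (wave k th x * wave l et x) = 0.
Proof.
wlog lk : k l th et / (l < k)%N.
  move=> H kl; have [lk|kl'|kl'] := ltngtP l k; first exact: H.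
    by under eq_Rintegral do rewrite mulrC; apply: H => //; rewrite eq_sym.
  by rewrite kl' eqxx in kl.
move=> _.
under eq_Rintegral do rewrite waveM -natrB ?(ltnW lk)// -/(wave _ _ _).
rewrite bm_intZ; last by apply: bmD; exact: bm_wave.
rewrite bm_intD; [|exact: bm_wave..].
by rewrite !int_wave ?addr0 ?mulr0// ?subn_gt0// addn_gt0 (leq_ltn_trans (leq0n l) lk).
Qed.

Lemma int_wave_eq k th et : (0 < k)%N ->
  \int[circ]_x (wave k th x * wave k et x) = 2^-1 * cos (th - et).
Proof.
move=> k0.
under eq_Rintegral do rewrite waveM subrr mul0r add0r.
rewrite bm_intZ; last by apply: bmD; [exact: bm_cst|exact: bm_wave].
rewrite bm_intD; [|exact: bm_cst|exact: bm_wave].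
by rewrite int_wave ?addr0 ?prob_int_cst// addn_gt0 k0.
Qed.

(* [trigs 0] is [trig], and [trigs rho] shifts the phase of every nonconstant
   function of the system by [rho]. *)
Definition phase (rho : R) (n : nat) : R :=
  if n == 0%N then 0 else rho - (odd n)%:R * (pi / 2).
Definition trigs (rho : R) (n : nat) : T -> R := wave (uphalf n) (phase rho n).

Lemma trigE n x : trig n x = trigs 0 n x.
Proof.
rewrite /trig /trigs /wave /phase; case: n => [|n].
  by rewrite /= addr0.
rewrite uphalf_half; case: (odd n.+1); rewrite /= ?add1n ?add0n sub0r.
  by rewrite mul1r cosBpihalf.
by rewrite mul0r oppr0 addr0.
Qed.

Lemma bm_trigs rho n : bmfun (trigs rho n). Proof. exact: bm_wave. Qed.

Lemma trigs_le1 rho n x : `|trigs rho n x| <= 1. Proof. exact: wave_le1. Qed.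

(** Distinct indices of equal frequency have opposite parity, hence phases that differ by [pi / 2],
    whatever [rho] is. *)
Lemma trigs_orth rho n m : n != m -> \int[circ]_x (trigs rho n x * trigs rho m x) = 0.
Proof.
move=> nm; have [e|ne] := eqVneq (uphalf n) (uphalf m); last exact: int_wave_neq.
rewrite /trigs e.
have onm : odd n != odd m.
  apply: contraNneq nm => onm; move: e; rewrite !uphalf_half onm => /addnI e.
  by rewrite -(odd_double_half n) -(odd_double_half m) onm e.
have m0 : (0 < uphalf m)%N.
  by case: n m e onm {nm} => [|n] [|m].
have [n0' m0'] : n <> 0%N /\ m <> 0%N.
  by split=> h; move: m0; [rewrite -e h|rewrite h].
rewrite int_wave_eq// /phase; move/eqP/negbTE: n0' => ->; move/eqP/negbTE: m0' => ->.
case: (odd n) (odd m) onm => [] [] //= _.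
  have -> : rho - 1 * (pi / 2) - (rho - 0 * (pi / 2)) = - (pi / 2) :> R by ring.
  by rewrite cosN cos_pihalf mulr0.
have -> : rho - 0 * (pi / 2) - (rho - 1 * (pi / 2)) = pi / 2 :> R by ring.
by rewrite cos_pihalf mulr0.
Qed.

Lemma trigs_sqr_ge rho n : 2^-1 <= \int[circ]_x (trigs rho n x ^+ 2).
Proof.
case: n => [|n].
  have -> : \int[circ]_x (trigs rho 0 x ^+ 2) = \int[circ]_x (1 : R).
    by apply: eq_Rintegral => x _; rewrite /trigs /wave /phase/= mul0r addr0 cos0 expr1n.
  by rewrite prob_int_cst invf_le1// ler1n.
by under eq_Rintegral do rewrite expr2; rewrite int_wave_eq// subrr cos0 mulr1.
Qed.

Lemma trigs_sqr_le rho n : \int[circ]_x (trigs rho n x ^+ 2) <= 1.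
Proof.
rewrite -[leRHS](prob_int_cst circ 1); apply: bm_int_le.
- exact: bmX (bm_trigs _ _).
- exact: bm_cst.
- by move=> x; rewrite -(real_normK (num_real (trigs rho n x))) expr_le1// trigs_le1.
Qed.
End trigonometric_system.

(** * Bessel's inequality *)

Section bessel.
Context d (T : measurableType d) (R : realType) (P : probability T R).
Variable u : nat -> T -> R.
Hypothesis bu : forall n, bmfun (u n).
Hypothesis u_orth : forall n m, n != m -> \int[P]_x (u n x * u m x) = 0.
Hypothesis u_sqr : forall n, \int[P]_x (u n x ^+ 2) <= 1.

Lemma orthogonal_sum_sqr (N : nat) (Q : pred 'I_N) (c : 'I_N -> R) :
  \int[P]_x ((\sum_(n < N | Q n) c n * u n x) ^+ 2) <= \sum_(n < N | Q n) c n ^+ 2.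
Proof.
have bcu n : bmfun (fun x => c n * u n x) by exact: bmZ.
have bS : bmfun (fun x => \sum_(n < N | Q n) c n * u n x) by exact: bm_sum.
under eq_Rintegral do rewrite expr2 mulr_suml.
rewrite bm_int_sum; last by move=> n _; exact: bmM.
apply: ler_sum => n Qn; under eq_Rintegral do rewrite -mulrA mulr_sumr.
have bum m : bmfun (fun x => u n x * (c m * u m x)) by exact: bmM.
rewrite bm_intZ; last by apply: bm_sum.
rewrite bm_int_sum// (bigD1 n)//= big1 ?addr0 => [|m /andP[_ mn]].
  under eq_Rintegral do rewrite mulrCA -expr2.
  rewrite bm_intZ ?mulrA -?expr2; last exact: bmX.
  by rewrite ler_piMr ?sqr_ge0.
under eq_Rintegral do rewrite mulrCA.
rewrite bm_intZ; last exact: bmM.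
by rewrite u_orth ?mulr0// eq_sym.
Qed.

(** [S] is not the orthogonal projection, the [u n] having norm at most 1 only, but the square of
    [S] integrates to at most the sum of [c n ^ 2], which is all that expanding the square of
    [phi - S] requires. *)
Lemma bessel_inequality N phi : bmfun phi ->
  \sum_(n < N) (\int[P]_x (phi x * u n x)) ^+ 2 <= \int[P]_x (phi x ^+ 2).
Proof.
move=> bphi; pose c (n : 'I_N) := \int[P]_x (phi x * u n x).
pose S x := \sum_(n < N) c n * u n x.
have bS : bmfun S by apply: bm_sum => n _; exact: bmZ.
have bphiS : bmfun (fun x => phi x * S x) by exact: bmM.
have h0 : 0 <= \int[P]_x ((phi x - S x) ^+ 2).
  by apply: bm_int_ge0 => x; exact: sqr_ge0.
have e1 : \int[P]_x (phi x * S x) = \sum_(n < N) c n ^+ 2.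
  under eq_Rintegral do rewrite mulr_sumr.
  rewrite bm_int_sum; last by move=> n _; apply: bmM => //; exact: bmZ.
  apply: eq_bigr => n _; under eq_Rintegral do rewrite mulrCA.
  by rewrite bm_intZ//; exact: bmM.
have e2 : \int[P]_x (S x ^+ 2) <= \sum_(n < N) c n ^+ 2 by exact: orthogonal_sum_sqr.
have e3 : \int[P]_x ((phi x - S x) ^+ 2) =
    \int[P]_x (phi x ^+ 2) - 2 * \int[P]_x (phi x * S x) + \int[P]_x (S x ^+ 2).
  rewrite -bm_intZ// -bm_intB; [|exact: bmX|exact: bmZ].
  rewrite -bm_intD; [|by apply: bmB; [exact: bmX|exact: bmZ]|exact: bmX].
  by apply: eq_Rintegral => x _; ring.
rewrite -/c; move: h0; rewrite e3 e1; lra.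
Qed.
End bessel.

(** Bessel's inequality for the system whose only nonzero member is the constant 1. *)
Lemma sqr_int_abs d (T : measurableType d) (R : realType) (P : probability T R) (h : T -> R) :
  bmfun h -> (\int[P]_x `|h x|) ^+ 2 <= \int[P]_x (h x ^+ 2).
Proof.
move=> bh; pose u (n : nat) (x : T) : R := (n == 0%N)%:R.
have bu n : bmfun (u n) by exact: bm_cst.
have uo n m : n != m -> \int[P]_x (u n x * u m x) = 0.
  move=> nm; rewrite /u prob_int_cst; case: n m nm => [|n] [|m]//= _; rewrite ?mulr0//.
  by rewrite mul0r.
have us n : \int[P]_x (u n x ^+ 2) <= 1.
  by rewrite /u prob_int_cst; case: n => [|n]; rewrite ?expr1n// expr0n/=.
have := bessel_inequality bu uo us 1 (bm_abs bh).
rewrite big_ord_recl big_ord0 addr0/=.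
under eq_Rintegral do rewrite mulr1.
by under [X in _ <= X -> _]eq_Rintegral do rewrite real_normK ?num_real//.
Qed.

(** * The univariate kernel and its partial sums *)

Section kernel.
Variables (R : realType) (r : R).
Hypothesis r_gt0 : 0 < r.
Local Notation circ := (circle R).
Local Notation T := (measurableTypeR R).
Let rho : R := r * pi / 2.

Let decay (j : nat) : R := j.+1%:R `^ (- r).

Let wsum (N : nat) (x : R) : R := \sum_(j < N) decay j * wave j.+1 (- rho) x.

Definition kernel_sum (N : nat) (x : R) : R := 1 + 2 * wsum N x.

Lemma bm_kernel_sum N : bmfun (kernel_sum N : T -> R).
Proof.
apply: bmD; first exact: bm_cst.
by apply: bmZ; apply: bm_sum => j _; apply: bmZ; exact: bm_wave.
Qed.

Let decay_ge0 j : 0 <= decay j. Proof. exact: powR_ge0. Qed.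

Let decay_noninc j : decay j.+1 <= decay j.
Proof.
rewrite /decay !powRN lef_pV2 ?posrE ?powR_gt0//.
by rewrite ge0_ler_powR ?nnegrE ?(ltW r_gt0)// ler_nat.
Qed.

Let decay_cvg : decay @ \oo --> 0.
Proof.
apply/cvgrPdist_le => e e0.
pose M := (Num.bound (e^-1 `^ r^-1)).
exists M => // n /= Mn; rewrite sub0r normrN ger0_norm//.
rewrite /decay powRN invf_ple ?posrE ?powR_gt0//.
have : e^-1 `^ r^-1 <= n.+1%:R.
  have e10 : 0 <= e^-1 `^ r^-1 by exact: powR_ge0.
  by rewrite (le_trans (ltW (archi_boundP e10)))// ler_nat (leq_trans Mn).
move/(ge0_ler_powR (ltW r_gt0)) => /(_ _ _)/=; rewrite !nnegrE => /(_ (powR_ge0 _ _) (ler0n _ _)).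
by rewrite -powRrM mulVf ?gt_eqF// powRr1// invr_ge0 ltW.
Qed.

Let wsum_F1 x N : \sum_(1 <= k < N.+1) (k%:R `^ (- r)) * cos (k%:R * x - r * pi / 2) = wsum N x.
Proof. by rewrite /wsum big_add1/= big_mkord. Qed.

(* Summation by parts: [2 sin(x/2) cos(kx - rho)] telescopes. *)
Let wsum_abel x N :
  2 * sin (x / 2) * wsum N x =
  decay N * sin ((N%:R + 2^-1) * x - rho) - decay 0 * sin (2^-1 * x - rho) +
  \sum_(j < N) (decay j - decay j.+1) * sin ((j.+1%:R + 2^-1) * x - rho).
Proof.
elim: N => [|N IH]; first by rewrite /wsum !big_ord0 mulr0 add0r subrr addr0.
rewrite big_ord_recr/= /wsum big_ord_recr/= -/(wsum N x) mulrDr IH.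
have E : 2 * sin (x / 2) * wave N.+1 (- rho) x =
    sin ((N.+1%:R + 2^-1) * x - rho) - sin ((N%:R + 2^-1) * x - rho).
  rewrite /wave.
  have -> : (N.+1%:R + 2^-1) * x - rho = (N.+1%:R * x - rho) + x / 2 by ring.
  have -> : (N%:R + 2^-1) * x - rho = (N.+1%:R * x - rho) + - (x / 2).
    by rewrite -natr1; field.
  move: (N.+1%:R * x - rho) (x / 2) => a b.
  by rewrite !sinD cosN sinN; ring.
rewrite mulrCA E; ring.
Qed.

(** Dirichlet's test: in [wsum_abel] the differences of [decay] are nonnegative and telescope, so
    the series on the right converges absolutely. *)
Let wsum_is_cvg x : sin (x / 2) != 0 -> cvgn (wsum ^~ x).
Proof.
move=> s0.
pose v j := (decay j - decay j.+1) * sin ((j.+1%:R + 2^-1) * x - rho).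
have cv : cvgn (series v).
  apply: normed_cvg.
  apply: (@series_le_cvg _ _ (fun j => decay j - decay j.+1)) => [j|j|j|] /=.
  - exact: normr_ge0.
  - by rewrite subr_ge0.
  - rewrite normrM ger0_norm ?subr_ge0// ler_piMr ?subr_ge0//.
    by rewrite ler_norml sin_geN1 sin_le1.
  - have -> : series (fun j => decay j - decay j.+1) = (fun n => decay 0 - decay n).
      apply/funext => n; rewrite /series/= -[RHS]opprB -telescope_sumr// -sumrN.
      by apply: eq_bigr => i _; rewrite opprB.
    by apply: is_cvgB; [exact: is_cvg_cst|apply/cvg_ex; exists 0].
have -> : wsum ^~ x = (fun N => (2 * sin (x / 2))^-1 *
    (decay N * sin ((N%:R + 2^-1) * x - rho) - decay 0 * sin (2^-1 * x - rho) + series v N)).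
  apply/funext => N.
  have d0 : 2 * sin (x / 2) != 0 by rewrite mulf_neq0.
  by rewrite /series/= big_mkord -wsum_abel mulKf.
apply: is_cvgM; first exact: is_cvg_cst.
apply: is_cvgD => //; apply: is_cvgB; last exact: is_cvg_cst.
apply/cvg_ex; exists 0.
apply/cvgrPdist_le => e e0; move/cvgrPdist_le : decay_cvg => /(_ _ e0).
apply: filterS => n; rewrite !sub0r !normrN normrM; apply: le_trans.
by rewrite ler_piMr// ler_norml sin_geN1 sin_le1.
Qed.

Lemma kernel_sum_cvg x : sin (x / 2) != 0 -> kernel_sum ^~ x @ \oo --> F1 r x.
Proof.
move=> s0; rewrite /F1; apply: cvgD; first exact: cvg_cst.
apply: cvgM; first exact: cvg_cst.
suff -> : limn (fun n => \sum_(1 <= k < n) (k%:R `^ (- r)) * cos (k%:R * x - r * pi / 2)) =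
    limn (wsum ^~ x) by exact: wsum_is_cvg.
apply: cvg_lim => //; rewrite -cvg_shiftS/=.
rewrite (_ : (fun n => _) = wsum ^~ x); last by apply/funext => n; rewrite wsum_F1.
exact: wsum_is_cvg.
Qed.

Let F1_ext x y :
  (forall k, cos (k%:R * x - r * pi / 2) = cos (k%:R * y - r * pi / 2)) -> F1 r x = F1 r y.
Proof.
by move=> e; rewrite /F1; under [X in limn X]eq_fun => n do under eq_bigr do rewrite e.
Qed.

Lemma F1_periodic x : F1 r (x + 2 * pi) = F1 r x.
Proof. by apply: F1_ext => k; exact: wave_periodic. Qed.

(** At multiples of [2 * pi] the partial sums are those at 0, so the value is the same there,
    whatever [limn] returns. This settles the measurability of [F1] on the exceptional set. *)
Lemma F1_sin0 x : sin (x / 2) = 0 -> F1 r x = F1 r 0.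
Proof.
move=> s0; apply: F1_ext => k; rewrite mulr0 !cosB cos0 sin0.
have x2 : x = x / 2 + x / 2 by lra.
have sx : sin x = 0 by rewrite x2 sinD s0 mul0r mulr0 addr0.
have cx : cos x = 1.
  have := cos2Dsin2 (x / 2); rewrite s0 expr0n addr0 => c2.
  by rewrite x2 cosD s0 mulr0 subr0 -expr2.
have [-> ->] : cos (k%:R * x) = 1 /\ sin (k%:R * x) = 0.
  elim: k => [|k [IHc IHs]]; first by rewrite mul0r cos0 sin0.
  by rewrite -natr1 mulrDl mul1r cosD sinD IHc IHs sx cx; split; ring.
by [].
Qed.

Let zeros : set T := [set x | sin (x / 2) = 0].

Let measurable_sinhalf : measurable_fun setT (fun x : T => sin (x / 2)).
Proof.
apply: (@continuous_measurable_fun R) => x.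
apply: continuous_comp; last exact: continuous_sin.
by apply: cvgM => //; exact: cvg_cst.
Qed.

Let measurable_zeros : measurable zeros.
Proof.
rewrite (_ : zeros = setT `&` (fun x : T => sin (x / 2)) @^-1` [set 0]); last by rewrite setTI.
exact: measurable_sinhalf.
Qed.

Lemma measurable_F1 : measurable_fun setT (F1 r : T -> R).
Proof.
rewrite -(setvU zeros); apply/measurable_funU => //; first exact: measurableC.
split.
  apply: (@measurable_fun_cvg _ _ _ _ kernel_sum) => //.
  - by move=> N; apply: measurable_funTS; exact: (bm_kernel_sum N).1.
  - by move=> x /= /eqP; exact: kernel_sum_cvg.
apply: (eq_measurable_fun (cst (F1 r 0))) => //.
by move=> x; rewrite inE => /F1_sin0 ->.
Qed.

Let circ_zeros : circ zeros = 0.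
Proof.
pose E := zeros `&` `[0, 2 * pi]%classic.
have -> : circ zeros = circ E by exact: integral_uniform_pdf.
have mE : measurable E by apply: measurableI => //; exact: measurable_itv.
have muE : lebesgue_measure E = 0.
  apply: (@subset_measure0 _ _ _ (@lebesgue_measure R) E ([set 0] `|` [set 2 * pi])) => //.
  - by apply: measurableU; exact: measurable_set1.
  - move=> x [/= s0]; rewrite in_itv/= => /andP[x0 x2].
    have [->|xn0] := eqVneq x 0; first by left.
    have [->|xn2] := eqVneq x (2 * pi); first by right.
    have : 0 < sin (x / 2).
      have xp : 0 < x by rewrite lt_def xn0.
      have x2' : x < 2 * pi by rewrite lt_def x2 eq_sym xn2.
      by apply: sin_gt0_pi; apply/andP; split; lra.
    by rewrite s0 ltxx.
  - apply: etrans (lebesgue_measure_set1 0).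
    apply: (@measureU0 _ _ _ (@lebesgue_measure R)); [exact: measurable_set1..|].
    exact: lebesgue_measure_set1.
exact: ((null_content_dominatesP _ _).1 (@dominates_uniform_prob R _ _ (twopi_gt0 R)) E mE muE).
Qed.

Hypothesis r_gt : 2^-1 < r.

(** The L^1 norm is at most the L^2 norm, whose square is by orthogonality at most a tail of
    [4 * j ^ (- 2 r)]; its convergence is the condition [r > 1/2]. *)
Lemma kernel_sum_dist : exists2 C, 0 <= C & forall N M, (0 < N <= M)%N ->
  \int[circ]_x `|kernel_sum M x - kernel_sum N x| <= C * N%:R `^ (2^-1 - r).
Proof.
pose C := 4 * (2 `^ (2 * r) / (2 * r - 1)).
have r1 : 1 < 2 * r by move: r_gt; lra.
have C0 : 0 <= C by rewrite /C mulr_ge0// divr_ge0 ?powR_ge0// subr_ge0 ltW.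
exists (Num.sqrt C) => [|N M /andP[N0 NM]]; first exact: sqrtr_ge0.
have bD : bmfun (fun x : T => kernel_sum M x - kernel_sum N x).
  by apply: bmB; exact: bm_kernel_sum.
have DE x : kernel_sum M x - kernel_sum N x =
    \sum_(j < M | (N <= j)%N) 2 * decay j * wave j.+1 (- rho) x.
  rewrite /kernel_sum /wsum (big_ord_widen _ (fun j => decay j * wave j.+1 (- rho) x) NM).
  rewrite (bigID (fun j : 'I_M => (j < N)%N))/= opprD addrACA subrr add0r -mulrBr addrAC subrr add0r.
  rewrite mulr_sumr; apply: eq_big => [j|j _]; first by rewrite -leqNgt.
  by rewrite mulrA.
have sq : \int[circ]_x ((kernel_sum M x - kernel_sum N x) ^+ 2) <= C * N%:R `^ (1 - 2 * r).
  under eq_Rintegral do rewrite DE.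
  have wo n m : n != m -> \int[circ]_x (wave n.+1 (- rho) x * wave m.+1 (- rho) x) = 0.
    by move=> nm; rewrite int_wave_neq// eqSS.
  have ws n : \int[circ]_x (wave n.+1 (- rho) x ^+ 2) <= 1.
    rewrite -[leRHS](prob_int_cst circ 1); apply: bm_int_le => [||x].
    - exact: bmX (bm_wave _ _).
    - exact: bm_cst.
    - by rewrite -(real_normK (num_real _)) expr_le1// wave_le1.
  apply: (le_trans (orthogonal_sum_sqr (u := fun j => wave j.+1 (- rho))
    (fun n => bm_wave n.+1 (- rho)) wo ws (fun j : 'I_M => (N <= j)%N) (fun j => 2 * decay j))).
  rewrite (eq_bigr (fun j : 'I_M => 4 * j.+1%:R `^ (- (2 * r)))); last first.
    move=> j _; rewrite exprMn /decay -natrX; congr (_ * _).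
    by rewrite -powR_mulrn ?powR_ge0// -powRrM; congr powR; ring.
  rewrite -mulr_sumr /C -mulrA ler_pM2l//.
  have N0' : 0 < N%:R :> R by rewrite ltr0n.
  apply: le_trans (powR_tail M r1 N0').
  by under [X in _ <= X]eq_bigl do rewrite ltr_nat ltnS.
have := le_trans (sqr_int_abs circ bD) sq.
rewrite -ler_sqrt; last by rewrite mulr_ge0 ?powR_ge0.
rewrite sqrtr_sqr ger0_norm; last by apply: bm_int_ge0.
rewrite sqrtrM// -(powR12_sqrt (powR_ge0 _ _)) -powRrM.
by rewrite (_ : (1 - 2 * r) * 2^-1 = 2^-1 - r)//; field.
Qed.

(** Fatou's lemma as [M] tends to infinity in [kernel_sum_dist]. *)
Lemma F1_kernel_dist : exists2 C, 0 <= C & forall N, (0 < N)%N ->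
  (\int[circ]_x `|F1 r x - kernel_sum N x|%:E <= (C * N%:R `^ (2^-1 - r))%:E)%E.
Proof.
have [C C0 HC] := kernel_sum_dist; exists C => // N N0.
(* Multiplication by [J] makes the partial sums converge at every point and changes the integrand on
   a null set only. *)
pose J (x : T) : R := \1_(~` zeros) x.
have bJ : bmfun J.
  split; first exact: measurable_indic (measurableC measurable_zeros).
  by exists 1 => x; rewrite /J indicE; case: (_ \in _); rewrite ?normr1 ?normr0.
have bD M : bmfun (fun x : T => `|kernel_sum M x - kernel_sum N x|).
  by apply: bm_abs; apply: bmB; exact: bm_kernel_sum.
have bJD M : bmfun (fun x : T => J x * `|kernel_sum M x - kernel_sum N x|) by exact: bmM.
have mF : measurable_fun setT (fun x : T => `|F1 r x - kernel_sum N x|).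
  apply: measurableT_comp => //; apply: measurable_funB; first exact: measurable_F1.
  exact: (bm_kernel_sum N).1.
have J0 x : 0 <= J x by rewrite /J indicE; case: (_ \in _).
have lim x : limn_einf (fun M => (J x * `|kernel_sum M x - kernel_sum N x|)%:E) =
    (J x * `|F1 r x - kernel_sum N x|)%:E.
  apply: (cvg_limn_einf_sup _).1; apply: cvg_EFin; first exact: nearW.
  have [s0|s0] := eqVneq (sin (x / 2)) 0.
    have -> : J x = 0 by rewrite /J indicE memNset.
    by rewrite mul0r; apply: cvg_near_cst; apply: nearW => M; rewrite /= mul0r.
  apply: cvgM; first exact: cvg_cst.
  by apply: cvg_norm; apply: cvgB; [exact: kernel_sum_cvg|exact: cvg_cst].
have fat := @fatou _ _ _ circ _ measurableT
  (fun M x => (J x * `|kernel_sum M x - kernel_sum N x|)%:E)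
  (fun M => (measurable_EFinP _ _).2 (bJD M).1)
  (fun M x _ => ltac:(by rewrite lee_fin mulr_ge0)).
move: fat; under [X in (X <= _)%E -> _]eq_integral do rewrite lim; move=> fat.
apply: (@le_trans _ _ (\int[circ]_x (J x * `|F1 r x - kernel_sum N x|)%:E)%E).
  rewrite le_eqVlt; apply/orP; left; apply/eqP.
  apply: ge0_ae_eq_integral => //.
  - exact/measurable_EFinP.
  - by apply/measurable_EFinP; apply: measurable_funM => //; exact: bJ.1.
  - by move=> x _; rewrite lee_fin mulr_ge0.
  exists zeros; split => // x /=; apply: contra_notP => xz; move=> _; congr EFin.
  by rewrite /J indicE mem_set// mul1r.
apply: (le_trans fat).
rewrite limn_einf_lim; apply: lime_le; first exact: is_cvg_einfs.
near=> M.
apply: (@le_trans _ _ (\int[circ]_x (J x * `|kernel_sum M x - kernel_sum N x|)%:E)%E).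
  by apply: ereal_inf_lbound; exists M => //=.
rewrite -[leLHS]fineK; last exact: integrable_fin_num (bm_integrable circ (bJD M)).
rewrite lee_fin; apply: (@le_trans _ _ (\int[circ]_x `|kernel_sum M x - kernel_sum N x|)).
  apply: bm_int_le => // x.
  by rewrite ler_piMl// /J indicE; case: (_ \in _).
apply: HC; rewrite N0; near: M; exact: nbhs_infty_ge.
Unshelve. all: by end_near.
Qed.

(** The Fourier multiplier of convolution with the kernel, in the enumeration of [trig]. *)
Definition mult (n : nat) : R := if n == 0%N then 1 else 2 * (uphalf n)%:R `^ (- r).

Lemma mult_ge0 n : 0 <= mult n.
Proof. by rewrite /mult; case: ifP => // _; rewrite mulr_ge0 ?powR_ge0. Qed.

(** For [n > 0] the frequency [uphalf n] is at least [n.+1 / 4]. *)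
Lemma mult_le n : mult n <= 2 * 4 `^ r * n.+1%:R `^ (- r).
Proof.
have c1 : 1 <= 2 * 4 `^ r :> R.
  have : 1 <= 4 `^ r :> R.
    have : 1 `^ r <= 4 `^ r :> R by rewrite ge0_ler_powR ?nnegrE ?(ltW r_gt0)// ler1n.
    by rewrite powR1.
  lra.
rewrite /mult; case: n => [|n]/=; first by rewrite powR1 mulr1.
rewrite -mulrA ler_pM2l// (_ : 4 `^ r = 4^-1 `^ (- r)); last first.
  have h4 : 4^-1 = 4 `^ (-1) :> R by rewrite powR_inv1.
  by rewrite h4 -powRrM; congr powR; ring.
rewrite -powRM// !powRN lef_pV2 ?posrE ?powR_gt0// ?ltr0n ?mulr_gt0 ?ltr0n//.
rewrite ge0_ler_powR ?nnegrE ?(ltW r_gt0)// ?mulr_ge0//.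
rewrite ler_pdivrMl// -natrM ler_nat.
have := odd_double_half n; rewrite -muln2; case: (odd n) => /=; lia.
Qed.

(** By the addition theorem [cos (k(x - y) - rho)] is [cos (kx) cos (ky + rho) + sin (kx) sin (ky +
    rho)]: the phase goes entirely to [y]. The constant and two functions per frequency make
    [N.*2.+1] indices. *)
Lemma kernel_sumB N x y :
  kernel_sum N (x - y) = \sum_(n < N.*2.+1) mult n * trig n x * trigs rho n y.
Proof.
rewrite /kernel_sum; elim: N => [|N IH].
  rewrite /wsum big_ord0 mulr0 addr0 big_ord_recl big_ord0 addr0 /mult/= trigE.
  by rewrite /trigs /wave /phase/= !mul0r !addr0 cos0 !mul1r.
rewrite doubleS big_ord_recr big_ord_recr/= -IH /wsum big_ord_recr/= mulrDr addrA -[RHS]addrA.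
congr (_ + _).
rewrite !trigE /trigs /mult /phase/= !odd_double/= !uphalf_double !doubleK /decay /wave.
rewrite !mul1r !mul0r !subr0 !addr0 sub0r.
have -> : N.+1%:R * (x - y) + - rho = N.+1%:R * x - (N.+1%:R * y + rho) by ring.
rewrite cosB addrA !cosBpihalf; ring.
Qed.
End kernel.

(** * Convolution with the kernel and its approximation in L^1 *)

Section convolution_L1.
Variables (R : realType) (r : R).
Hypothesis r_gt : 2^-1 < r.
Local Notation circ := (circle R).
Local Notation tor := (torus R).
Local Notation T := (measurableTypeR R).
Let rho : R := r * pi / 2.
Let r_gt0 : 0 < r. Proof. by apply: lt_trans r_gt; rewrite invr_gt0. Qed.

Definition tker d (h : R -> R) (x : Rd R d) : R := \prod_(i < d) h (tnth x i).

Lemma measurable_tker d (h : T -> R) : measurable_fun setT h -> measurable_fun setT (@tker d h).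
Proof.
move=> mh; rewrite /tker; apply: measurable_prod => i _.
exact: (measurableT_comp mh (measurable_tnth i)).
Qed.

Lemma measurable_subRd d : measurable_fun setT (fun z : Rd R d * Rd R d => subRd z.1 z.2).
Proof.
apply/measurable_fun_tnthP => i.
rewrite (_ : _ \o _ = fun z : Rd R d * Rd R d => (tnth z.1 i : R) - tnth z.2 i); last first.
  by apply/funext => z /=; rewrite tnth_mktuple.
apply: measurable_funB.
  exact: (measurableT_comp (measurable_tnth i) measurable_fst).
exact: (measurableT_comp (measurable_tnth i) measurable_snd).
Qed.

Lemma measurable_subRdl d (y : Rd R d) : measurable_fun setT (fun x : Rd R d => subRd x y).
Proof.
have mp : measurable_fun setT (fun x : Rd R d => (x, y)) by exact: measurable_fun_pair.
exact: (measurableT_comp (@measurable_subRd d) mp).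
Qed.

Lemma subRd_tcons d x1 y1 (x y : Rd R d) :
  subRd (tcons (x1, x)) (tcons (y1, y)) = tcons ((x1 : R) - y1 : T, subRd x y).
Proof.
apply: eq_from_tnth => i; rewrite tnth_mktuple /tcons/=.
by case: (unliftP ord0 i) => [j ->|->]; rewrite ?tnth0// !tnthS tnth_mktuple.
Qed.

Lemma tker_tcons d h x1 (x : Rd R d) : tker h (tcons (x1, x)) = h x1 * tker h x.
Proof.
rewrite /tker big_ord_recl /tcons/= tnth0; congr (_ * _).
by apply: eq_bigr => i _; rewrite tnthS.
Qed.

Lemma Rd_tcons d (x : Rd R d.+1) : exists x1 (x' : Rd R d), x = tcons (x1, x').
Proof. by exists (thead x), [tuple of behead x]; exact: tuple_eta. Qed.

(** Both bounds are proved together, one coordinate at a time, from [f1 * F - g1 * G = (f1 - g1) * F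
    + g1 * (F - G)] and translation invariance. *)
Lemma tker_shift_bound (A e : R) (f g : T -> R) d (y : Rd R d) :
  1 <= A -> 0 <= e -> measurable_fun setT f -> measurable_fun setT g ->
  (forall x, f (x + 2 * pi) = f x) -> (forall x, g (x + 2 * pi) = g x) ->
  (\int[circ]_x `|f x|%:E <= A%:E)%E -> (\int[circ]_x `|g x|%:E <= A%:E)%E ->
  (\int[circ]_x `|f x - g x|%:E <= e%:E)%E ->
  (\int[tor d]_x `|tker f (subRd x y)|%:E <= (A ^+ d)%:E)%E /\
  (\int[tor d]_x `|tker f (subRd x y) - tker g (subRd x y)|%:E <= (d%:R * A ^+ d * e)%:E)%E.
Proof.
move=> A1 e0 mf mg pf pg fA gA fg.
have A0 : 0 <= A by exact: le_trans A1.
have mtk (h : T -> R) n (z : Rd R n) : measurable_fun setT h -> measurable_fun setT (fun x => tker h (subRd x z)).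
  move=> mh; apply: (measurableT_comp (measurable_tker mh)).
  exact: measurable_subRdl.
have msh (h : T -> R) (z : R) : measurable_fun setT h -> measurable_fun setT (fun x : T => h (x - z)).
  by move=> mh; exact: (measurableT_comp mh (measurable_shift (- z))).
have sh (h : T -> R) (z : R) : measurable_fun setT h -> (forall x, h (x + 2 * pi) = h x) ->
    (\int[circ]_x `|h (x - z)|%:E = \int[circ]_x `|h x|%:E)%E.
  move=> mh ph; apply: (@circle_shift R (fun x => `|h x|%:E) (- z)) => //.
    by apply/measurable_EFinP; exact: measurableT_comp.
  by move=> x; rewrite ph.
elim: d y => [|d IH] y.
  split.
    under eq_integral do rewrite /tker big_ord0 normr1.
    by rewrite integral_cst//= diracT mul1e.
  under eq_integral do rewrite /tker !big_ord0 subrr normr0.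
  by rewrite integral0 !mul0r.
have [y1 [y' ->]] := Rd_tcons y.
have [IH1 IH2] := IH y'.
split.
  rewrite torus_ge0_intS//; last first.
    by apply/measurable_EFinP; apply: measurableT_comp => //; exact: mtk.
  under eq_integral => x' _.
    under eq_integral => x1 _ do rewrite subRd_tcons tker_tcons normrM EFinM.
    rewrite ge0_integralZr//; last first.
      by apply/measurable_EFinP; apply: measurableT_comp => //; exact: msh.
    rewrite sh//; over.
  rewrite /= ge0_integralZl//; last 2 first.
  - by apply/measurable_EFinP; apply: measurableT_comp => //; exact: mtk.
  - by apply: integral_ge0.
  rewrite exprS EFinM; apply: lee_pmul => //; exact: integral_ge0.
have mD n (z : Rd R n) : measurable_fun setT
    (fun x => `|tker f (subRd x z) - tker g (subRd x z)|%:E).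
  by apply/measurable_EFinP; apply: measurableT_comp => //; apply: measurable_funB; exact: mtk.
have mT n (z : Rd R n) : measurable_fun setT (fun x => `|tker f (subRd x z)|%:E).
  by apply/measurable_EFinP; apply: measurableT_comp => //; exact: mtk.
rewrite torus_ge0_intS//.
have m1 x' : measurable_fun setT (fun x1 : T => (`|f (x1 - y1) - g (x1 - y1)| * `|tker f (subRd x' y')|)%:E).
  apply/measurable_EFinP; apply: measurable_funM => //; apply: measurableT_comp => //.
  by apply: measurable_funB; exact: msh.
have m2 x' : measurable_fun setT (fun x1 : T => (`|g (x1 - y1)| * `|tker f (subRd x' y') - tker g (subRd x' y')|)%:E).
  apply/measurable_EFinP; apply: measurable_funM => //; apply: measurableT_comp => //.
  exact: msh.
apply: (@le_trans _ _ (\int[tor d]_x' (e%:E * `|tker f (subRd x' y')|%:E +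
    A%:E * `|tker f (subRd x' y') - tker g (subRd x' y')|%:E))%E).
  apply: ge0_le_integral => //.
  - by move=> x' _; exact: integral_ge0.
  - have mDt := measurableT_comp (mD _ (tcons (y1, y'))) (@measurable_tcons R d).
    by apply: (measurable_fun_fubini_tonelli_G _ mDt) => z; rewrite lee_fin.
  - by apply: emeasurable_funD; apply: measurable_funeM; [exact: mT|exact: mD].
  move=> x' _.
  apply: (@le_trans _ _ (\int[circ]_x1 (
      (`|f (x1 - y1) - g (x1 - y1)| * `|tker f (subRd x' y')|)%:E +
      (`|g (x1 - y1)| * `|tker f (subRd x' y') - tker g (subRd x' y')|)%:E))%E).
    apply: ge0_le_integral => //.
    - exact: (measurableT_comp (mD _ (tcons (y1, y'))) (@measurable_tcons1 R d x')).
    - exact: emeasurable_funD.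
    move=> x1 _; rewrite subRd_tcons !tker_tcons -EFinD lee_fin -!normrM.
    apply: le_trans (ler_normD _ _); rewrite le_eqVlt; apply/orP; left; apply/eqP.
    by congr (`|_|); ring.
  rewrite ge0_integralD//.
  under eq_integral => x1 _ do rewrite EFinM.
  under [X in (_ + X)%E]eq_integral => x1 _ do rewrite EFinM.
  rewrite ge0_integralZr//; last first.
    by apply/measurable_EFinP; apply: measurableT_comp => //; apply: measurable_funB; exact: msh.
  rewrite ge0_integralZr//; last first.
    by apply/measurable_EFinP; apply: measurableT_comp => //; exact: msh.
  rewrite (sh (fun x => f x - g x))//; [|exact: measurable_funB|by move=> x; rewrite pf pg].
  by rewrite sh//; apply: leeD; exact: lee_wpmul2r.
rewrite ge0_integralD//; last 4 first.
- by move=> x _; rewrite mule_ge0// lee_fin.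
- by apply: measurable_funeM; exact: mT.
- by move=> x _; rewrite mule_ge0// lee_fin.
- by apply: measurable_funeM; exact: mD.
rewrite ge0_integralZl//; last exact: mT.
rewrite ge0_integralZl//; last exact: mD.
apply: (le_trans (leeD (lee_wpmul2l _ IH1) (lee_wpmul2l _ IH2))) => //.
rewrite -!EFinM -EFinD lee_fin exprS -natr1.
have : 1 * (A ^+ d * e) <= A * (A ^+ d * e) by rewrite ler_wpM2r// mulr_ge0// exprn_ge0.
lra.
Qed.

Lemma bm_tker_shift d (g : T -> R) (x : Rd R d) : bmfun g -> bmfun (fun y => tker g (subRd x y)).
Proof.
move=> bg.
have bt : bmfun (@tker d g) by apply: bm_prod => i _; exact: bm_tnth.
have mp : measurable_fun setT (fun y : Rd R d => (x, y)) by exact: measurable_fun_pair.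
exact: (bm_comp (measurableT_comp (@measurable_subRd d) mp) bt).
Qed.

Lemma convolution_dist (A e : R) (f g : T -> R) d (phi h G : Rd R d -> R) :
  1 <= A -> 0 <= e -> measurable_fun setT f -> bmfun g ->
  (forall x, f (x + 2 * pi) = f x) -> (forall x, g (x + 2 * pi) = g x) ->
  (\int[circ]_x `|f x|%:E <= A%:E)%E -> (\int[circ]_x `|g x|%:E <= A%:E)%E ->
  (\int[circ]_x `|f x - g x|%:E <= e%:E)%E ->
  (tor d).-integrable setT (EFin \o phi) ->
  measurable_fun setT h -> h = convolution phi (tker f) %[ae tor d] ->
  measurable_fun setT G -> (forall x, G x = convolution phi (tker g) x) ->
  (\int[tor d]_x `|h x - G x|%:E <= (d%:R * A ^+ d * e)%:E * \int[tor d]_y `|phi y|%:E)%E.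
Proof.
move=> A1 e0 mf bg pf pg fA gA fg iphi mh hconv mG GE.
have mg := bg.1.
have mphi : measurable_fun setT phi by apply/measurable_EFinP; exact: measurable_int iphi.
pose D (z : Rd R d * Rd R d) := phi z.2 * (tker f (subRd z.1 z.2) - tker g (subRd z.1 z.2)).
have mD : measurable_fun setT D.
  apply: measurable_funM; first exact: (measurableT_comp mphi measurable_snd).
  apply: measurable_funB.
    exact: (measurableT_comp (measurable_tker mf) (@measurable_subRd d)).
  exact: (measurableT_comp (measurable_tker mg) (@measurable_subRd d)).
have mDa : measurable_fun setT (fun z => `|D z|%:E).
  by apply/measurable_EFinP; exact: measurableT_comp.
have D0 z : (0 <= `|D z|%:E)%E by rewrite lee_fin.
pose u x := (\int[tor d]_y `|D (x, y)|%:E)%E.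
have mu : measurable_fun setT u by exact: (measurable_fun_fubini_tonelli_F _ mDa D0).
have u0 x : (0 <= u x)%E by exact: integral_ge0.
have hu : {ae tor d, forall x, setT x -> (`|h x - G x|%:E <= u x)%E}.
  case: hconv => N [mN N0 hN]; exists N; split => // x /= nle; apply: hN => /= hx.
  apply: nle => _; rewrite hx// GE.
  (* Where [u x] is finite, [phi] times the kernel [tker f] is integrable as the sum of two
     integrable functions, so that the convolution is a genuine integral there and may be
     subtracted. *)
  have [uoo|uoo] := eqVneq (u x) +oo%E; first by rewrite uoo leey.
  have mDx : measurable_fun setT (fun y => D (x, y)).
    have mp : measurable_fun setT (fun y : Rd R d => (x, y)) by exact: measurable_fun_pair.
    exact: (measurableT_comp mD mp).
  have iD : (tor d).-integrable setT (EFin \o (fun y => D (x, y))).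
    apply/integrableP; split; first exact/measurable_EFinP.
    by rewrite ltey.
  have ig : (tor d).-integrable setT (EFin \o (fun y => phi y * tker g (subRd x y))).
    by apply: integrable_mulbm => //; exact: bm_tker_shift.
  have if_ : (tor d).-integrable setT (EFin \o (fun y => phi y * tker f (subRd x y))).
    have := integrableD measurableT iD ig.
    apply: eq_integrable => // y _; rewrite /D/= -EFinD; congr EFin; ring.
  rewrite /convolution -RintegralB//.
  under eq_Rintegral do rewrite -mulrBr.
  rewrite -[leRHS]fineK ?ge0_fin_numE ?ltey// lee_fin.
  exact: (le_normr_Rintegral measurableT iD).
apply: (@le_trans _ _ (\int[tor d]_x u x)%E).
  apply: ae_ge0_le_integral => //.
  by apply/measurable_EFinP; apply: measurableT_comp => //; exact: measurable_funB.
rewrite /u (fubini_tonelli _ mDa D0).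
have mDy y : measurable_fun setT (fun x => `|tker f (subRd x y) - tker g (subRd x y)|%:E).
  have ms := measurable_subRdl y.
  apply/measurable_EFinP; apply: measurableT_comp => //; apply: measurable_funB.
    exact: (measurableT_comp (measurable_tker mf) ms).
  exact: (measurableT_comp (measurable_tker mg) ms).
under eq_integral => y _.
  under eq_integral do rewrite /D/= normrM EFinM.
  rewrite ge0_integralZl//; last exact: mDy.
  over.
rewrite /= -ge0_integralZl//; last 2 first.
- by apply/measurable_EFinP; exact: measurableT_comp.
- by rewrite lee_fin mulr_ge0// mulr_ge0// exprn_ge0// (le_trans ler01).
apply: ge0_le_integral => //.
- by move=> y _; apply: mule_ge0 => //; exact: integral_ge0.
- apply: emeasurable_funM; first by apply/measurable_EFinP; exact: measurableT_comp.
  have mE : measurable_fun setT (fun z : Rd R d * Rd R d =>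
      `|tker f (subRd z.1 z.2) - tker g (subRd z.1 z.2)|%:E).
    apply/measurable_EFinP; apply: measurableT_comp => //; apply: measurable_funB.
      exact: (measurableT_comp (measurable_tker mf) (@measurable_subRd d)).
    exact: (measurableT_comp (measurable_tker mg) (@measurable_subRd d)).
  by apply: (measurable_fun_fubini_tonelli_G _ mE) => z; rewrite lee_fin.
- apply: measurable_funeM; by apply/measurable_EFinP; exact: measurableT_comp.
move=> y _; rewrite muleC; apply: lee_wpmul2r => //.
exact: (tker_shift_bound y A1 e0 mf mg pf pg fA gA fg).2.
Qed.

Lemma bigA_distr_tuple d M (F : 'I_d -> 'I_M -> R) :
  \prod_i \sum_n F i n = \sum_(a : d.-tuple 'I_M) \prod_i F i (tnth a i).
Proof.
rewrite bigA_distr_bigA (reindex (fun a : d.-tuple 'I_M => [ffun i => tnth a i])).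
  by apply: eq_bigr => a _; apply: eq_bigr => i _; rewrite ffunE.
exists (fun f : {ffun 'I_d -> 'I_M} => [tuple f i | i < d]) => [a _|f _].
  by apply: eq_from_tnth => i; rewrite tnth_mktuple ffunE.
by apply/ffunP => i; rewrite ffunE tnth_mktuple.
Qed.

Lemma int_mul_sum d (T' : measurableType d) (P : probability T' R) (I : finType)
    (phi : T' -> R) (c : I -> R) (g : I -> T' -> R) :
  P.-integrable setT (EFin \o phi) -> (forall i, bmfun (g i)) ->
  \int[P]_y (phi y * \sum_i c i * g i y) = \sum_i c i * \int[P]_y (phi y * g i y).
Proof.
move=> iphi bg.
have iS (s : seq I) : P.-integrable setT (EFin \o (fun y => phi y * \sum_(i <- s) c i * g i y)).
  apply: integrable_mulbm => //.
  rewrite (_ : (fun x => _) = \sum_(i <- s) (fun y => c i * g i y))%R; last first.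
    by apply/funext => x; rewrite fct_sumE.
  by elim/big_ind: _ => [|f h|i _]; [exact: bm_cst|exact: bmD|exact: bmZ].
elim: (index_enum I) => [|i s IH].
  rewrite big_nil; under eq_Rintegral do rewrite big_nil mulr0.
  by rewrite prob_int_cst.
rewrite big_cons -IH; under eq_Rintegral do rewrite big_cons mulrDr.
have ii : P.-integrable setT (EFin \o (fun y => phi y * (c i * g i y))).
  by apply: integrable_mulbm => //; exact: bmZ.
rewrite RintegralD//; congr (_ + _).
under eq_Rintegral do rewrite mulrCA.
by rewrite RintegralZl//; exact: integrable_mulbm.
Qed.

(** The coefficient of [convolution phi (@Fd R d r)] in the unshifted system: [phi] is tested
    against the system shifted by [rho], as in [kernel_sumB]. *)
Definition coef d (phi : Rd R d -> R) (k : 'I_d -> nat) : R :=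
  (\prod_(i < d) mult r (k i)) * \int[tor d]_y (phi y * tens (trigs rho) k y).

Definition fpsum d (phi : Rd R d -> R) M (x : Rd R d) : R :=
  \sum_(a : d.-tuple 'I_M) coef phi (fun i => tnth a i) * tens (@trig R) (fun i => tnth a i) x.

Lemma bm_fpsum d (phi : Rd R d -> R) M : bmfun (fpsum phi M).
Proof.
apply: bm_sum => a _; apply: bmZ; apply: bm_tens => n.
by rewrite (_ : @trig R n = trigs 0 n); [exact: bm_trigs|apply/funext => x; exact: trigE].
Qed.

Lemma convolution_kernel_sum d N (phi : Rd R d -> R) x :
  (tor d).-integrable setT (EFin \o phi) ->
  fpsum phi N.*2.+1 x = convolution phi (tker (kernel_sum r N)) x.
Proof.
move=> iphi; rewrite /convolution.
have E y : tker (kernel_sum r N) (subRd x y) = \sum_(a : d.-tuple 'I_(N.*2.+1))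
    ((\prod_(i < d) mult r (tnth a i)) * tens (@trig R) (fun i => tnth a i) x) *
    tens (trigs rho) (fun i => tnth a i) y.
  rewrite /tker; under eq_bigr do rewrite tnth_mktuple kernel_sumB.
  by rewrite bigA_distr_tuple; apply: eq_bigr => a _; rewrite !big_split.
under [RHS]eq_Rintegral do rewrite E.
rewrite int_mul_sum//; last by move=> a; apply: bm_tens; exact: bm_trigs.
by apply: eq_bigr => a _; rewrite /coef mulrAC.
Qed.

Lemma fpsum_dist : exists2 C, 0 <= C &
  forall d N (phi f : Rd R d -> R), (0 < N)%N ->
  (tor d).-integrable setT (EFin \o phi) ->
  measurable_fun setT f -> f = convolution phi (@Fd R d r) %[ae tor d] ->
  (\int[tor d]_x `|f x - fpsum phi N.*2.+1 x|%:E <=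
   (d%:R * C ^+ d * (C * N%:R `^ (2^-1 - r)))%:E * \int[tor d]_y `|phi y|%:E)%E.
Proof.
have [C C0 HC] := F1_kernel_dist r_gt0 r_gt.
have Nle N : (0 < N)%N -> N%:R `^ (2^-1 - r) <= 1 :> R.
  move=> N0; have : N%:R `^ (2^-1 - r) <= 1%:R `^ (2^-1 - r) :> R.
    rewrite -opprB !powRN lef_pV2 ?posrE ?powR_gt0 ?ltr0n//.
    by rewrite ge0_ler_powR ?nnegrE ?ler_nat// subr_ge0 ltW.
  by rewrite powR1.
have dist0 (g : T -> R) : measurable_fun setT g -> measurable_fun setT (fun x => `|g x|%:E).
  by move=> mg; apply/measurable_EFinP; exact: measurableT_comp.
have mF := measurable_F1 r_gt0; have bK N := bm_kernel_sum r N.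
have tri (g h : T -> R) (a b : R) : measurable_fun setT g -> measurable_fun setT h ->
    (\int[circ]_x `|g x|%:E <= a%:E)%E -> (\int[circ]_x `|h x - g x|%:E <= b%:E)%E ->
    (\int[circ]_x `|h x|%:E <= (a + b)%:E)%E.
  move=> mg mh ga hb.
  apply: (@le_trans _ _ (\int[circ]_x (`|g x|%:E + `|h x - g x|%:E))%E).
    apply: ge0_le_integral => //; first exact: dist0.
      apply: emeasurable_funD; first exact: dist0.
      by apply: (dist0 (fun x => h x - g x)); exact: measurable_funB.
    by move=> x _; rewrite -EFinD lee_fin addrC -lerBlDr lerB_dist.
  rewrite ge0_integralD//; first by rewrite EFinD leeD.
    exact: dist0.
  by apply: (dist0 (fun x => h x - g x)); exact: measurable_funB.
have K1 : (\int[circ]_x `|kernel_sum r 1 x|%:E <= 3%:E)%E.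
  apply: (@le_trans _ _ (\int[circ]_x 3%:E)%E).
    apply: ge0_le_integral => //; first exact: (dist0 _ (bK 1%N).1).
    move=> x _; rewrite lee_fin /kernel_sum big_ord_recl big_ord0 addr0 powR1 mul1r.
    apply: (le_trans (ler_normD _ _)); rewrite normr1 normrM (ger0_norm (ler0n _ 2)).
    by have := wave_le1 1 (- (r * pi / 2)) x; lra.
  have := integral_cst circ measurableT 3%:E; rewrite /cst => ->.
  by rewrite [X in (_ * X)%E](_ : _ = 1%E) ?mule1//; exact: probability_setT.
have FA : (\int[circ]_x `|F1 r x|%:E <= (3 + C)%:E)%E.
  apply: (tri (kernel_sum r 1)) => //; first exact: (bK 1%N).1.
  by apply: (le_trans (HC 1%N isT)); rewrite lee_fin ler_piMr// Nle.
(* 3 bounds the norm of [kernel_sum r 1]; one [C] leads from there to [F1 r], the other on to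
   [kernel_sum r N]. *)
exists (3 + C + C) => [|d N phi f N0 iphi mf fconv]; first by rewrite !addr_ge0.
have mS : measurable_fun setT (fpsum phi N.*2.+1).
  by apply: bm_measurable; exact: bm_fpsum.
have KA : (\int[circ]_x `|kernel_sum r N x|%:E <= (3 + C + C)%:E)%E.
  apply: (tri (F1 r)) => //; first exact: (bK N).1.
  under eq_integral do rewrite distrC.
  by apply: (le_trans (HC N N0)); rewrite lee_fin ler_piMr// Nle.
have FA' : (\int[circ]_x `|F1 r x|%:E <= (3 + C + C)%:E)%E.
  by apply: (le_trans FA); rewrite lee_fin lerDl.
apply: (@convolution_dist (3 + C + C) _ (F1 r) (kernel_sum r N)) => //.
- by lra.
- by rewrite mulr_ge0 ?powR_ge0//; lra.
- by move=> x; exact: F1_periodic.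
- by move=> x; rewrite /kernel_sum; under eq_bigr do rewrite wave_periodic.
- by apply: (le_trans (HC N N0)); rewrite lee_fin ler_wpM2r ?powR_ge0//; lra.
- by move=> x; exact: convolution_kernel_sum.
Qed.
End convolution_L1.

(** * Uniform approximation by Fourier sums *)

Section fourier_sums.
Variable R : realType.
Local Notation tor := (torus R).

(** Cubes of different sizes have different index types; summands that depend on lists of numbers
    make them comparable. *)
Lemma big_tuple_widen d N M (G : seq nat -> R) : (N <= M)%N ->
  \sum_(a : d.-tuple 'I_N) G (map val a) =
  \sum_(a : d.-tuple 'I_M | all (fun n => (n < N)%N) (map val a)) G (map val a).
Proof.
move=> NM; elim: d G => [|d IH] G.
  rewrite (eq_bigr (fun=> G [::])); last by move=> a _; rewrite tuple0.
  rewrite [RHS](eq_big predT (fun=> G [::])); last 2 first.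
  - by move=> a; rewrite tuple0.
  - by move=> a _; rewrite tuple0.
  by rewrite !sumr_const !card_tuple !expn0.
rewrite [RHS]big_mkcond !big_tuple_cons/=.
under eq_bigr do rewrite (IH (fun s => G (_ :: s))).
rewrite (big_ord_widen _ (fun k => \sum_(a : d.-tuple 'I_M | all (fun n => (n < N)%N) (map val a)) G (k :: map val a)) NM).
rewrite [LHS]big_mkcond/=; apply: eq_bigr => k _.
case: ifP => kN; last by rewrite big1.
by rewrite big_mkcond.
Qed.

Lemma powRN_small (s e : R) N0 : 0 < s -> 0 < e ->
  exists2 N, (N0 <= N)%N & N.+1%:R `^ (- s) <= e.
Proof.
move=> s0 e0; pose M := Num.bound (e^-1 `^ s^-1).
exists (maxn N0 M); first exact: leq_maxl.
rewrite powRN invf_ple ?posrE ?powR_gt0//.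
have h : e^-1 `^ s^-1 <= (maxn N0 M).+1%:R.
  have e10 : 0 <= e^-1 `^ s^-1 by exact: powR_ge0.
  by rewrite (le_trans (ltW (archi_boundP e10)))// ler_nat ltnW// ltnS leq_maxr.
have := ge0_ler_powR (ltW s0) (powR_ge0 _ _) (ler0n _ _) h.
by rewrite -powRrM mulVf ?gt_eqF// powRr1// invr_ge0 ltW.
Qed.

Variable r : R.
Hypothesis r_gt : 2^-1 < r.

(* The partial sums are uniformly Cauchy since the coefficients are summable, and
   converge to [f] in L^1. *)
Lemma fpsum_uniform d (phi f : Rd R d -> R) (A e : R) :
  (tor d).-integrable setT (EFin \o phi) ->
  measurable_fun setT f -> f = convolution phi (@Fd R d r) %[ae tor d] ->
  (forall N, \sum_(a : d.-tuple 'I_N) `|coef r phi (fun i => tnth a i)| <= A) ->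
  0 < e ->
  exists N, {ae tor d, forall x, `|f x - fpsum r phi N x| <= e}.
Proof.
move=> iphi mf fconv HA e0.
pose g (s : seq nat) : R := `|coef r phi (fun i : 'I_d => nth 0%N s i)|.
have gE N (a : d.-tuple 'I_N) : g (map val a) = `|coef r phi (fun i => tnth a i)|.
  rewrite /g; congr (`|coef r phi _|); apply/funext => i.
  by rewrite (tnth_nth (tnth a i)) (nth_map (tnth a i)) ?size_tuple.
pose s N : R := \sum_(a : d.-tuple 'I_N) g (map val a).
have sA N : s N <= A by rewrite /s; under eq_bigr do rewrite gE.
have g0 t : 0 <= g t by exact: normr_ge0.
have s_mono : {homo s : n m / (n <= m)%N >-> n <= m}.
  move=> n m nm; rewrite /s (big_tuple_widen d g nm) [leLHS]big_mkcond.
  by apply: ler_sum => a _; case: ifP.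
have [N HN] : exists N, forall M, (N <= M)%N -> s M - s N <= e.
  have supS : has_sup (range s).
    by split; [exists (s 0%N), 0%N|exists A => _ [n _ <-]].
  (* The sums [s] increase and are bounded by [A], so some [s N] is within [e] of their supremum. *)
  have [_ [N _ <-] HN] := sup_adherent e0 supS.
  exists N => M NM.
  have : s M <= sup (range s) by apply: ub_le_sup; [case: supS|exists M].
  lra.
exists N.
have near_fp M x : (N <= M)%N -> `|fpsum r phi M x - fpsum r phi N x| <= e.
  move=> NM; apply: le_trans (HN M NM).
  pose h (t : seq nat) := coef r phi (fun i : 'I_d => nth 0%N t i) *
    tens (@trig R) (fun i : 'I_d => nth 0%N t i) x.
  have hE K : fpsum r phi K x = \sum_(a : d.-tuple 'I_K) h (map val a).
    apply: eq_bigr => a _; rewrite /h.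
    have -> : (fun i : 'I_d => nth 0%N (map val a) i) = (fun i => tnth a i : nat).
      apply/funext => i.
      by rewrite (tnth_nth (tnth a i)) (nth_map (tnth a i)) ?size_tuple.
    by [].
  rewrite !hE (big_tuple_widen d h NM) /s (big_tuple_widen d g NM).
  rewrite [X in `|X - _|](bigID (fun a : d.-tuple 'I_M => all (fun n => (n < N)%N) (map val a)))/=.
  rewrite [X in _ <= X - _](bigID (fun a : d.-tuple 'I_M => all (fun n => (n < N)%N) (map val a)))/=.
  rewrite addrAC subrr add0r [X in _ <= X]addrAC subrr add0r.
  apply: (le_trans (ler_norm_sum _ _ _)); apply: ler_sum => a _.
  rewrite /h /g normrM ler_piMr// le1_tens// => n y.
  by rewrite trigE trigs_le1.
(* By [near_fp] this excess is at most [|f - fpsum r phi M|] for all [M >= N]; the L^1 norm of the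
   latter tends to 0, so [v] vanishes almost everywhere. *)
pose v x : R := Num.max 0 (`|f x - fpsum r phi N x| - e).
have v0 x : 0 <= v x by rewrite le_max lexx.
have md K : measurable_fun setT (fun x => `|f x - fpsum r phi K x|).
  by apply: measurableT_comp => //; apply: measurable_funB => //; exact: (bm_fpsum r phi K).1.
have mv : measurable_fun setT v.
  by apply: measurable_maxr => //; apply: measurable_funB.
have [C C0 HC] := fpsum_dist r_gt.
have int_v0 : (\int[tor d]_x `|(v x)%:E| = 0)%E.
  apply/eqP; rewrite eq_le integral_ge0// andbT.
  apply/lee_addgt0Pr => del del0; rewrite add0e.
  pose K := d%:R * C ^+ d * C * \int[tor d]_y `|phi y|.
  have K0 : 0 <= K by rewrite mulr_ge0 ?mulr_ge0 ?exprn_ge0// bm_int_ge0.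
  have s0 : 0 < r - 2^-1 by rewrite subr_gt0.
  have d0 : 0 < del / (K + 1) by rewrite divr_gt0// ltr_wpDl.
  have [M' NM' HM'] := powRN_small N s0 d0.
  (* [fpsum_dist] covers only sums that contain the sine and the cosine of each frequency. *)
  pose M := (M'.+1).*2.+1.
  have NM : (N <= M)%N.
    by rewrite /M -addnn -addnS (leq_trans NM')// (leq_trans (leqnSn _))// leq_addr.
  apply: (@le_trans _ _ (\int[tor d]_x `|f x - fpsum r phi M x|%:E)%E).
    apply: ge0_le_integral => //.
    - by apply/measurable_EFinP; apply: measurableT_comp.
    - by apply/measurable_EFinP; exact: md.
    move=> x _; rewrite lee_fin ger0_norm// /v ge_max normr_ge0 /=.
    have := ler_distD (fpsum r phi M x) (f x) (fpsum r phi N x).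
    have := near_fp _ x NM; lra.
  apply: (le_trans (HC d M'.+1 phi f isT iphi mf fconv)).
  have iabs : (tor d).-integrable setT (EFin \o (fun x => `|phi x|)).
    exact: (integrable_norm iphi).
  have -> : (\int[tor d]_x `|phi x|%:E = (\int[tor d]_y `|phi y|)%:E)%E.
    by rewrite /Rintegral fineK// integrable_fin_num.
  rewrite -EFinM lee_fin.
  have -> : d%:R * C ^+ d * (C * M'.+1%:R `^ (2^-1 - r)) * (\int[tor d]_y `|phi y|)
    = K * M'.+1%:R `^ (- (r - 2^-1)).
    by rewrite opprB /K; ring.
  apply: (le_trans (ler_wpM2l K0 HM')).
  rewrite mulrCA ler_piMr ?(ltW del0)// ler_pdivrMr ?ltr_wpDl//.
  by rewrite mul1r lerDl.
have := (ae_eq_integral_abs (tor d) measurableT (proj2 (measurable_EFinP _ _) mv)).1 int_v0.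
apply: filterS => x /= /(_ I) [] vx.
by rewrite -subr_le0 -vx le_max lexx orbT.
Qed.
End fourier_sums.

(** * Sums and tails of the coefficients *)

Section coefficient_sums.
Variable R : realType.
Local Notation tor := (torus R).

Lemma Lfun_powR_int_le1 d (T : measurableType d) (mu : {measure set T -> \bar R}) (q : R)
    (phi : T -> R) : 1 <= q -> phi \in Lfun mu q%:E ->
  ('N[mu]_(q%:E)[EFin \o phi] <= 1)%E -> \int[mu]_x (`|phi x| `^ q) <= 1.
Proof.
move=> q1 Lphi N1; have q0 : 0 < q by lra.
have iphiq := Lfun_integrable q1 Lphi.
rewrite -lee_fin /Rintegral fineK; last exact: integrable_fin_num.
have -> : (\int[mu]_x ((`|phi x| `^ q)%:E) = 'N[mu]_(q%:E)[EFin \o phi] `^ q)%E.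
  by rewrite powR_Lnorm ?gt_eqF.
have /= := gt0_ler_poweR (ltW q0) _ _ N1.
rewrite powR1; apply; rewrite in_itv/= ?leey ?andbT//; exact: Lnorm_ge0.
Qed.

Lemma powR_prod (I : finType) (x : I -> R) (s : R) : (forall i, 0 <= x i) ->
  (\prod_i x i) `^ s = \prod_i x i `^ s.
Proof.
move=> x0; suff [] : 0 <= \prod_i x i /\ (\prod_i x i) `^ s = \prod_i x i `^ s by [].
elim/big_ind2 : _ => [|y1 z1 y2 z2 [y0 <-] [z0 <-]|//]; first by rewrite powR1.
by rewrite powRM ?mulr_ge0.
Qed.

Variables (r q : R).
Hypothesis q_gt1 : 1 < q.
Hypothesis q_le2 : q <= 2.
Hypothesis r_gt : q^-1 < r.

Lemma smoothness_gt_half : 2^-1 < r.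
Proof.
by apply: le_lt_trans r_gt; rewrite lef_pV2 ?posrE// (lt_trans ltr01).
Qed.
Let r_half := smoothness_gt_half.

Lemma coef_le d N (phi : Rd R d -> R) (a : d.-tuple 'I_N) :
  `|coef r phi (fun i => tnth a i)| <= (2 * 4 `^ r) ^+ d *
    (tweight R a `^ (- r) *
     `|\int[tor d]_y (phi y * tens (trigs (r * pi / 2)) (fun i => tnth a i) y)|).
Proof.
rewrite /coef normrM mulrA ler_wpM2r// ger0_norm; last by rewrite prodr_ge0// => i _; exact: mult_ge0.
rewrite /tweight powR_prod// -{6}(card_ord d) -prodr_const -big_split/=.
rewrite [leRHS](eq_bigl predT)//; apply: ler_prod => i _; rewrite mult_ge0/=.
by apply: mult_le => //; apply: lt_trans r_half; rewrite invr_gt0.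
Qed.

(** Exponents for Hoelder's inequality. A term [W ^ (- r) * c] is split into [c * W ^ s], whose q-th
    power is the Hardy-Littlewood term [W ^ (q - 2) * c ^ q], and [W ^ (- (r + s))], whose q'-th
    power is [W ^ (- beta)]. The condition [beta > 1] amounts to [r > 1/q]. *)
Let q' := (1 - q^-1)^-1.
Let s : R := 1 - 2 / q.
Let beta := (r + s) * q'.

Let q0 : 0 < q. Proof. exact: lt_trans q_gt1. Qed.

Let iq1 : 0 < 1 - q^-1. Proof. by rewrite subr_gt0 invf_lt1. Qed.

Let beta_gt1 : 1 < beta.
Proof.
rewrite /beta /q' -ltr_pdivrMr ?invr_gt0// mul1r invrK /s.
move: r_gt; rewrite mulrDl mul1r; lra.
Qed.

Lemma coef_powR_sum d : exists2 X, 0 <= X & forall (phi : Rd R d -> R),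
  phi \in Lfun (tor d) q%:E -> ('N[tor d]_(q%:E)[EFin \o phi] <= 1)%E ->
  forall N (P : pred (d.-tuple 'I_N)) Y, 0 < Y ->
    \sum_(a | P a) tweight R a `^ (- beta) <= Y ->
    \sum_(a | P a) `|coef r phi (fun i => tnth a i)| <= X * Y `^ (1 - q^-1).
Proof.
pose u := @trigs R (r * pi / 2).
have bu n : bmfun (u n) by exact: bm_trigs.
have u1 n x : `|u n x| <= 1 by exact: trigs_le1.
have [C /ltW C0 HL] := hardy_littlewood1 bu u1
  (bessel_inequality bu (trigs_orth _) (trigs_sqr_le _)) q_gt1 q_le2.
pose X := 2 `^ q * C ^+ d.
have X0 : 0 <= X by rewrite /X; apply: mulr_ge0; [exact: powR_ge0|exact: exprn_ge0].
exists ((2 * 4 `^ r) ^+ d * (X + 1)).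
  by apply: mulr_ge0; [rewrite exprn_ge0// mulr_ge0// powR_ge0|exact: addr_ge0].
move=> phi Lphi N1 N P Y Y0 HY.
pose c (a : d.-tuple 'I_N) :=
  `|\int[tor d]_y (phi y * tens u (fun i => tnth a i) y)|.
pose x (a : d.-tuple 'I_N) := c a * tweight R a `^ s.
pose y (a : d.-tuple 'I_N) := tweight R a `^ (- (r + s)).
have W0 (a : d.-tuple 'I_N) := tweight_gt0 R a.
have xy a : tweight R a `^ (- r) * c a = x a * y a.
  rewrite /x /y -mulrA mulrC -powRD ?(gt_eqF (W0 a)) ?implybT//.
  by congr (_ * _ `^ _); ring.
have HX : \sum_(a | P a) x a `^ q <= X.
  have -> : \sum_(a | P a) x a `^ q = \sum_(a | P a) tweight R a `^ (q - 2) * c a `^ q.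
    apply: eq_bigr => a _; rewrite powRM ?powR_ge0 ?normr_ge0// mulrC -powRrM.
    by congr (_ `^ _ * _); rewrite /s; field; rewrite gt_eqF.
  apply: (@le_trans _ _ (\sum_a tweight R a `^ (q - 2) * c a `^ q)).
    rewrite [leLHS]big_mkcond; apply: ler_sum => a _; case: ifP => // _.
    by apply: mulr_ge0; exact: powR_ge0.
  apply: (le_trans (hardy_littlewood_Lq q_gt1 C0 bu u1 HL N Lphi)).
  rewrite /X mulrA ler_piMr// Lfun_powR_int_le1//; exact: ltW.
have HY' : \sum_(a | P a) y a `^ q' <= Y.
  apply: le_trans HY; rewrite le_eqVlt; apply/orP; left; apply/eqP.
  by apply: eq_bigr => a _; rewrite /y -powRrM mulNr.
have cj : q^-1 + q'^-1 = 1 by rewrite invrK; lra.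
have q'0 : 0 < q' by rewrite invr_gt0.
have := @sum_hoelder R _ P x y q q' X Y q0 q'0 cj Y0 _ _ HX HY'.
rewrite invrK => h.
apply: (@le_trans _ _ ((2 * 4 `^ r) ^+ d * \sum_(a | P a) x a * y a)).
  rewrite mulr_sumr; apply: ler_sum => a _; rewrite -xy; exact: coef_le.
rewrite -mulrA ler_wpM2l ?exprn_ge0 ?mulr_ge0 ?powR_ge0//.
apply: h => a; last exact: powR_ge0.
by apply: mulr_ge0; [exact: normr_ge0|exact: powR_ge0].
Qed.

Lemma coef_sum_le d : exists2 A, 0 <= A & forall (phi : Rd R d -> R),
  phi \in Lfun (tor d) q%:E -> ('N[tor d]_(q%:E)[EFin \o phi] <= 1)%E ->
  forall N, \sum_(a : d.-tuple 'I_N) `|coef r phi (fun i => tnth a i)| <= A.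
Proof.
have [X X0 HX] := coef_powR_sum d.
have [Z Z0 HZ] := tweight_sum_le beta_gt1.
exists (X * (Z ^+ d + 1) `^ (1 - q^-1)); first by rewrite mulr_ge0 ?powR_ge0.
move=> phi Lphi N1 N; apply: HX => //; first by rewrite ltr_wpDl ?exprn_ge0.
by rewrite (le_trans (HZ d N))// lerDl.
Qed.

Lemma coef_tail_le d : exists2 A, 0 < A & forall (phi : Rd R d.+1 -> R),
  phi \in Lfun (tor d.+1) q%:E -> ('N[tor d.+1]_(q%:E)[EFin \o phi] <= 1)%E ->
  forall N L, 1 <= L ->
    \sum_(a : d.+1.-tuple 'I_N | L < tweight R a) `|coef r phi (fun i => tnth a i)| <=
    A * (L `^ (q^-1 - r) * (1 + ln L) `^ (d%:R * (1 - q^-1))).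
Proof.
have [X X0 HX] := coef_powR_sum d.+1.
have [C C0 HC] := hyperbolic_tail d beta_gt1.
exists (X * C `^ (1 - q^-1) + 1); first by rewrite ltr_wpDl ?mulr_ge0 ?powR_ge0.
move=> phi Lphi N1 N L L1.
have L0 : 0 < L by lra.
have lL : 0 < 1 + ln L by rewrite ltr_wpDr// ln_ge0.
apply: (le_trans (HX phi Lphi N1 N _ _ _ (HC N L L1))).
  by rewrite !mulr_gt0 ?powR_gt0 ?exprn_gt0.
rewrite !powRM ?powR_ge0 ?mulr_ge0 ?exprn_ge0 ?(ltW lL) ?powR_ge0 ?(ltW C0)//.
rewrite -powR_mulrn ?(ltW lL)// -!powRrM.
(* Since [beta * (1 - 1/q) = r + s], the exponent is [1 - 1/q - r - (1 - 2/q)]. *)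
have -> : (1 - beta) * (1 - q^-1) = q^-1 - r.
  rewrite mulrBl mul1r /beta /q' -mulrA mulVf ?gt_eqF// /s; ring.
rewrite [leLHS]mulrA; apply: ler_wpM2r; last by rewrite lerDl.
by apply: mulr_ge0; exact: powR_ge0.
Qed.
End coefficient_sums.

(** * L_p norms on a probability space *)

Section Lp_probability.
Context (R : realType) d (T : measurableType d) (P : probability T R).
Variables (p : R) (p1 : (1 <= p%:E)%E).
Hypothesis p2 : 2 <= p.
Let nm (f : LfunType P p1) : R := fine ('N[P]_(p%:E)[EFin \o f])%E.

Let p0 : 0 < p. Proof. exact: lt_le_trans p2. Qed.

Lemma Lp_integrable_sqr (h : LfunType P p1) :
  P.-integrable setT (EFin \o (fun x => h x ^+ 2)).
Proof.
apply: Lfun2_integrable_sqr; apply: (Lfun_subset (q := p%:E)) (LfunP h) => //.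
- by rewrite lee_fin ler1n.
- exact: fin_num_measure.
Qed.

Lemma Lp_integrable (h : LfunType P p1) : P.-integrable setT (EFin \o h).
Proof.
apply/Lfun1_integrable; apply: (Lfun_subset (q := p%:E)) (LfunP h) => //.
exact: fin_num_measure.
Qed.

(** The tangent inequality for the power [p / 2], applied pointwise to [(|h x| / A) ^ 2] and
    integrated. It requires [p / 2 > 1], hence the separate case [p = 2]. *)
Lemma sqr_int_le (h : LfunType P p1) A : 0 < A -> nm h <= A ->
  \int[P]_x (h x ^+ 2) <= A ^+ 2.
Proof.
move=> A0 hA.
have ih := Lp_integrable_sqr h.
have ihp : P.-integrable setT (EFin \o (fun x => `|h x| `^ p)).
  by apply: Lfun_integrable; [rewrite -lee_fin|exact: LfunP].
pose s := 2 / p; have s0 : 0 < s by rewrite divr_gt0.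
have s1 : s <= 1 by rewrite ler_pdivrMr// mul1r.
have pt x : h x ^+ 2 <= A ^+ 2 * (s * A `^ (- p)) * `|h x| `^ p + A ^+ 2 * (1 - s).
  have y0 : 0 <= (`|h x| / A) ^+ 2 by exact: sqr_ge0.
  have yE : ((`|h x| / A) ^+ 2) `^ (p / 2) = A `^ (- p) * `|h x| `^ p.
    rewrite -powR_mulrn ?divr_ge0 ?(ltW A0)// -powRrM.
    rewrite [X in _ `^ X](_ : _ = p); last by field.
    by rewrite powRM ?invr_ge0 ?(ltW A0)// -powR_inv1 ?(ltW A0)// -powRrM mulN1r mulrC.
  have : (`|h x| / A) ^+ 2 <= s * (A `^ (- p) * `|h x| `^ p) + (1 - s).
    have [p2e|pN2] := eqVneq p 2.
      have e1 : p / 2 = 1 by rewrite p2e divff.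
      have e2 : s = 1 by rewrite /s -invf_div e1 invr1.
      by rewrite -yE e1 e2 powRr1// mul1r subrr addr0.
    have p21 : 1 < p / 2 by rewrite ltr_pdivlMr// mul1r lt_def pN2.
    have := le_powR_conjugate p21 y0; rewrite yE.
    by rewrite invf_div -/s [X in _ <= X + _]mulrC.
  move/(ler_wpM2l (sqr_ge0 A)); rewrite exprMn exprVn mulrCA divff ?expf_neq0 ?gt_eqF// mulr1.
  rewrite real_normK ?num_real// => /le_trans; apply.
  by rewrite mulrDr !mulrA.
have i2 := integrableD measurableT
  (integrableZl measurableT (A ^+ 2 * (s * A `^ (- p))) ihp)
  (bm_integrable P (bm_cst T (A ^+ 2 * (1 - s)))).
apply: (@le_trans _ _ (\int[P]_x (A ^+ 2 * (s * A `^ (- p)) * `|h x| `^ p + A ^+ 2 * (1 - s)))).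
  by apply: le_Rintegral => // x _; exact: pt.
rewrite RintegralD//; last 2 first.
- exact: (integrableZl measurableT _ ihp).
- exact: (bm_integrable P (bm_cst T _)).
rewrite prob_int_cst RintegralZl// -(Lnorm_powR p2) -/(nm h).
have le1 : A `^ (- p) * nm h `^ p <= 1.
  rewrite powRN mulrC ler_pdivrMr ?powR_gt0// mul1r ge0_ler_powR ?nnegrE ?(ltW p0) ?(ltW A0)//.
  by rewrite fine_ge0// Lnorm_ge0.
rewrite [leLHS](_ : _ = A ^+ 2 * (s * (A `^ (- p) * nm h `^ p) + (1 - s))); last by ring.
apply: ler_piMr; first exact: sqr_ge0.
by move/(ler_wpM2l (ltW s0)): le1; lra.
Qed.

Lemma Lp_norm_le_ae (h : LfunType P p1) B : 0 <= B ->
  {ae P, forall x, `|h x| <= B} -> nm h <= B.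
Proof.
move=> B0 hB; rewrite leNgt; apply/negP => Bh.
have := gt0_ltr_powR p0 _ _ Bh; rewrite !nnegrE B0 => /(_ isT).
have nm0 : 0 <= nm h by rewrite fine_ge0// Lnorm_ge0.
move=> /(_ nm0); apply/negP; rewrite -leNgt (Lnorm_powR p2) -lee_fin.
rewrite /Rintegral fineK; last first.
  by apply: integrable_fin_num => //; apply: Lfun_integrable; [rewrite -lee_fin|exact: LfunP].
have -> : ((B `^ p)%:E = \int[P]_x (B `^ p)%:E)%E.
  by rewrite integral_cst//= [X in (_ * X)%E](_ : _ = 1%E) ?mule1//; exact: probability_setT.
apply: ae_ge0_le_integral => //.
- apply/measurable_EFinP; apply: (measurableT_comp (measurable_powR _)) => //.
  exact: measurableT_comp.
- by move=> x _; rewrite lee_fin powR_ge0.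
- by apply: filterS hB => x hx _; rewrite lee_fin ge0_ler_powR ?nnegrE ?(ltW p0).
Qed.

Lemma bm_Lfun (h : T -> R) : bmfun h -> h \in Lfun P p%:E.
Proof.
move=> bh; rewrite inE; apply/andP; split; rewrite inE/=; first exact: bh.1.
rewrite /finite_norm unlock poweR_lty//.
exact: (integrable_lty measurableT (bm_integrable P (bm_powR (ltW p0) bh))).
Qed.

Lemma bm_Lfun_exists (h : T -> R) : bmfun h -> exists g : LfunType P p1, g = h :> (T -> R).
Proof. by move=> bh; exists (Lfun_Sub p1 (bm_Lfun bh)). Qed.
End Lp_probability.

(** * The normalized dictionary *)

Section normalized_trigonometric_system.
Variable R : realType.
Variable p : R.
Hypothesis p2 : 2 <= p.
Let p1 := ge2_ge1 p2.

Definition trig_norm n : R := fine ('N[circle R]_(p%:E)[EFin \o @trig R n])%E.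

Lemma trig_trigs n : @trig R n = trigs 0 n.
Proof. by apply/funext => x; rewrite trigE. Qed.

(** A smaller norm would make the integral of the square at most 1/4, whereas it is at least 1/2. *)
Lemma trig_norm_ge n : 2^-1 <= trig_norm n.
Proof.
have [g gE] := bm_Lfun_exists (circle R) p1 p2 (bm_trigs 0 n).
rewrite leNgt; apply/negP => h.
have := @sqr_int_le R _ _ (circle R) p p1 p2 g 2^-1.
rewrite gE -trig_trigs invr_gt0 ltr0n => /(_ isT (ltW h)).
have := trigs_sqr_ge (0 : R) n; rewrite -trig_trigs; lra.
Qed.

Lemma trig_norm_le n : trig_norm n <= 1.
Proof.
have [g gE] := bm_Lfun_exists (circle R) p1 p2 (bm_trigs 0 n).
have := @Lp_norm_le_ae R _ _ (circle R) p p1 p2 g 1 ler01.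
rewrite gE -trig_trigs; apply; apply: nearW => x; rewrite trigE; exact: trigs_le1.
Qed.

Variable d : nat.
Local Notation Lp := (Lp d p1).
Local Notation nm := (@Lp_norm R d p p1).
Local Notation D := (@RT R d p p1).

Lemma trigLp_exists (k : 'I_d -> nat) :
  exists g : Lp, g = tens (@trig R) k :> (Rd R d -> R).
Proof.
apply: bm_Lfun_exists => //; apply: bm_tens => n; rewrite trig_trigs; exact: bm_trigs.
Qed.

Definition trigLp k : Lp := sval (cid (trigLp_exists k)).

Lemma trigLpE k x : trigLp k x = tens (@trig R) k x.
Proof. by rewrite /trigLp; case: cid => g /= ->. Qed.

Definition tens_norm (k : 'I_d -> nat) := \prod_(i < d) trig_norm (k i).

Lemma tens_norm_gt0 k : 0 < tens_norm k.
Proof.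
by rewrite /tens_norm prodr_gt0// => i _; apply: lt_le_trans (trig_norm_ge _); rewrite invr_gt0.
Qed.

Lemma tens_norm_le1 k : tens_norm k <= 1.
Proof.
rewrite /tens_norm; apply: prodr_ile1 => i _.
by rewrite trig_norm_le (le_trans _ (trig_norm_ge _))// invr_ge0.
Qed.

Lemma tens_ntrig k x : tens (ntrig p) k x = (tens_norm k)^-1 * tens (@trig R) k x.
Proof. by rewrite /tens /ntrig big_split/= prodfV mulrC. Qed.

Lemma RT_trigLp k : D ((tens_norm k)^-1 *: trigLp k).
Proof.
by exists k => x; rewrite -[RHS]/(tens (ntrig p) k x) tens_ntrig -trigLpE.
Qed.

Lemma RT_exists g : D g -> exists k, g = (tens_norm k)^-1 *: trigLp k.
Proof.
move=> [k gE]; exists k; apply/LfuneqP => x.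
by rewrite gE -[LHS]/(tens (ntrig p) k x) tens_ntrig -trigLpE.
Qed.

(** A pointwise bound: each normalizing factor is at most 2 and each trigonometric factor at most 1.
    The size of this constant affects only the constant of the rate. *)
Lemma RT_norm_le g : D g -> nm g <= 2 ^+ d.
Proof.
move=> /RT_exists[k ->]; apply: Lp_norm_le_ae => //.
apply: nearW => x.
have -> : ((tens_norm k)^-1 *: trigLp k) x = (tens_norm k)^-1 * trigLp k x by [].
rewrite trigLpE normrM normfV (gtr0_norm (tens_norm_gt0 _)).
apply: (@le_trans _ _ (tens_norm k)^-1).
  rewrite ler_piMr ?invr_ge0 ?(ltW (tens_norm_gt0 _))// le1_tens// => n y.
  by rewrite trigE trigs_le1.
rewrite -[leRHS]invrK lef_pV2 ?posrE ?tens_norm_gt0 ?invr_gt0 ?exprn_gt0//.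
rewrite -exprVn -[X in _ ^+ X](card_ord d) -prodr_const /tens_norm.
rewrite [leLHS](eq_bigl predT)//; apply: ler_prod => i _.
by rewrite invr_ge0 ler0n trig_norm_ge.
Qed.

Lemma trigLp_orth (k l : 'I_d -> nat) : k <> l ->
  \int[torus R d]_x (tens (@trig R) k x * tens (@trig R) l x) = 0.
Proof.
move=> kl; have [i ki] : exists i, k i != l i.
  apply: contrapT => /forallNP H; apply: kl; apply/funext => i.
  by apply/eqP; rewrite -[_ == _]negbK; apply/negP/H.
rewrite /tens; under eq_Rintegral do rewrite -big_split/=.
rewrite (@torus_int_prod R d (fun i x => trig (k i) x * trig (l i) x)).
  rewrite (bigD1 i)//= !trig_trigs trigs_orth ?mul0r//.
by move=> j; rewrite !trig_trigs; apply: bmM; exact: bm_trigs.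
Qed.

Lemma trigLp_sqr_ge (k : 'I_d -> nat) :
  (2^-1) ^+ d <= \int[torus R d]_x (tens (@trig R) k x * tens (@trig R) k x).
Proof.
rewrite /tens; under eq_Rintegral do rewrite -big_split/=.
rewrite (@torus_int_prod R d (fun i x => trig (k i) x * trig (k i) x)); last first.
  by move=> j; rewrite !trig_trigs; apply: bmM; exact: bm_trigs.
rewrite -[X in _ ^+ X](card_ord d) -prodr_const.
rewrite [leLHS](eq_bigl predT)//; apply: ler_prod => i _.
rewrite invr_ge0 ler0n !trig_trigs; under eq_Rintegral do rewrite -expr2.
exact: trigs_sqr_ge.
Qed.
End normalized_trigonometric_system.

(** * Concentration of the residual on a hyperbolic cross *)

Section residual_concentration.
Variables (R : realType) (d' : nat) (p : R).
Hypothesis p2 : 2 <= p.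
Let d := d'.+1.
Let p1 := ge2_ge1 p2.
Local Notation Lp := (Lp d p1).
Local Notation nm := (@Lp_norm R d p p1).
Local Notation D := (@RT R d p p1).
Local Notation tor := (torus R d).
Local Notation E := (tens (@trig R)).

Lemma int_abs_le_ae (v : Rd R d -> R) (e : R) : tor.-integrable setT (EFin \o v) ->
  {ae tor, forall x, `|v x| <= e} -> \int[tor]_x `|v x| <= e.
Proof.
move=> iv ve; have iv' := integrable_norm iv.
rewrite -lee_fin /Rintegral fineK ?integrable_fin_num//.
have e0 : 0 <= e.
  apply/negPn/negP; rewrite -ltNge => e0.
  suff : tor setT = 0%E by rewrite probability_setT => /eqP; rewrite onee_eq0.
  apply/negligibleP => //; apply: negligibleS ve => x _ /=.
  by apply/negP; rewrite -ltNge (lt_le_trans e0).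
have -> : (e%:E = \int[tor]_x e%:E)%E.
  by rewrite integral_cst//= [X in (_ * X)%E](_ : _ = 1%E) ?mule1//; exact: probability_setT.
apply: ae_ge0_le_integral => //.
- by case/integrableP: iv'.
- by apply: filterS ve.
Qed.

Lemma Lp_sumE (I : Type) (s : seq I) (Q : pred I) (G : I -> Lp) x :
  (\sum_(i <- s | Q i) G i) x = \sum_(i <- s | Q i) G i x.
Proof. by elim/big_rec2 : _ => // i y1 y2 _ <-. Qed.

Lemma bm_tens_trig k : bmfun (E k : Rd R d -> R).
Proof. apply: bm_tens => n; rewrite trig_trigs; exact: bm_trigs. Qed.

Lemma tens_trig_le1 k (x : Rd R d) : `|E k x| <= 1.
Proof. by apply: le1_tens => n y; rewrite trigE trigs_le1. Qed.

Lemma Lp_int_mul (h : Lp) k : tor.-integrable setT (EFin \o (fun x => h x * E k x)).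
Proof. apply: integrable_mulbm (bm_tens_trig k); exact: Lp_integrable. Qed.

(** The case [q = 2] and [C = 1] of [hardy_littlewood_Lq]; the factor 4 is its [2 ^ q]. *)
Lemma bessel_Lp (h : Lp) N :
  \sum_(a : d.-tuple 'I_N) (\int[tor]_x (h x * E (fun i => tnth a i) x)) ^+ 2 <=
  4 * \int[tor]_x (h x ^+ 2).
Proof.
have sqrE (x : R) : `|x| `^ 2 = x ^+ 2.
  by rewrite powR_mulrn// real_normK// num_real.
have bt n : bmfun (@trig R n) by rewrite trig_trigs; exact: bm_trigs.
have L2 : (h : Rd R d -> R) \in Lfun tor 2%:E.
  apply: (Lfun_subset (q := p%:E)) (LfunP h) => //; last exact: fin_num_measure.
  by rewrite lee_fin ler1n.
have := @hardy_littlewood_Lq R (@trig R) 2 1 _ ler01 bt _ _ d N h L2.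
rewrite ltr1n expr1n mul1r => /(_ isT).
have t1 (n : nat) y : `|@trig R n y| <= 1 by rewrite trigE trigs_le1.
move=> /(_ t1).
have -> : 2 `^ 2 = 4 :> R by rewrite powR_mulrn//; ring.
have -> : \int[tor]_x (`|h x| `^ 2) = \int[tor]_x (h x ^+ 2).
  by under eq_Rintegral do rewrite sqrE.
move=> H; apply: le_trans (H _).
  by apply: ler_sum => a _; rewrite subrr powRr0 mul1r sqrE.
move=> M f bf; rewrite mul1r.
under eq_Rintegral do rewrite sqrE.
under eq_bigr do rewrite subrr powRr0 mul1r sqrE.
have := @bessel_inequality _ _ _ (circle R) (trigs 0) (bm_trigs 0) (@trigs_orth R 0) (@trigs_sqr_le R 0) M f bf.
by apply: le_trans; apply: ler_sum => n _; rewrite trig_trigs.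
Qed.

(** By orthogonality an approximant has no component along a frequency not yet chosen, so [f] and
    the residual have the same inner product with it. *)
Lemma span_orth (psi : nat -> Lp) n (g : Lp) k :
  (forall j, (1 <= j <= n)%N -> D (psi j)) ->
  (forall j, (1 <= j <= n)%N -> psi j <> (tens_norm p k)^-1 *: trigLp p2 k) ->
  span_upto psi n g -> \int[tor]_x (g x * E k x) = 0.
Proof.
move=> Dpsi kpsi [c ->]; rewrite big_nat_cond.
elim/big_ind : _ => [|u v u0 v0|j /andP[jn _]].
- rewrite [X in Rintegral _ _ X](_ : _ = cst 0) ?Rintegral_cst//= ?mul0r//.
  by apply/funext => x /=; rewrite mul0r.
- under eq_Rintegral do rewrite [(u + v) _]/(u _ + v _) mulrDl.
  by rewrite RintegralD//; [rewrite u0 v0 addr0|exact: Lp_int_mul|exact: Lp_int_mul].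
have [l lE] := RT_exists (Dpsi j jn).
have -> : (fun x => (c j *: psi j) x * E k x) = (fun x => c j * (tens_norm p l)^-1 * (E l x * E k x)).
  apply/funext => x; rewrite lE.
  have -> : (c j *: ((tens_norm p l)^-1 *: trigLp p2 l)) x = c j * ((tens_norm p l)^-1 * trigLp p2 l x) by [].
  by rewrite trigLpE !mulrA.
rewrite bm_intZ; last by apply: bmM; exact: bm_tens_trig.
rewrite trigLp_orth ?mulr0// => lk.
by apply: (kpsi j jn); rewrite lE lk.
Qed.

Variables (r : R) (f : Lp) (phi : Rd R d -> R) (A L tau : R).
Hypothesis r_gt : 2^-1 < r.
Hypothesis iphi : tor.-integrable setT (EFin \o phi).
Hypothesis fconv : (f : Rd R d -> R) = convolution phi (@Fd R d r) %[ae tor].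
Hypothesis coefA : forall N,
  \sum_(a : d.-tuple 'I_N) `|coef r phi (fun i => tnth a i)| <= A.
Hypothesis L1 : 1 <= L.
Hypothesis coef_tail : forall N,
  \sum_(a : d.-tuple 'I_N | L < tweight R a) `|coef r phi (fun i => tnth a i)| <= tau.

(** The inner product of the partial sum with its a-th function is the coefficient times the
    integral of the squared function, which is at least [2 ^ (- d)]; replacing the partial sum by
    [f] costs [e]. *)
Lemma coef_residual_le N e (h : Lp) (a : d.-tuple 'I_N) :
  {ae tor, forall x, `|f x - fpsum r phi N x| <= e} ->
  \int[tor]_x (f x * E (fun i => tnth a i) x) = \int[tor]_x (h x * E (fun i => tnth a i) x) ->
  `|coef r phi (fun i => tnth a i)| <=
    2 ^+ d * (`|\int[tor]_x (h x * E (fun i => tnth a i) x)| + e).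
Proof.
move=> fe <-; set k := fun i => _; set b := coef r phi _.
have fpE : \int[tor]_x (fpsum r phi N x * E k x) = b * \int[tor]_x (E k x * E k x).
  rewrite /fpsum; under eq_Rintegral do rewrite mulr_suml.
  rewrite bm_int_sum; last first.
    by move=> c _; apply: bmM; [apply: bmZ|]; exact: bm_tens_trig.
  rewrite (bigD1 a)//= big1 ?addr0.
    under eq_Rintegral do rewrite -mulrA.
    by rewrite bm_intZ//; apply: bmM; exact: bm_tens_trig.
  move=> c ca; under eq_Rintegral do rewrite -mulrA.
  rewrite bm_intZ; last by apply: bmM; exact: bm_tens_trig.
  rewrite trigLp_orth ?mulr0// => ck.
  move/eqP: ca; apply; apply: eq_from_tnth => i; apply/val_inj.
  exact: (congr1 (fun u => u i) ck).
have ib := bm_integrable tor (bm_fpsum r phi N).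
have iff := Lp_integrable f.
have dist := dist_int_mul iff ib (bm_tens_trig k) (tens_trig_le1 k).
have le_e := int_abs_le_ae (integrableB measurableT iff ib) fe.
have {le_e}dist := le_trans dist le_e; rewrite fpE in dist.
have sq := trigLp_sqr_ge R k.
set s := \int[tor]_x (E k x * E k x) in sq dist.
have d0 : 0 < (2^-1 : R) ^+ d by rewrite exprn_gt0// invr_gt0.
have s0 : 0 < s by apply: lt_le_trans sq.
rewrite -ler_pdivrMl ?exprn_gt0// -exprVn.
apply: (@le_trans _ _ (s * `|b|)); first by rewrite ler_wpM2r.
rewrite -{1}(gtr0_norm s0) -normrM mulrC.
have := ler_distD (\int[tor]_x (f x * E k x)) (b * s) 0; rewrite !subr0 distrC; lra.
Qed.

Lemma residual_concentrated (F : {scalar Lp}) (psi : nat -> Lp) n (g : Lp) (M : R) :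
  (forall x, `|F x| <= nm x) ->
  (forall j, (1 <= j <= n)%N -> D (psi j) /\ F (psi j) = 0) ->
  span_upto psi n g -> (forall h, D h -> `|F h| <= M) ->
  F (f - g) <= M * (5 * 2 ^+ d * (L * (1 + ln L) ^+ d') `^ 2^-1 * nm (f - g) + tau).
Proof.
move=> F1 psi0 spg FM; set Y := L * _.
have L0 : 0 < L by exact: lt_le_trans L1.
have Y0 : 0 < Y by rewrite mulr_gt0// exprn_gt0// ltr_wpDr// ln_ge0.
have tau0 : 0 <= tau by apply: le_trans (coef_tail 0%N); rewrite sumr_ge0.
have M0 : 0 <= M := le_trans (normr_ge0 _) (FM _ (RT_trigLp p2 (fun=> 0%N))).
have nm0 (x : Lp) : 0 <= nm x by rewrite fine_ge0// Lnorm_ge0.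
have rhs0 : 0 <= M * (5 * 2 ^+ d * Y `^ 2^-1 * nm (f - g) + tau).
  by rewrite mulr_ge0// addr_ge0// !mulr_ge0 ?exprn_ge0 ?powR_ge0.
have [z|nz] := eqVneq (nm (f - g)) 0.
  by apply: le_trans rhs0; rewrite (le_trans (ler_norm _))// (le_trans (F1 _))// z.
have h0 : 0 < nm (f - g) by rewrite lt_def nz nm0.
have Fg : F g = 0.
  case: spg => c ->; rewrite linear_sum big_nat_cond big1// => j /andP[jn _].
  by rewrite linearZ/= (psi0 j jn).2 mulr0.
set h := f - g in h0 rhs0 *.
have Fh : F h = F f by rewrite /h linearB/= Fg subr0.
pose K := 1 + M * 2 ^+ d * Y.
have K0 : 0 < K.
  rewrite /K ltr_wpDr//; apply: mulr_ge0; last exact: ltW.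
  by apply: mulr_ge0 => //; exact: exprn_ge0.
(* [e] is the uniform error of a partial sum of [f]. It enters once through [F] and once for each of
   the at most [Y] coefficients in the cross, which [K] collects. *)
suff H e : 0 < e -> F h <= M * (5 * 2 ^+ d * Y `^ 2^-1 * nm h + tau) + e * K.
  apply/ler_addgt0Pr => e e0.
  have := H (e / K); rewrite divr_gt0// => /(_ isT).
  by rewrite divfK ?gt_eqF.
move=> e0.
have mf : measurable_fun setT (f : Rd R d -> R) by [].
have [N fe] := fpsum_uniform r_gt iphi mf fconv coefA e0.
pose c (a : d.-tuple 'I_N) := coef r phi (fun i => tnth a i).
pose T (a : d.-tuple 'I_N) : Lp := trigLp p2 (fun i => tnth a i).
pose S : Lp := \sum_a c a *: T a.
have SE x : S x = fpsum r phi N x.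
  rewrite /S Lp_sumE; apply: eq_bigr => a _.
  by have -> : (c a *: T a) x = c a * T a x by []; rewrite /T trigLpE.
have fS : nm (f - S) <= e.
  apply: Lp_norm_le_ae => //; first exact: ltW.
  apply: filterS fe => x.
  by have -> : (f - S) x = f x - S x by []; rewrite SE.
have FT (a : d.-tuple 'I_N) : `|F (T a)| <= M.
  have := FM _ (RT_trigLp p2 (fun i => tnth a i)).
  rewrite linearZ/= normrM normfV (gtr0_norm (tens_norm_gt0 p2 _)).
  rewrite ler_pdivrMl ?tens_norm_gt0// => /le_trans; apply.
  by rewrite ler_piMl// tens_norm_le1.
(* Indices outside [G] drop out of [F S]. An index in [G] cannot have been chosen, since [F] kills
   the chosen elements, so its coefficient is controlled by the residual. *)
pose G (a : d.-tuple 'I_N) := F (T a) != 0.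
have cG a : G a -> `|c a| <= 2 ^+ d * (`|\int[tor]_x (h x * E (fun i => tnth a i) x)| + e).
  move=> Ga; apply: coef_residual_le fe _.
  have gz : \int[tor]_x (g x * E (fun i => tnth a i) x) = 0.
    apply: span_orth spg => [j /psi0[]//|j jn jE].
    move/negP: Ga; apply; have := (psi0 j jn).2; rewrite jE linearZ/= => /eqP.
    by rewrite mulf_eq0 invr_eq0 gt_eqF// tens_norm_gt0.
  have -> : (fun x => h x * E (fun i => tnth a i) x) =
    (fun x => f x * E (fun i => tnth a i) x - g x * E (fun i => tnth a i) x).
    by apply/funext => x; rewrite -mulrBl.
  by rewrite RintegralB ?gz ?subr0//; exact: Lp_int_mul.
have FS : F S <= M * \sum_(a | G a) `|c a|.
  rewrite /S linear_sum (bigID G)/= [X in _ + X]big1 ?addr0; last first.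
    by move=> a; rewrite negbK => /eqP Fa; rewrite linearZ/= Fa mulr0.
  rewrite mulr_sumr; apply: ler_sum => a _.
  rewrite linearZ/= (le_trans (ler_norm _))// normrM mulrC ler_wpM2r//.
have Fle : F h <= M * \sum_(a | G a) `|c a| + e.
  rewrite Fh -(subrK S f) linearD/= addrC lerD//.
  exact: le_trans (ler_norm _) (le_trans (F1 _) fS).
apply: (le_trans Fle).
have -> : e * K = M * (2 ^+ d * (e * Y)) + e by rewrite /K; ring.
rewrite addrA lerD2r -mulrDr ler_wpM2l//.
rewrite (bigID (fun a => tweight R a <= L))/=.
have tl : \sum_(a | G a && ~~ (tweight R a <= L)) `|c a| <= tau.
  apply: le_trans (coef_tail N); rewrite big_mkcond [leRHS]big_mkcond/=.
  apply: ler_sum => a _; rewrite -ltNge; case: (G a) => //=.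
  by case: ifP.
suff hd : \sum_(a | G a && (tweight R a <= L)) `|c a| <=
    5 * 2 ^+ d * Y `^ 2^-1 * nm h + 2 ^+ d * (e * Y) by move: hd tl; lra.
(* After division by [nm h] the squares sum to at most 4 by [bessel_Lp], and [sum_hoelder] with both
   exponents 2 yields [(4 + 1) * Y ^ (1/2)], whence the 5 in the statement. *)
pose x (a : d.-tuple 'I_N) := `|\int[tor]_x (h x * E (fun i => tnth a i) x)| / nm h.
have x0 a : 0 <= x a by rewrite divr_ge0.
have cnt : \sum_(a : d.-tuple 'I_N | tweight R a <= L) (1 : R) `^ 2 <= Y.
  by under eq_bigr do rewrite powR1; exact: hyperbolic_count.
have X4 : \sum_(a | tweight R a <= L) x a `^ 2 <= 4.
  have sq : \int[tor]_x (h x ^+ 2) <= nm h ^+ 2 by exact: sqr_int_le.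
  apply: (@le_trans _ _ ((nm h ^+ 2)^-1 * \sum_(a : d.-tuple 'I_N) (\int[tor]_x (h x * E (fun i => tnth a i) x)) ^+ 2)).
    rewrite mulr_sumr big_mkcond; apply: ler_sum => a _; case: ifP => _.
      by rewrite powR_mulrn// /x exprMn real_normK ?num_real// exprVn mulrC.
    by rewrite mulr_ge0 ?invr_ge0 ?sqr_ge0.
  rewrite ler_pdivrMl ?exprn_gt0// mulrC.
  by apply: (le_trans (bessel_Lp h N)); rewrite ler_wpM2l.
have cs := @sum_hoelder R _ (fun a : d.-tuple 'I_N => tweight R a <= L) x (fun=> 1) 2 2 4 Y
  (ltr0n _ _) (ltr0n _ _) _ Y0 x0 (fun=> ler01) X4 cnt.
apply: (@le_trans _ _ (\sum_(a : d.-tuple 'I_N | tweight R a <= L) 2 ^+ d * (nm h * (x a * 1) + e * 1))).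
  rewrite big_mkcond [leRHS]big_mkcond; apply: ler_sum => a _.
  case: ifP => [/andP[Ga ->]|_].
    by rewrite (le_trans (cG a Ga))// /x !mulr1 mulrCA divff ?mulr1.
  case: ifP => // _; apply: mulr_ge0; first exact: exprn_ge0.
  rewrite !mulr1; apply: addr_ge0; last exact: ltW.
  exact: mulr_ge0 (nm0 h) (x0 a).
rewrite -mulr_sumr big_split/= -!mulr_sumr.
have cnt' : \sum_(a : d.-tuple 'I_N | tweight R a <= L) (1 : R) <= Y.
  exact: hyperbolic_count.
apply: (@le_trans _ _ (2 ^+ d * (nm h * ((4 + 1) * Y `^ 2^-1) + e * Y))).
  rewrite ler_wpM2l ?exprn_ge0//; apply: lerD; first by rewrite ler_wpM2l// cs//; lra.
  by rewrite ler_wpM2l// ltW.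
by rewrite le_eqVlt; apply/orP; left; apply/eqP; ring.
Qed.
End residual_concentration.

(** * Choice of the size of the cross *)

Section asymptotics.
Variable R : realType.

(** From [ln x <= x ^ ep / ep] with [ep = 1 / (4 * d.+1)], the power of the logarithm is
    [O(m ^ (1/4))]; the remaining [m ^ (- 1/4)] beats [delta]. *)
Lemma ln_expn_le d (delta : R) : 0 < delta ->
  exists N, forall m, (N <= m)%N -> 1 <= ln (m%:R : R) /\ ln m%:R ^+ d <= delta * m%:R `^ 2^-1.
Proof.
move=> delta0; pose K : R := (4 * d.+1%:R) ^+ d.
have d0 : (0 : R) < 4 * d.+1%:R by rewrite mulr_gt0.
have K0 : 0 < K by rewrite exprn_gt0.
have s0 : (0 : R) < 4^-1 by rewrite invr_gt0.
have e0 : 0 < delta / K by rewrite divr_gt0.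
have [N _ HN] := powRN_small 0 s0 e0.
exists (maxn N.+1 (Num.bound (expR 1 : R))) => m; rewrite geq_max => /andP[Nm mb].
have em : expR 1 <= m%:R :> R.
  by rewrite (le_trans (ltW (archi_boundP (expR_ge0 _))))// ler_nat.
have m0 : (0 : R) < m%:R by apply: lt_le_trans em; exact: expR_gt0.
have lm1 : (1 : R) <= ln m%:R by rewrite -[leLHS](expRK 1) ler_ln ?posrE ?expR_gt0.
split => //.
pose ep : R := (4 * d.+1%:R)^-1.
have ep0 : 0 < ep by rewrite invr_gt0.
have me0 : 0 < m%:R `^ ep by rewrite powR_gt0.
have l1 : ln m%:R <= (4 * d.+1%:R) * m%:R `^ ep.
  rewrite -ler_pdivrMl// -/ep -ln_powR -[in leLHS](subrK 1 (_ `^ _)) addrC.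
  by apply: (le_trans (le_ln1Dx _)); lra.
have l2 : ln m%:R ^+ d <= K * m%:R `^ 4^-1.
  have lm0 : 0 <= ln (m%:R : R) by apply: le_trans lm1.
  have := lerXn2r d _ _ l1; rewrite !nnegrE lm0 mulr_ge0 ?(ltW me0) ?(ltW d0)// => /(_ isT isT).
  rewrite exprMn -/K => /le_trans; apply; rewrite ler_wpM2l ?(ltW K0)//.
  rewrite -powR_mulrn ?(ltW me0)// -powRrM ler_powR//.
    by apply: le_trans em; rewrite -[leLHS]expR0 ler_expR.
  rewrite /ep invfM -mulrA ler_piMr ?invr_ge0//.
  by rewrite mulrC ler_pdivrMr// mul1r ler_nat.
apply: (le_trans l2).
have h : m%:R `^ (- 4^-1) <= delta / K.
  apply: le_trans HN; rewrite !powRN lef_pV2 ?posrE ?powR_gt0//.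
  by rewrite ge0_ler_powR ?nnegrE ?ler_nat// ltW.
have -> : delta * m%:R `^ 2^-1 = K * (delta / K * m%:R `^ 2^-1).
  by field; rewrite gt_eqF.
rewrite ler_wpM2l ?(ltW K0)//.
apply: le_trans (ler_wpM2r (powR_ge0 _ _) h).
rewrite -powRD ?(gt_eqF m0) ?implybT// le_eqVlt; apply/orP; left; apply/eqP.
by congr (_ `^ _); field.
Qed.

(* [L] is taken of order [m / (ln m) ^+ d.+1] for large [m], and [L = 1] for the
   finitely many remaining [m]. *)
Lemma rate_bound (rho eta c A2 A3 : R) d : 0 < rho -> 0 <= eta -> 0 <= rho - eta ->
  0 < c -> 0 <= A2 -> 0 <= A3 ->
  exists2 C, 0 < C & forall m x, (2 <= m)%N ->
    (forall L, 1 <= L -> x <= Num.max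
      (A3 * (L `^ (- rho) * (1 + ln L) `^ (- (d%:R * eta))))
      (A2 * expR (- c * (m%:R / (L * (1 + ln L) ^+ d))))) ->
    x <= C * (m%:R `^ (- rho) * ln m%:R `^ (d%:R * (rho - eta) + rho)).
Proof.
move=> rho0 eta0 re0 c0 A20 A30.
(* With [L = delta * m / (ln m) ^ d.+1] and [1 + ln L <= 2 * ln m], this choice makes the
   exponential at most [m ^ (- rho)]; [delta <= 1] ensures [L <= m]. *)
pose delta := Num.min 1 (c / (rho * 2 ^+ d)).
have rd0 : 0 < rho * 2 ^+ d by rewrite mulr_gt0// exprn_gt0.
have delta0 : 0 < delta by rewrite lt_min ltr01 divr_gt0.
have delta1 : delta <= 1 by rewrite ge_min lexx.
have deltac : delta * (rho * 2 ^+ d) <= c.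
  by rewrite -ler_pdivlMr// ge_min lexx orbT.
have [N HN] := ln_expn_le d.+1 delta0.
set E := d%:R * (rho - eta) + rho.
have E0 : 0 <= E by rewrite addr_ge0 ?mulr_ge0// ltW.
have ln2 : (0 : R) < ln 2 by rewrite ln_gt0// ltr1n.
(* For [2 <= m < N] the rate is at least [N.+1 ^ (- rho) * (ln 2) ^ E], and [L = 1] bounds [x] by
   [A2 + A3]. *)
pose C1 := (A2 + A3) * (N.+1%:R `^ rho * ln 2 `^ (- E)).
pose C2 := A3 * (delta `^ (- rho) * 2 `^ (d%:R * eta)).
have C10 : 0 <= C1 by rewrite /C1; do !apply: mulr_ge0; rewrite ?addr_ge0 ?powR_ge0.
have C20 : 0 <= C2 by rewrite /C2; do !apply: mulr_ge0; rewrite ?powR_ge0.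
exists (C1 + C2 + A2 + 1); first by rewrite ltr_wpDl// !addr_ge0.
move=> m x m2 Hx.
have m0 : (0 : R) < m%:R by rewrite ltr0n (leq_trans _ m2).
have lm2 : ln 2 <= ln m%:R :> R by rewrite ler_ln ?posrE// ler_nat.
have lm0 : (0 : R) < ln m%:R by apply: lt_le_trans lm2.
set Q := m%:R `^ (- rho) * ln m%:R `^ E.
have Q0 : 0 < Q by rewrite mulr_gt0// powR_gt0.
suff : x <= C1 * Q \/ x <= C2 * Q \/ x <= A2 * Q.
  have Q0' := ltW Q0.
  by case=> [|[]] /le_trans; apply; rewrite ler_wpM2r//; lra.
have [mN|Nm] := ltnP m N.
  left; have := Hx 1 (lexx _).
  rewrite ln1 addr0 expr1n !powR1 !mul1r !mulr1 => h.
  apply: (@le_trans _ _ (A2 + A3)).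
    apply: (le_trans h); rewrite ge_max lerDr A20/=.
    rewrite -[leRHS]mulr1 mulrDl mulr1 -[leLHS]addr0 lerD// ?mulr1//.
    by rewrite ler_piMr// -[leRHS]expR0 ler_expR mulNr oppr_le0 divr1 mulr_ge0// ltW.
  rewrite /C1 -mulrA ler_peMr ?addr_ge0//.
  rewrite mulrACA -[leLHS]mulr1 ler_pM//.
    rewrite powRN ler_pdivlMr ?powR_gt0// mul1r.
    by rewrite ge0_ler_powR ?nnegrE ?(ltW rho0)// ler_nat ltnW// ltnW.
  rewrite powRN mulrC ler_pdivlMr ?powR_gt0// mul1r.
  by rewrite ge0_ler_powR ?nnegrE// ltW.
have [lm1 lmd] := HN m Nm.
right; pose L := delta * m%:R / ln m%:R ^+ d.+1.
have ld0 : 0 < ln (m%:R : R) ^+ d.+1 by rewrite exprn_gt0.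
have sq0 : 0 < (m%:R : R) `^ 2^-1 by rewrite powR_gt0.
(* Together with [L <= m] this makes [1 + ln L] comparable with [ln m]; the lower bound matters
   because [1 + ln L] occurs with a negative exponent. *)
have Lm : m%:R `^ 2^-1 <= L.
  rewrite ler_pdivlMr// (le_trans (ler_wpM2l (ltW sq0) lmd))//.
  rewrite mulrCA -powRD ?(gt_eqF m0) ?implybT//.
  rewrite [X in _ `^ X](_ : _ = 1); last by field.
  by rewrite powRr1// ltW.
have L0 : 0 < L by apply: lt_le_trans Lm.
have L1 : 1 <= L.
  apply: le_trans Lm; have m1 : (1 : R) <= m%:R by rewrite ler1n (leq_trans _ m2).
  by rewrite -[leLHS](powRr0 m%:R) ler_powR// invr_ge0.
have Lle : L <= m%:R.
  rewrite ler_pdivrMr// mulrC ler_wpM2l ?(ltW m0)//.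
  by rewrite (le_trans delta1)// exprn_ege1.
have lnL0 : 0 <= ln L by exact: ln_ge0.
have low : 2^-1 * ln m%:R <= 1 + ln L.
  have : ln (m%:R `^ 2^-1) <= ln L by rewrite ler_ln ?posrE.
  rewrite ln_powR; lra.
have up : 1 + ln L <= 2 * ln m%:R.
  have : ln L <= ln m%:R by rewrite ler_ln ?posrE.
  lra.
have := Hx L L1; rewrite le_max => /orP[h|h]; [left|right]; apply: (le_trans h).
  rewrite /C2 -mulrA ler_wpM2l//.
  have LE : L `^ (- rho) = delta `^ (- rho) * (m%:R `^ (- rho) * ln m%:R `^ ((d%:R + 1) * rho)).
    rewrite /L -[(ln m%:R ^+ _)^-1]powR_inv1 ?(ltW ld0)// -powR_mulrn ?(ltW lm0)//.
    rewrite !powRM ?powR_ge0 ?(ltW delta0) ?(ltW m0) ?mulr_ge0 ?(ltW delta0) ?(ltW m0)//.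
    rewrite -[in LHS]powRrM -[in LHS]powRrM -mulrA; congr (_ * (_ * _ `^ _)).
    by rewrite -natr1; ring.
  have lE : (1 + ln L) `^ (- (d%:R * eta)) <= 2 `^ (d%:R * eta) * ln m%:R `^ (- (d%:R * eta)).
    have de0 : 0 <= d%:R * eta by rewrite mulr_ge0.
    have : (2^-1 * ln m%:R) `^ (d%:R * eta) <= (1 + ln L) `^ (d%:R * eta).
      by rewrite ge0_ler_powR ?nnegrE ?mulr_ge0 ?addr_ge0 ?invr_ge0 ?(ltW lm0).
    rewrite powRM ?invr_ge0 ?(ltW lm0)// => pl.
    have i2 : (2^-1 : R) `^ (d%:R * eta) = (2 `^ (d%:R * eta))^-1.
      by rewrite -[2^-1]powR_inv1// powRAC powR_inv1// powR_ge0.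
    have pos2 : 0 < (2 : R) `^ (d%:R * eta) by rewrite powR_gt0.
    have posl : 0 < ln (m%:R : R) `^ (d%:R * eta) by rewrite powR_gt0.
    rewrite i2 in pl.
    rewrite !powRN -[X in _ <= X * _]invrK -invfM lef_pV2// posrE.
      by rewrite powR_gt0// ltr_wpDr.
    by rewrite mulr_gt0// invr_gt0.
  rewrite LE; apply: (le_trans (ler_wpM2l _ lE)).
    by rewrite -LE powR_ge0.
  rewrite /Q le_eqVlt; apply/orP; left; apply/eqP.
  have -> : E = (d%:R + 1) * rho + - (d%:R * eta) by rewrite /E; ring.
  rewrite [ln m%:R `^ (_ + _)]powRD ?(gt_eqF lm0) ?implybT//; ring.
rewrite ler_wpM2l//.
apply: (@le_trans _ _ (m%:R `^ (- rho))).
  rewrite /powR (gt_eqF m0) ler_expR mulNr [leRHS]mulNr lerN2.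
  have den0 : 0 < L * (1 + ln L) ^+ d by rewrite mulr_gt0// exprn_gt0//; lra.
  rewrite mulrA ler_pdivlMr//.
  apply: (@le_trans _ _ (rho * ln m%:R * (L * (2 * ln m%:R) ^+ d))).
    rewrite ler_wpM2l ?mulr_ge0 ?(ltW rho0) ?(ltW lm0)// ler_wpM2l ?(ltW L0)//.
    by rewrite lerXn2r ?nnegrE// ?mulr_ge0 ?(ltW lm0)//; lra.
  have -> : rho * ln m%:R * (L * (2 * ln m%:R) ^+ d) = delta * (rho * 2 ^+ d) * m%:R.
    by rewrite /L exprMn exprS; field; rewrite expf_neq0 ?gt_eqF.
  by rewrite ler_wpM2r// ltW.
rewrite /Q ler_peMr ?powR_ge0//.
by rewrite -[leLHS](powRr0 (ln m%:R)) ler_powR.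
Qed.
End asymptotics.

(** * The rate of convergence *)

Section rate_of_convergence.
Variable R : realType.

Lemma W_mono d (r q : R) : 2 <= q -> @W R d r q `<=` @W R d r 2.
Proof.
move=> q2 f [phi [Lphi N1 fconv]]; have q1 := ge2_ge1 q2.
exists phi; split => //.
  apply: (Lfun_subset (q := q%:E)) Lphi => //; last exact: fin_num_measure.
  by rewrite lee_fin ler1n.
have := @sqr_int_le R _ _ (torus R d) q q1 q2 (Lfun_Sub q1 Lphi) 1 ltr01.
have i2 := @Lp_integrable_sqr R _ _ (torus R d) q q1 q2 (Lfun_Sub q1 Lphi).
rewrite /= in i2 *.
have -> : fine ('N[torus R d]_(q%:E)[EFin \o phi])%E <= 1.
  rewrite -lee_fin fineK// fin_numElt (lt_le_trans ltNy0) ?Lnorm_ge0//=.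
  exact: le_lt_trans N1 (ltry _).
move=> /(_ isT) h2; rewrite unlock.
have -> : (\int[torus R d]_x (`|(EFin \o phi) x| `^ 2) =
    (\int[torus R d]_x (phi x ^+ 2))%:E)%E.
  rewrite /Rintegral fineK ?integrable_fin_num//; apply: eq_integral => x _ /=.
  by rewrite powR_mulrn// real_normK// num_real.
rewrite poweR_EFin lee_fin; rewrite expr1n in h2.
have := ge0_ler_powR (r := 2^-1) _ _ _ h2.
rewrite powR1 invr_ge0 !nnegrE ler01 ler0n; apply => //.
by apply: bm_int_ge0 => x; exact: sqr_ge0.
Qed.

Lemma wcga_rate d (p q r t : R) (p2 : 2 <= p) : 0 < t -> 1 < q -> q <= 2 -> q^-1 < r ->
  let eta : R := q^-1 - 2^-1 in
  exists2 C, 0 < C & forall m (f fm : Lp d.+1 (ge2_ge1 p2)), (2 <= m)%N -> W r q f ->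
    wcga_residual (@Lp_norm R d.+1 p (ge2_ge1 p2)) (@RT R d.+1 p (ge2_ge1 p2)) t f m fm ->
    Lp_norm fm <= C * (m%:R `^ (- (r - eta)) *
      ln m%:R `^ (d%:R * (r - eta - eta) + (r - eta))).
Proof.
move=> t0 q1 q2 rq eta.
have q0 : 0 < q by lra.
have iq1 : q^-1 < 1 by rewrite invf_lt1.
have iq2 : 2^-1 <= q^-1 by rewrite lef_pV2// posrE.
have r_half : 2^-1 < r by lra.
have [A A0 HA] := coef_sum_le q1 q2 rq d.+1.
have [A1 A10 HA1] := coef_tail_le q1 q2 rq d.
pose k0 : R := 5 * 2 ^+ d.+1; have k00 : 0 < k0 by rewrite mulr_gt0// exprn_gt0.
pose B : R := 2 ^+ d.+1; have B0 : 0 < B by rewrite exprn_gt0.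
pose gam : R := 4 * smooth_cst p + 2.
have gam0 : 0 < gam by rewrite ltr_wpDl// mulr_ge0// smooth_cst_ge0.
(* The decay constant of [greedy_rate] divided by the factor of [L * l ^ d] in [kap ^ 2]. *)
pose c := t ^+ 2 / (16 * gam * B ^+ 2) / k0 ^+ 2.
have c0 : 0 < c by rewrite !divr_gt0 ?exprn_gt0// !mulr_gt0 ?exprn_gt0.
have [C C0 HC] := @rate_bound R (r - eta) eta c (A + 1) (A1 / k0) d
  ltac:(rewrite /eta; lra) ltac:(rewrite /eta; lra) ltac:(rewrite /eta; lra) c0
  ltac:(lra) (divr_ge0 (ltW A10) (ltW k00)).
exists C => // m f fm m2 [phi [Lphi N1 fconv]] res.
have iphi : (torus R d.+1).-integrable setT (EFin \o phi).
  apply/Lfun1_integrable; apply: (Lfun_subset (q := q%:E)) Lphi => //.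
  - by rewrite lee_fin ltW.
  - exact: fin_num_measure.
  - by rewrite lee_fin ltW.
apply: HC => // L L1.
have L0 : 0 < L by lra.
pose l := 1 + ln L.
have l0 : 0 < l by rewrite ltr_wpDr// ln_ge0.
pose kap := k0 * (L * l ^+ d) `^ 2^-1.
pose tau := A1 * (L `^ (q^-1 - r) * l `^ (d%:R * (1 - q^-1))).
have Y0 : 0 < L * l ^+ d by rewrite mulr_gt0// exprn_gt0.
have kap0 : 0 < kap by rewrite mulr_gt0// powR_gt0.
have tau0 : 0 <= tau by apply: mulr_ge0; [exact: ltW|apply: mulr_ge0; exact: powR_ge0].
(* Some partial sum is within 1 of [f] almost everywhere, and the moduli of its coefficients sum to
   at most [A]. *)
have nmf : Lp_norm f <= A + 1.
  have mf : measurable_fun setT (f : Rd R d.+1 -> R) by [].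
  have [N fe] := fpsum_uniform r_half iphi mf fconv (HA phi Lphi N1) ltr01.
  apply: Lp_norm_le_ae => //; first by rewrite addr_ge0.
  apply: filterS fe => x fe.
  have fpA : `|fpsum r phi N x| <= A.
    apply: le_trans (HA phi Lphi N1 N); apply: (le_trans (ler_norm_sum _ _ _)).
    by apply: ler_sum => a _; rewrite normrM ler_piMr// tens_trig_le1.
  have := ler_distD (fpsum r phi N x) (f x) 0; rewrite !subr0; lra.
have := @greedy_rate R (Lp d.+1 (ge2_ge1 p2)) (@Lp_norm R d.+1 p (ge2_ge1 p2)) _ _ gam gam0 _
  (@RT R d.+1 p (ge2_ge1 p2)) t B f kap tau t0 B0 kap0 tau0 _ _ m fm res.
move=> H; apply: le_trans (H _ _ _ _ _) _.
- by move=> x; rewrite fine_ge0// Lnorm_ge0.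
- move=> a x; rewrite /Lp_norm.
  have -> : EFin \o (a *: x : Lp d.+1 (ge2_ge1 p2)) = EFin \o (a \*: x) :> (Rd R d.+1 -> \bar R) by [].
  by rewrite LnormZ fineM// -finite_norm_fine.
- by move=> x y; exact: Lnorm_smooth.
- by move=> g; exact: RT_norm_le.
- move=> F psi k g M F1 psi0 spg FM.
  exact: (residual_concentrated r_half iphi fconv (HA phi Lphi N1) L1
    (fun N => HA1 phi Lphi N1 N L L1) F1 psi0 spg FM).
have kap2 : kap ^+ 2 = k0 ^+ 2 * (L * l ^+ d).
  by rewrite exprMn; congr (_ * _); rewrite -[LHS]powR_mulrn ?powR_ge0// -powRrM mulVf// powRr1// ltW.
rewrite ge_max !le_max; apply/andP; split; apply/orP; [left|right].
  (* In [tau / kap] the exponent of [L] is [1/q - r - 1/2 = - (r - eta)], and that of [l] is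
     [d * (1 - 1/q) - d / 2 = - d * eta]. *)
  rewrite le_eqVlt; apply/orP; left; apply/eqP; rewrite /tau /kap -/l.
  have -> : - (r - eta) = (q^-1 - r) + - 2^-1 by rewrite /eta; ring.
  have -> : - (d%:R * eta) = d%:R * (1 - q^-1) + - (d%:R * 2^-1) by rewrite /eta; field; rewrite gt_eqF.
  rewrite powRM ?exprn_ge0 ?ltW// -powR_mulrn ?(ltW l0)// -powRrM.
  rewrite [L `^ (_ - 2^-1)]powRD ?(gt_eqF L0) ?implybT// [l `^ (_ + _)]powRD ?(gt_eqF l0) ?implybT//.
  rewrite !(powRN _ 2^-1) (powRN _ (_ * 2^-1)).
  by field; rewrite ?gt_eqF ?powR_gt0.
have -> : - (t ^+ 2 / (16 * gam * B ^+ 2)) * (m%:R / kap ^+ 2) = - c * (m%:R / (L * (1 + ln L) ^+ d)).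
  by rewrite kap2 /c -/l; field; rewrite !gt_eqF ?exprn_gt0.
by rewrite ler_wpM2r// expR_ge0.
Qed.
End rate_of_convergence.

Unset Implicit Arguments.

Theorem theorem1p5 (R : realType) (d : nat) (p q r t : R)
    (d_gt0 : (0 < d)%N) (p_ge2 : 2 <= p) (t_gt0 : 0 < t) (t_le1 : t <= 1) :
  let eta : R := q^-1 - 2^-1 in
  let residual := @wcga_residual R (Lp d (ge2_ge1 p_ge2))
        (@Lp_norm R d p (ge2_ge1 p_ge2)) (@RT R d p (ge2_ge1 p_ge2)) t in
  (1 < q -> q <= 2 -> q^-1 < r ->
    exists2 C : R, 0 < C &
      forall (m : nat) (f fm : Lp d (ge2_ge1 p_ge2)),
        (2 <= m)%N -> W r q f -> residual f m fm ->
        Lp_norm fm <= C * (m%:R `^ (- r + eta) *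
          ln m%:R `^ ((d%:R - 1) * (r - 2 * eta) + r - eta))) /\
  (2 <= q -> 2^-1 < r ->
    exists2 C : R, 0 < C &
      forall (m : nat) (f fm : Lp d (ge2_ge1 p_ge2)),
        (2 <= m)%N -> W r q f -> residual f m fm ->
        Lp_norm fm <= C * (m%:R `^ (- r) * ln m%:R `^ (r * d%:R))).
Proof.
case: d d_gt0 => // d' _ eta residual.
have dE : d'.+1%:R - 1 = d'%:R :> R by rewrite -natr1 addrK.
split=> [q1 q2 rq|q2 r2].
  have [C C0 HC] := wcga_rate d' p_ge2 t_gt0 q1 q2 rq.
  exists C => // m f fm m2 Wf res.
  have := HC m f fm m2 Wf res; rewrite -/eta dE.
  have -> : - (r - eta) = - r + eta by rewrite opprB addrC.
  by have -> : d'%:R * (r - eta - eta) + (r - eta) = d'%:R * (r - 2 * eta) + r - eta by ring.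
(* For the exponent 2 the correction [eta] vanishes and the two logarithmic exponents add up to
   [r * d]. *)
have [C C0 HC] := wcga_rate d' p_ge2 t_gt0 (ltr1n R 2) (lexx 2) r2.
exists C => // m f fm m2 Wf res.
have := HC m f fm m2 (W_mono q2 Wf) res; rewrite subrr !subr0.
by have -> : d'%:R * r + r = r * d'.+1%:R by rewrite -natr1; ring.
Qed.
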